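(* Let $\nabla=f_*(\nabla_{\mathcal O})$ be the direct image of the rank-$1$ connection $\nabla_{\mathcal O}=d+\lambda_1\frac{d\xi}{y}+\lambda_2\frac{\xi\,d\xi}{y}$ on $\mathcal O_C$. With $a,b,\gamma_1,\gamma_2$ and $K,K',L,L'$ as in the context, the monodromy matrices of $\nabla$ (with respect to the fundamental matrix of the context) are $$M_a=\begin{pmatrix}e^{-2i\lambda_2K'}\cos(2\lambda_1K)&-e^{-2i\lambda_2K'}\,i\sin(2\lambda_1K)\\ -e^{-2i\lambda_2K'}\,i\sin(2\lambda_1K)&e^{-2i\lambda_2K'}\cos(2\lambda_1K)\end{pmatrix},$$ $$M_b=\begin{pmatrix}e^{2\lambda_2L'}\cosh(2\lambda_1L)&e^{2\lambda_2L'}\sinh(2\lambda_1L)\\ e^{2\lambda_2L'}\sinh(2\lambda_1L)&e^{2\lambda_2L'}\cosh(2\lambda_1L)\end{pmatrix},\qquad M_{\gamma_i}=\begin{pmatrix}1&0\\0&-1\end{pmatrix}\ (i=1,2).$$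
   Context: Let $t,t'\in\mathbb C\setminus\{0,1\}$, $t\neq t'$. $E$: $y^2=x(x-1)(x-t)$ with point at infinity $\infty$; $C$: $y^2=(t'-\xi^2)(t'-1-\xi^2)(t'-t-\xi^2)$ (smooth projective models); $f:C\to E$, $(\xi,y)\mapsto(t'-\xi^2,y)$, of degree $2$, with branch points $p_\pm=(t',\pm y_0)$, $y_0=\sqrt{t'(t'-1)(t'-t)}$, and ramification points $\tilde p_\pm=(0,\pm y_0)$; $f^{-1}(\infty)=\{\infty_+,\infty_-\}$. The loops are described for real $1<t<t'$, the general case being obtained by continuous deformation. $C$ is obtained by gluing two copies of the Riemann sphere along the cuts $[-\sqrt{t'},-\sqrt{t'-1}]$, $[-\sqrt{t'-t},\sqrt{t'-t}]$, $[\sqrt{t'-1},\sqrt{t'}]$; $\infty_+$ lies on the upper sheet, where $\operatorname{Im}y>0$ for real $\xi\to+\infty$. Put $$K=\int_{\sqrt{t'-t}}^{\sqrt{t'-1}}\frac{d\xi}{\sqrt{(t'-\xi^2)(t'-1-\xi^2)(t-t'+\xi^2)}},\quad K'=\int_{\sqrt{t'-t}}^{\sqrt{t'-1}}\frac{\xi\,d\xi}{\sqrt{(t'-\xi^2)(t'-1-\xi^2)(t-t'+\xi^2)}},$$ $$L=\int_{\sqrt{t'-1}}^{\sqrt{t'}}\frac{d\xi}{|y|},\qquad L'=\int_{\sqrt{t'-1}}^{\sqrt{t'}}\frac{\xi\,d\xi}{|y|},$$ all positive. Let $a_1,b_1$ be loops in $C\setminus\{\tilde p_\pm\}$ based at $\infty_+$,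 $a_1$ going around the segment $[\sqrt{t'-t},\sqrt{t'-1}]$ and $b_1$ around the cut $[\sqrt{t'-1},\sqrt{t'}]$, oriented so that $\int_{a_1}\frac{d\xi}y=2iK$, $\int_{a_1}\frac{\xi d\xi}y=2iK'$, $\int_{b_1}\frac{d\xi}y=-2L$, $\int_{b_1}\frac{\xi d\xi}y=-2L'$. Put $a=f_*(a_1)$, $b=f_*(b_1)$, and let $\gamma_1,\gamma_2$ be simple loops based at $\infty$ going once around $p_+$, $p_-$ respectively, such that $a,b,\gamma_1,\gamma_2$ generate $\pi_1(E\setminus\{p_\pm\},\infty)$ with $[a,b]\gamma_1\gamma_2=1$. In the basis $(1,\xi)$ of $f_*\mathcal O_C$, horizontal sections of $\nabla$ have the fundamental matrix $$\mathbf\Phi=\begin{pmatrix}e^{-\lambda_2z_2}\cosh(\lambda_1z_1)&-e^{-\lambda_2z_2}\sinh(\lambda_1z_1)\\ -\frac{e^{-\lambda_2z_2}}{\xi}\sinh(\lambda_1z_1)&\frac{e^{-\lambda_2z_2}}{\xi}\cosh(\lambda_1z_1)\end{pmatrix},$$ where $z_1=\int\frac{d\xi}y$ and $z_2=\int\frac{\xi d\xi}y$ are multivalued primitives on $C$ (with constants of integration suitably chosen). The monodromy matrix $M_\gamma$ is defined by $T_\gamma(\mathbf\Phi)=\mathbf\Phi M_\gamma$, $T_\gamma$ denoting analytic continuation along $\gamma$. *)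

(* Defs.v *)
From Stdlib Require Import Reals.
From Coquelicot Require Export Coquelicot.
Open Scope C_scope.

Definition Cexp (z : C) : C :=
  ((exp (Re z) * cos (Im z))%R, (exp (Re z) * sin (Im z))%R).
Definition Ccosh (z : C) : C := (Cexp z + Cexp (- z)) / 2.
Definition Csinh (z : C) : C := (Cexp z - Cexp (- z)) / 2.
Definition Ccos (z : C) : C := (Cexp (Ci * z) + Cexp (- (Ci * z))) / 2.
Definition Csin (z : C) : C := (Cexp (Ci * z) - Cexp (- (Ci * z))) / (2 * Ci).

(** [Ept] and [Cpt] are ambient surfaces: the affine plane together with the
    only points at infinity through which the curves pass, [0:1:0] in the
    projective plane for E, and (1:0:+-i) in the weighted projective plane
    P(1,1,3) with coordinates (xi:z:y) for C.  The curves are the subsets [onE]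
    and [onC], with the subspace topology. *)

Inductive Ept := Eaff (x y : C) | Einf.

(** [Cinf true] is infinity_+, where y / xi^3 -> i, so that Im y > 0 for real
    xi -> +oo; [Cinf false] is infinity_-. *)
Inductive Cpt := Caff (xi y : C) | Cinf (plus : bool).

Definition admissible (t t' : C) : Prop :=
  t <> 0 /\ t <> 1 /\ t' <> 0 /\ t' <> 1 /\ t <> t'.

Definition onE (t : C) (Q : Ept) : Prop :=
  match Q with
  | Eaff x y => y ^ 2 = x * (x - 1) * (x - t)
  | Einf => True
  end.

Definition onC (t t' : C) (P : Cpt) : Prop :=
  match P with
  | Caff xi y =>
      y ^ 2 = (t' - xi ^ 2) * (t' - 1 - xi ^ 2) * (t' - t - xi ^ 2)
  | Cinf _ => True
  end.

Definition fcov (t' : C) (P : Cpt) : Ept :=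
  match P with
  | Caff xi y => Eaff (t' - xi ^ 2) y
  | Cinf _ => Einf
  end.

(** E minus {p_+, p_-}: these are the points of E with x = t'. *)
Definition puncturedE (t t' : C) (Q : Ept) : Prop :=
  onE t Q /\ forall y, Q <> Eaff t' y.

(** C minus the two ramification points of f, the points of C with xi = 0. *)
Definition puncturedC (t t' : C) (P : Cpt) : Prop :=
  onC t t' P /\ forall y, P <> Caff 0 y.

(** Neighbourhood filters.  At infinity they are read in the charts
    (x / y, 1 / y) for E and (1 / xi, y / xi^3) for C. *)
Definition nbhdE (Q : Ept) (A : Ept -> Prop) : Prop :=
  exists eps : R, (0 < eps)%R /\
  match Q with
  | Eaff x0 y0 =>
      forall x y, (Cmod (x - x0) < eps)%R -> (Cmod (y - y0) < eps)%R ->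
        A (Eaff x y)
  | Einf =>
      A Einf /\
      forall x y, (1 < eps * Cmod y)%R -> (Cmod x < eps * Cmod y)%R ->
        A (Eaff x y)
  end.

Definition slope_at_infinity (plus : bool) : C := if plus then Ci else - Ci.

Definition nbhdC (P : Cpt) (A : Cpt -> Prop) : Prop :=
  exists eps : R, (0 < eps)%R /\
  match P with
  | Caff xi0 y0 =>
      forall xi y, (Cmod (xi - xi0) < eps)%R -> (Cmod (y - y0) < eps)%R ->
        A (Caff xi y)
  | Cinf b =>
      A (Cinf b) /\
      forall xi y, (1 < eps * Cmod xi)%R ->
        (Cmod (y / xi ^ 3 - slope_at_infinity b) < eps)%R -> A (Caff xi y)
  end.

Definition nearE (t : C) (Q : Ept) (A : Ept -> Prop) : Prop :=
  nbhdE Q (fun Q' => onE t Q' -> A Q').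
Definition nearC (t t' : C) (P : Cpt) (A : Cpt -> Prop) : Prop :=
  nbhdC P (fun P' => onC t t' P' -> A P').

Definition nbhd_plane : C -> (C -> Prop) -> Prop := @locally C_UniformSpace.

Definition I01 (r : R) : Prop := (0 <= r <= 1)%R.
Definition square01 (q : R * R) : Prop := I01 (fst q) /\ I01 (snd q).

Definition continuous_path {T : Type} (N : T -> (T -> Prop) -> Prop)
    (g : R -> T) : Prop :=
  forall r, I01 r -> filterlim g (within I01 (locally r)) (N (g r)).

Definition continuous_square {T : Type} (N : T -> (T -> Prop) -> Prop)
    (H : R -> R -> T) : Prop :=
  forall s r, square01 (s, r) ->
    filterlim (fun q : R * R => H (fst q) (snd q))
      (within square01 (locally (s, r))) (N (H s r)).

Definition pathE (t t' : C) (g : R -> Ept) : Prop :=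
  continuous_path nbhdE g /\ forall r, I01 r -> puncturedE t t' (g r).

Definition loopE (t t' : C) (g : R -> Ept) : Prop :=
  pathE t t' g /\ g 0%R = Einf /\ g 1%R = Einf.

Definition loopC (t t' : C) (c : R -> Cpt) : Prop :=
  continuous_path nbhdC c /\ (forall r, I01 r -> puncturedC t t' (c r)) /\
  c 0%R = Cinf true /\ c 1%R = Cinf true.

Definition concat {T : Type} (g h : R -> T) : R -> T :=
  fun r => if Rle_dec r (1 / 2) then g (2 * r)%R else h (2 * r - 1)%R.
Definition reverse {T : Type} (g : R -> T) : R -> T := fun r => g (1 - r)%R.

Definition homotopicE (t t' : C) (g h : R -> Ept) : Prop :=
  exists H : R -> R -> Ept,
    continuous_square nbhdE H /\
    (forall s r, square01 (s, r) -> puncturedE t t' (H s r)) /\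
    (forall s, I01 s -> H s 0%R = Einf /\ H s 1%R = Einf) /\
    (forall r, I01 r -> H 0%R r = g r /\ H 1%R r = h r).

(** Loops whose class lies in the subgroup of pi_1(E minus {p_+, p_-}, infinity)
    generated by the classes of the loops in [S]. *)
Inductive in_subgroup (t t' : C) (S : (R -> Ept) -> Prop) :
    (R -> Ept) -> Prop :=
| sub_gen : forall g, S g -> in_subgroup t t' S g
| sub_one : in_subgroup t t' S (fun _ => Einf)
| sub_mul : forall g h, in_subgroup t t' S g -> in_subgroup t t' S h ->
    in_subgroup t t' S (concat g h)
| sub_inv : forall g, in_subgroup t t' S g -> in_subgroup t t' S (reverse g)
| sub_homotopic : forall g h, in_subgroup t t' S g -> homotopicE t t' g h ->
    in_subgroup t t' S h.

Definition generate_pi1 (t t' : C) (a b g1 g2 : R -> Ept) : Prop :=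
  forall g, loopE t t' g ->
    in_subgroup t t' (fun h => h = a \/ h = b \/ h = g1 \/ h = g2) g.

(** [a,b] g1 g2 = 1 with [a,b] = a b a^-1 b^-1, paths being composed from left
    to right. *)
Definition surface_relation (t t' : C) (a b g1 g2 : R -> Ept) : Prop :=
  homotopicE t t'
    (concat (concat (concat (concat (concat a b) (reverse a)) (reverse b)) g1)
            g2)
    (fun _ => Einf).

Definition unit_circle (r : R) : C := (cos (2 * PI * r), sin (2 * PI * r)).

(** [g] is a simple loop going once around p = (t', w): it does not
    self-intersect, and is homotopic to a lasso [s c s^-1] where [c] runs once,
    in either direction, along the boundary of a disc of E centred at p, the
    graph of a continuous branch [Y] of y over |x - t'| <= rho. *)
Definition simple_loop_around (t t' w : C) (g : R -> Ept) : Prop :=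
  loopE t t' g /\
  (forall r r', (0 <= r < 1)%R -> (0 <= r' < 1)%R -> g r = g r' -> r = r') /\
  exists (rho : R) (Y : C -> C) (u : R -> C) (s : R -> Ept),
    let D := fun x : C => (Cmod (x - t') <= rho)%R in
    let c := fun r => Eaff (t' + rho * u r) (Y (t' + rho * u r)) in
    (0 < rho)%R /\
    (forall x, D x -> filterlim Y (within D (nbhd_plane x)) (nbhd_plane (Y x))) /\
    (forall x, D x -> onE t (Eaff x (Y x))) /\ Y t' = w /\
    (u = unit_circle \/ u = reverse unit_circle) /\
    pathE t t' s /\ s 0%R = Einf /\ s 1%R = c 0%R /\
    homotopicE t t' g (concat s (concat c (reverse s))).

Definition xi_coord (P : Cpt) : C :=
  match P with Caff xi _ => xi | Cinf _ => 0 end.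
Definition inv_xi (P : Cpt) : C :=
  match P with Caff xi _ => / xi | Cinf _ => 0 end.

Definition coordC (P : Cpt) : Cpt -> C :=
  match P with
  | Caff _ y =>
      if Ceq_dec y 0
      then fun P' => match P' with Caff _ y' => y' | Cinf _ => 0 end
      else xi_coord
  | Cinf _ => inv_xi
  end.

Definition coordE (Q : Ept) : Ept -> C :=
  match Q with
  | Eaff _ y =>
      if Ceq_dec y 0
      then fun Q' => match Q' with Eaff _ y' => y' | Einf => 0 end
      else fun Q' => match Q' with Eaff x' _ => x' | Einf => 0 end
  | Einf => fun Q' => match Q' with Eaff x' y' => x' / y' | Einf => 0 end
  end.

(** [coordC P] and [coordE Q] are local coordinates of the curves at P and Q;
    [h] has complex derivative [d] at [P], along the curve, with respect to the
    coordinate [coordC P]; when P = (xi, y) with y <> 0 this is dh/dxi. *)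
Definition derivC (t t' : C) (h : Cpt -> C) (P : Cpt) (d : C) : Prop :=
  filterlim (fun P' => (h P' - h P) / (coordC P P' - coordC P P))
    (within (fun P' => onC t t' P' /\ P' <> P) (nbhdC P)) (nbhd_plane d).

Definition derivE (t : C) (h : Ept -> C) (Q : Ept) (d : C) : Prop :=
  filterlim (fun Q' => (h Q' - h Q) / (coordE Q Q' - coordE Q Q))
    (within (fun Q' => onE t Q' /\ Q' <> Q) (nbhdE Q)) (nbhd_plane d).

(** Near [P], [h] is holomorphic with dh = w dxi, for a form w dxi regular on C.
    It is enough to compare the two forms where xi is a local coordinate, since
    the other points are isolated. *)
Definition primitive_near (t t' : C) (w : C -> C -> C) (h : Cpt -> C) (P : Cpt)
    : Prop :=
  nearC t t' P (fun P' =>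
    (exists d, derivC t t' h P' d) /\
    forall xi y, P' = Caff xi y -> y <> 0 -> derivC t t' h P' (w xi y)).

(** A form w dxi is given by its coefficient w. *)
Definition omega1 (xi y : C) : C := / y.
Definition omega2 (xi y : C) : C := xi / y.

(** [v] is the integral of w dxi along the continuous path [c]: [zeta] is the
    continuation along [c] of a local primitive. *)
Definition is_integral (t t' : C) (w : C -> C -> C) (c : R -> Cpt) (v : C)
    : Prop :=
  exists zeta : R -> C,
    v = zeta 1%R - zeta 0%R /\
    forall s, I01 s -> exists h : Cpt -> C,
      primitive_near t t' w h (c s) /\
      within I01 (locally s) (fun r => zeta r = h (c r)).

Section RealHalfPeriods.
Local Open Scope R_scope.
Variables t t' : R.

Definition K_integrand (x : R) : R :=
  / sqrt ((t' - x ^ 2) * (t' - 1 - x ^ 2) * (t - t' + x ^ 2)).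
Definition abs_y (x : R) : R :=
  sqrt (Rabs ((t' - x ^ 2) * (t' - 1 - x ^ 2) * (t' - t - x ^ 2))).

Definition K_real : R :=
  RInt_gen (fun x => K_integrand x)
    (at_right (sqrt (t' - t))) (at_left (sqrt (t' - 1))).
Definition K'_real : R :=
  RInt_gen (fun x => x * K_integrand x)
    (at_right (sqrt (t' - t))) (at_left (sqrt (t' - 1))).
Definition L_real : R :=
  RInt_gen (fun x => / abs_y x)
    (at_right (sqrt (t' - 1))) (at_left (sqrt t')).
Definition L'_real : R :=
  RInt_gen (fun x => x / abs_y x)
    (at_right (sqrt (t' - 1))) (at_left (sqrt t')).
End RealHalfPeriods.

(** In C minus the ramification points of f, the loop [c] is freely homotopic
    to a lift of the circle with real diameter [l, u]. *)
Definition goes_around_circle (t t' : C) (l u : R) (c : R -> Cpt) : Prop :=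
  exists (H : R -> R -> Cpt) (y : R -> C),
    continuous_square nbhdC H /\
    (forall s r, square01 (s, r) -> puncturedC t t' (H s r)) /\
    (forall s, I01 s -> H s 0%R = H s 1%R) /\
    (forall r, I01 r -> H 0%R r = c r) /\
    (forall r, I01 r ->
       H 1%R r = Caff ((l + u) / 2 + (u - l) / 2 * unit_circle r) (y r)).

(** For real 1 < t < t', [a1] goes around [sqrt (t'-t), sqrt (t'-1)] and [b1]
    around [sqrt (t'-1), sqrt t']: around a circle which encloses this segment,
    but neither 0 nor the other branch points of xi. *)
Definition go_around_segments (t t' : R) (a1 b1 : R -> Cpt) : Prop :=
  (exists l u : R,
     (0 < l < sqrt (t' - t))%R /\ (sqrt (t' - 1) < u < sqrt t')%R /\
     goes_around_circle t t' l u a1) /\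
  (exists l u : R,
     (sqrt (t' - t) < l < sqrt (t' - 1))%R /\ (sqrt t' < u)%R /\
     goes_around_circle t t' l u b1).

Definition normalized_loops (t t' K K' L L' : C) (a1 b1 : R -> Cpt) : Prop :=
  loopC t t' a1 /\ loopC t t' b1 /\
  is_integral t t' omega1 a1 (2 * Ci * K) /\
  is_integral t t' omega2 a1 (2 * Ci * K') /\
  is_integral t t' omega1 b1 (- 2 * L) /\
  is_integral t t' omega2 b1 (- 2 * L').

(** The loops a_1, b_1 and the numbers K, K', L, L' attached to (t, t'): they
    are obtained by continuous deformation, over a path (T, T') of admissible
    parameters ending at (t, t'), from those of a real pair 1 < t0 < t0', which
    are given by the explicit segments and integrals.  The case of real
    1 < t < t' is that of a constant deformation. *)
Definition marking (t t' K K' L L' : C) (a1 b1 : R -> Cpt) : Prop :=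
  exists (T T' KK KK' LL LL' : R -> C) (A B : R -> R -> Cpt) (t0 t0' : R),
    (continuous_path nbhd_plane T /\ continuous_path nbhd_plane T') /\
    (continuous_path nbhd_plane KK /\ continuous_path nbhd_plane KK' /\
     continuous_path nbhd_plane LL /\ continuous_path nbhd_plane LL') /\
    (continuous_square nbhdC A /\ continuous_square nbhdC B) /\
    (forall s, I01 s ->
       admissible (T s) (T' s) /\
       normalized_loops (T s) (T' s) (KK s) (KK' s) (LL s) (LL' s)
         (A s) (B s)) /\
    ((1 < t0 < t0')%R /\ T 0%R = t0 /\ T' 0%R = t0' /\
     KK 0%R = K_real t0 t0' /\ KK' 0%R = K'_real t0 t0' /\
     LL 0%R = L_real t0 t0' /\ LL' 0%R = L'_real t0 t0' /\
     go_around_segments t0 t0' (A 0%R) (B 0%R)) /\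
    (T 1%R = t /\ T' 1%R = t' /\
     KK 1%R = K /\ KK' 1%R = K' /\ LL 1%R = L /\ LL' 1%R = L' /\
     forall r, I01 r -> A 1%R r = a1 r /\ B 1%R r = b1 r).

(** The function s1 + xi s2 on the preimage of U in C, that is the section of
    f_* O_C over U with components (s1, s2) in the basis (1, xi). *)
Definition section_of (t' : C) (s1 s2 : Ept -> C) (P : Cpt) : C :=
  s1 (fcov t' P) + xi_coord P * s2 (fcov t' P).

(** nabla_O h = 0 at the point (xi, y) of C, y <> 0, where
    nabla_O = d + lam1 dxi / y + lam2 xi dxi / y. *)
Definition nablaO_zero (t t' lam1 lam2 : C) (h : Cpt -> C) (xi y : C) : Prop :=
  exists d, derivC t t' h (Caff xi y) d /\
    d + (lam1 * omega1 xi y + lam2 * omega2 xi y) * h (Caff xi y) = 0.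

(** Near [Q], s1 and s2 are holomorphic and the section s1 + xi s2 is horizontal
    for the direct image of nabla_O, which is nabla_O acting on functions on the
    preimage in C.  The equation is imposed on the dense set where xi is a
    local coordinate; it leaves out infinity, where xi has a pole. *)
Definition horizontal_near (t t' lam1 lam2 : C) (s1 s2 : Ept -> C) (Q : Ept)
    : Prop :=
  nearE t Q (fun Q' =>
    (exists d, derivE t s1 Q' d) /\ (exists d, derivE t s2 Q' d) /\
    forall xi y, onC t t' (Caff xi y) -> fcov t' (Caff xi y) = Q' -> y <> 0 ->
      nablaO_zero t t' lam1 lam2 (section_of t' s1 s2) xi y).

Definition mat2 := matrix (T := C) 2 2.
Definition entry (G : Ept -> mat2) (i j : nat) (Q : Ept) : C :=
  coeff_mat (T := C) 0 (G Q) i j.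

(** The columns of [G] form a basis of horizontal sections near infinity. *)
Definition fundamental_matrix (t t' lam1 lam2 : C) (G : Ept -> mat2) : Prop :=
  (forall j, (j < 2)%nat ->
     horizontal_near t t' lam1 lam2 (entry G 0 j) (entry G 1 j) Einf) /\
  nearE t Einf (fun Q => Q <> Einf ->
    entry G 0 0 Q * entry G 1 1 Q - entry G 0 1 Q * entry G 1 0 Q <> 0).

Definition Phi_matrix (lam1 lam2 : C) (z1 z2 : Cpt -> C) (P : Cpt) : mat2 :=
  let e := Cexp (- (lam2 * z2 P)) in
  let ch := Ccosh (lam1 * z1 P) in
  let sh := Csinh (lam1 * z1 P) in
  [ [ e * ch, - (e * sh) ],
    [ - (e * inv_xi P * sh), e * inv_xi P * ch ] ].

(** [G] is the germ at infinity on E of the matrix Phi: f maps a neighbourhood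
    of infinity_+ isomorphically onto a neighbourhood of infinity. *)
Definition is_Phi_germ (t t' lam1 lam2 : C) (z1 z2 : Cpt -> C)
    (G : Ept -> mat2) : Prop :=
  nearC t t' (Cinf true)
    (fun P => G (fcov t' P) = Phi_matrix lam1 lam2 z1 z2 P).

Definition same_germ (t : C) (Q : Ept) (G H : Ept -> mat2) : Prop :=
  nearE t Q (fun Q' => G Q' = H Q').

(** [G1], a germ at the end of [g], is the analytic continuation along [g] of
    [G0], a germ at its origin. *)
Definition continuation (t : C) (g : R -> Ept) (G0 G1 : Ept -> mat2) : Prop :=
  exists G : R -> Ept -> mat2,
    same_germ t (g 0%R) (G 0%R) G0 /\ same_germ t (g 1%R) (G 1%R) G1 /\
    forall s, I01 s ->
      (forall i j, (i < 2)%nat -> (j < 2)%nat ->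
         nearE t (g s) (fun Q => exists d, derivE t (entry (G s) i j) Q d)) /\
      within I01 (locally s) (fun r => same_germ t (g r) (G r) (G s)).

(** T_g (G) = G M: as G is invertible near infinity and continuation along a
    path is unique, this determines M. *)
Definition has_monodromy (t : C) (g : R -> Ept) (G : Ept -> mat2) (M : mat2)
    : Prop :=
  continuation t g G (fun Q => Mmult (T := C_Ring) (G Q) M).

Definition M_a (lam1 lam2 K K' : C) : mat2 :=
  let e := Cexp (- (2 * Ci * lam2 * K')) in
  [ [ e * Ccos (2 * lam1 * K), - (e * (Ci * Csin (2 * lam1 * K))) ],
    [ - (e * (Ci * Csin (2 * lam1 * K))), e * Ccos (2 * lam1 * K) ] ].

Definition M_b (lam1 lam2 L L' : C) : mat2 :=
  let e := Cexp (2 * lam2 * L') in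
  [ [ e * Ccosh (2 * lam1 * L), e * Csinh (2 * lam1 * L) ],
    [ e * Csinh (2 * lam1 * L), e * Ccosh (2 * lam1 * L) ] ].

Definition M_gamma : mat2 := [ [ RtoC 1, RtoC 0 ], [ RtoC 0, RtoC (-1) ] ].

(* Main.v *)
(** A primitive z of either form is only defined up to a constant, and up to the
    sheet of f.  Continuing it along a loop based at infinity that is lifted to
    C therefore acts by z -> z + c if the lift closes up, where c is the integral
    of the form over the lifted loop, and ends on the other sheet otherwise.  The
    deck transformation s : (xi, y) -> (-xi, y) sends dxi / y to its opposite and
    fixes xi dxi / y.  A loop around p_+ or p_- is homotopic to a lasso, whose
    circle lifts to half a circle around a fixed point of s; contracting it shows
    that z2 becomes z2 o s, while z1 becomes 2 x - z1 o s, where x is the value of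
    z1 continued to the ramification point.  As the translations attached to a and
    b commute, the relation [a, b] g1 g2 = 1 forces x to be the same for g1 and g2,
    and x = 0 for a suitable constant of integration.  The monodromy matrices are
    then read off from the addition formulas for cosh and sinh.

    Local primitives exist by Goursat's lemma.  Both f and the germs of primitives
    on C are coverings, so that continuation along a path exists, is unique and
    depends only on the homotopy class of the path. *)

Require Import Defs.
From Stdlib Require Import Reals Lra Lia Psatz Classical ClassicalEpsilon.
From Coquelicot Require Import Coquelicot.
Open Scope C_scope.

(** Two coverings of different kinds occur: f over E without its branch points, with a group of two
    elements, and germs of primitives over the whole of C, with the additive group of constants.
    Both are instances of [is_covering], where a section is a function defined everywhere of which
    only the germ counts, and a relation replaces equality in the fibres, so that no total space has
    to be given a topology.

    A circle around a branch point cannot be contracted in the punctured E, over which f is a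
    covering. Its lift can be contracted in C, because the forms are regular at the ramification
    points; hence the base of the second covering includes these points.

    Derivatives on the curves refer to a coordinate that changes with the point. Charts at the three
    kinds of points of C ([y <> 0], [y = 0], infinity) turn such statements into statements on the
    plane near 0. The equation of a primitive need not be imposed at the centre of a chart, so
    uniqueness up to a constant has to rest on continuity there. *)

(** * Limits in the complex plane *)

Lemma nbhd_planeP (x : C) (A : C -> Prop) :
  nbhd_plane x A <->
  exists eps : R, (0 < eps)%R /\ forall y, (Cmod (y - x) < eps)%R -> A y.
Proof.
  split.
  - intros [eps H]. exists eps. split. apply cond_pos.
    intros y Hy. apply H. apply C_NormedModule_mixin_compat1, Hy.
  - intros [eps [He H]].
    (* The balls of [C_UniformSpace] are squares; one of half side [eps / sqrt 2] lies in the disc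
       of radius [eps]. *)
    assert (Hs : (0 < sqrt 2)%R) by (apply sqrt_lt_R0; lra).
    assert (Hp : (0 < eps / sqrt 2)%R) by (apply Rdiv_lt_0_compat; lra).
    exists (mkposreal _ Hp). intros y Hy. apply H.
    apply (C_NormedModule_mixin_compat2 x y (mkposreal _ Hp)) in Hy.
    change (minus y x) with (y - x) in Hy. simpl in Hy.
    replace (sqrt 2 * (eps / sqrt 2))%R with eps in Hy by (field; lra).
    exact Hy.
Qed.

Global Instance nbhd_plane_filter (x : C) : ProperFilter (nbhd_plane x).
Proof. apply (locally_filter (T := C_UniformSpace)). Qed.

Lemma climP {T : Type} (F : (T -> Prop) -> Prop) {FF : Filter F} (g : T -> C) (l : C) :
  filterlim g F (nbhd_plane l) <->
  forall eps : R, (0 < eps)%R -> F (fun p => (Cmod (g p - l) < eps)%R).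
Proof.
  split.
  - intros H eps He. apply (H (fun y => (Cmod (y - l) < eps)%R)).
    apply nbhd_planeP. exists eps. auto.
  - intros H A HA. apply nbhd_planeP in HA. destruct HA as [eps [He HA]].
    unfold filtermap. generalize (H eps He). apply filter_imp. auto.
Qed.

Lemma nbhd_plane_ball (x : C) (eps : R) :
  (0 < eps)%R -> nbhd_plane x (fun y => (Cmod (y - x) < eps)%R).
Proof. intros. apply nbhd_planeP. exists eps. auto. Qed.

Lemma nbhd_plane_self (x : C) (A : C -> Prop) : nbhd_plane x A -> A x.
Proof.
  intros H. apply nbhd_planeP in H. destruct H as [eps [He H]].
  apply H. replace (x - x) with (RtoC 0) by ring. rewrite Cmod_0. exact He.
Qed.

Lemma nbhd_plane_open (x : C) (A : C -> Prop) :
  nbhd_plane x A -> nbhd_plane x (fun y => nbhd_plane y A).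
Proof. apply (locally_locally (T := C_UniformSpace)). Qed.

Lemma Cmod_minus_sym (x y : C) : Cmod (x - y) = Cmod (y - x).
Proof. rewrite <- Cmod_opp. f_equal. ring. Qed.

Lemma Cmod_minus_triangle (x y : C) : (Cmod x - Cmod y <= Cmod (x - y))%R.
Proof.
  generalize (Cmod_triangle (x - y) y). replace (x - y + y) with x by ring. lra.
Qed.

Lemma filterlim_within {T U : Type} (D : T -> Prop) (F : (T -> Prop) -> Prop) {FF : Filter F}
    (G : (U -> Prop) -> Prop) (f : T -> U) :
  filterlim f F G -> filterlim f (within D F) G.
Proof.
  intros H A HA. generalize (H A HA). unfold filtermap, within. apply filter_imp. auto.
Qed.

Section Limits.
Context {T : Type} {F : (T -> Prop) -> Prop} {FF : Filter F}.
Implicit Types f g : T -> C.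

Lemma clim_const (l : C) : filterlim (fun _ : T => l) F (nbhd_plane l).
Proof. apply filterlim_const. Qed.

Lemma clim_plus f g (lf lg : C) :
  filterlim f F (nbhd_plane lf) -> filterlim g F (nbhd_plane lg) ->
  filterlim (fun p => f p + g p) F (nbhd_plane (lf + lg)).
Proof.
  intros Hf Hg. apply climP; [exact FF|]. intros eps He.
  apply climP with (eps := (eps / 2)%R) in Hf; [|exact FF|lra].
  apply climP with (eps := (eps / 2)%R) in Hg; [|exact FF|lra].
  generalize (filter_and _ _ Hf Hg). apply filter_imp. intros p [H1 H2].
  replace (f p + g p - (lf + lg)) with ((f p - lf) + (g p - lg)) by ring.
  eapply Rle_lt_trans; [apply Cmod_triangle|lra].
Qed.

Lemma clim_mult f g (lf lg : C) :
  filterlim f F (nbhd_plane lf) -> filterlim g F (nbhd_plane lg) ->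
  filterlim (fun p => f p * g p) F (nbhd_plane (lf * lg)).
Proof.
  intros Hf Hg. apply climP; [exact FF|]. intros eps He.
  (* Once both errors are below [e <= 1], the three terms of the expansion add up to at most
     [e * M]. *)
  set (M := (1 + Cmod lf + Cmod lg)%R).
  assert (HM : (1 <= M)%R)
    by (unfold M; generalize (Cmod_ge_0 lf) (Cmod_ge_0 lg); lra).
  set (e := Rmin 1 (eps / (2 * M))).
  assert (Hq : (0 < eps / (2 * M))%R) by (apply Rdiv_lt_0_compat; lra).
  assert (He' : (0 < e)%R) by (apply Rmin_glb_lt; lra).
  apply climP with (eps := e) in Hf; [|exact FF|exact He'].
  apply climP with (eps := e) in Hg; [|exact FF|exact He'].
  generalize (filter_and _ _ Hf Hg). apply filter_imp. intros p [H1 H2].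
  replace (f p * g p - lf * lg) with ((f p - lf) * (g p - lg)
     + ((f p - lf) * lg + lf * (g p - lg))) by ring.
  assert (E1 := Rmin_l 1 (eps / (2 * M))). assert (E2 := Rmin_r 1 (eps / (2 * M))).
  fold e in E1, E2.
  assert (E3 : (e * M <= eps / 2)%R).
  { replace (eps / 2)%R with (eps / (2 * M) * M)%R by (field; lra).
    apply Rmult_le_compat_r; lra. }
  eapply Rle_lt_trans; [apply Cmod_triangle|].
  eapply Rle_lt_trans; [apply Rplus_le_compat_l, Cmod_triangle|].
  rewrite !Cmod_mult.
  generalize (Cmod_ge_0 lf) (Cmod_ge_0 lg) (Cmod_ge_0 (f p - lf)) (Cmod_ge_0 (g p - lg)).
  intros. unfold M in E3. nra.
Qed.

Lemma clim_opp f (lf : C) :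
  filterlim f F (nbhd_plane lf) -> filterlim (fun p => - f p) F (nbhd_plane (- lf)).
Proof.
  intros Hf. apply climP; [exact FF|]. intros eps He.
  apply climP with (eps := eps) in Hf; [|exact FF|exact He].
  generalize Hf. apply filter_imp. intros p Hp.
  replace (- f p - - lf) with (- (f p - lf)) by ring. rewrite Cmod_opp. exact Hp.
Qed.

Lemma clim_minus f g (lf lg : C) :
  filterlim f F (nbhd_plane lf) -> filterlim g F (nbhd_plane lg) ->
  filterlim (fun p => f p - g p) F (nbhd_plane (lf - lg)).
Proof. intros Hf Hg. apply clim_plus; [exact Hf|apply clim_opp, Hg]. Qed.

Lemma clim_inv f (lf : C) : lf <> 0 ->
  filterlim f F (nbhd_plane lf) -> filterlim (fun p => / f p) F (nbhd_plane (/ lf)).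
Proof.
  intros H0 Hf. apply climP; [exact FF|]. intros eps He.
  assert (Hm : (0 < Cmod lf)%R) by (apply Cmod_gt_0; exact H0).
  set (e := Rmin (Cmod lf / 2) (eps * (Cmod lf * Cmod lf / 2))).
  assert (He' : (0 < e)%R).
  { apply Rmin_glb_lt; [lra|]. apply Rmult_lt_0_compat; nra. }
  apply climP with (eps := e) in Hf; [|exact FF|exact He'].
  generalize Hf. apply filter_imp. intros p Hp.
  assert (E1 := Rmin_l (Cmod lf / 2) (eps * (Cmod lf * Cmod lf / 2))).
  assert (E2 := Rmin_r (Cmod lf / 2) (eps * (Cmod lf * Cmod lf / 2))). fold e in E1, E2.
  assert (Hl : (Cmod lf / 2 < Cmod (f p))%R).
  { generalize (Cmod_minus_triangle lf (f p)). rewrite Cmod_minus_sym. lra. }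
  assert (Hp0 : f p <> 0) by (apply Cmod_gt_0; lra).
  replace (/ f p - / lf) with (- (f p - lf) * / (f p * lf)) by (field; auto).
  rewrite Cmod_mult, Cmod_opp, Cmod_inv, Cmod_mult by (apply Cmult_neq_0; auto).
  apply Rmult_lt_reg_r with (Cmod (f p) * Cmod lf)%R; [nra|].
  rewrite Rmult_assoc, Rinv_l by nra. nra.
Qed.

Lemma clim_div f g (lf lg : C) : lg <> 0 ->
  filterlim f F (nbhd_plane lf) -> filterlim g F (nbhd_plane lg) ->
  filterlim (fun p => f p / g p) F (nbhd_plane (lf / lg)).
Proof. intros H0 Hf Hg. apply clim_mult; [exact Hf|apply clim_inv; assumption]. Qed.

Lemma clim_pow f (lf : C) (n : nat) :
  filterlim f F (nbhd_plane lf) -> filterlim (fun p => f p ^ n) F (nbhd_plane (lf ^ n)).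
Proof.
  intros Hf. induction n as [|n IH].
  - apply clim_const.
  - apply (clim_mult f (fun p => f p ^ n)); assumption.
Qed.

Lemma clim_neq_0 f (lf : C) : lf <> 0 ->
  filterlim f F (nbhd_plane lf) -> F (fun p => f p <> 0).
Proof.
  intros H0 Hf. apply climP with (eps := Cmod lf) in Hf; [|exact FF|apply Cmod_gt_0; exact H0].
  generalize Hf. apply filter_imp. intros p Hp E. rewrite E in Hp.
  rewrite <- Cmod_opp in Hp. replace (- (0 - lf)) with lf in Hp by ring. lra.
Qed.

Lemma clim_mult3 f g h (lf lg lh : C) :
  filterlim f F (nbhd_plane lf) -> filterlim g F (nbhd_plane lg) -> filterlim h F (nbhd_plane lh) ->
  filterlim (fun p => f p * g p * h p) F (nbhd_plane (lf * lg * lh)).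
Proof.
  intros Hf Hg Hh. apply (clim_mult (fun p => f p * g p) h); [|exact Hh].
  apply (clim_mult f g); assumption.
Qed.

Lemma clim_ext f g (l : C) :
  F (fun p => f p = g p) -> filterlim f F (nbhd_plane l) -> filterlim g F (nbhd_plane l).
Proof. intros H. apply filterlim_ext_loc, H. Qed.

Lemma clim_Re_pos f (l : C) : (0 < Re l)%R ->
  filterlim f F (nbhd_plane l) -> F (fun p => (0 < Re (f p))%R).
Proof.
  intros H0 Hf. apply climP with (eps := Re l) in Hf; [|exact FF|exact H0].
  generalize Hf. apply filter_imp. intros p Hp.
  generalize (re_le_Cmod (f p - l)). intros H.
  apply (Rle_lt_trans _ _ _ H) in Hp. apply Rabs_def2 in Hp.
  simpl in *. unfold Re in *. simpl in Hp. lra.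
Qed.
End Limits.

Lemma clim_id (z : C) : filterlim (fun x : C => x) (nbhd_plane z) (nbhd_plane z).
Proof. apply filterlim_id. Qed.

(** * Complex differentiation *)

(** Complex differentiability over the field [C_AbsRing], whose balls are discs for [Cmod], whereas
    those of [nbhd_plane] are squares. [cderivP] and [cderiv_quotient] translate between the two. *)
Definition cderiv (g : C -> C) (v d : C) : Prop :=
  is_derive (K := C_AbsRing) (V := AbsRing_NormedModule C_AbsRing) g v d.

Lemma cderivP (g : C -> C) (v d : C) :
  cderiv g v d <->
  forall eps : R, (0 < eps)%R -> exists delta : R, (0 < delta)%R /\
    forall w, (Cmod (w - v) < delta)%R ->
      (Cmod (g w - g v - d * (w - v)) <= eps * Cmod (w - v))%R.
Proof.
  split.
  - intros [_ H] eps He.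
    specialize (H v (fun P H => H) (mkposreal _ He)).
    destruct H as [delta H].
    exists delta. split; [apply cond_pos|]. intros w Hw.
    specialize (H w Hw). simpl in H.
    replace (d * (w - v)) with ((w - v) * d) by ring. exact H.
  - intros H. split; [apply is_linear_scal_l|].
    intros x Hx.
    apply (is_filter_lim_locally_unique (V := AbsRing_NormedModule C_AbsRing)) in Hx.
    subst x.
    intros eps. destruct (H eps (cond_pos eps)) as [delta [Hd H']].
    exists (mkposreal _ Hd). intros w Hw. specialize (H' w Hw).
    replace (d * (w - v)) with ((w - v) * d) in H' by ring. exact H'.
Qed.

Lemma cderiv_quotient (g : C -> C) (v d : C) :
  cderiv g v d <->
  filterlim (fun w => (g w - g v) / (w - v))
    (within (fun w => w <> v) (nbhd_plane v)) (nbhd_plane d).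
Proof.
  rewrite cderivP, climP by typeclasses eauto. split.
  - intros H eps He. destruct (H (eps / 2)%R) as [delta [Hd H']]; [lra|].
    apply nbhd_planeP. exists delta. split; [exact Hd|]. intros w Hw Hn.
    assert (Hn' : w - v <> 0) by (intros E; apply Hn; replace w with (w - v + v) by ring; rewrite E; ring).
    replace ((g w - g v) / (w - v) - d) with ((g w - g v - d * (w - v)) / (w - v))
      by (field; exact Hn').
    rewrite Cmod_div by exact Hn'. apply Cmod_gt_0 in Hn'.
    apply Rle_lt_trans with (eps / 2)%R; [|lra].
    apply Rmult_le_reg_r with (Cmod (w - v)); [exact Hn'|].
    unfold Rdiv. rewrite Rmult_assoc, Rinv_l by lra. rewrite Rmult_1_r. apply H', Hw.
  - intros H eps He. specialize (H eps He). apply nbhd_planeP in H.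
    destruct H as [delta [Hd H]]. exists delta. split; [exact Hd|]. intros w Hw.
    destruct (Ceq_dec w v) as [->|Hn].
    + replace (g v - g v - d * (v - v)) with (RtoC 0) by ring. 
      replace (v - v) with (RtoC 0) by ring. rewrite Cmod_0. lra.
    + specialize (H w Hw Hn).
      assert (Hn' : w - v <> 0) by (intros E; apply Hn; replace w with (w - v + v) by ring; rewrite E; ring).
      replace (g w - g v - d * (w - v)) with (((g w - g v) / (w - v) - d) * (w - v))
        by (field; exact Hn').
      rewrite Cmod_mult. apply Rmult_le_compat_r; [apply Cmod_ge_0|lra].
Qed.

Lemma cderiv_const (c v : C) : cderiv (fun _ => c) v 0.
Proof. exact (is_derive_const (K := C_AbsRing) (V := AbsRing_NormedModule C_AbsRing) c v). Qed.

Lemma cderiv_id (v : C) : cderiv (fun x => x) v 1.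
Proof. exact (is_derive_id (K := C_AbsRing) v). Qed.

Lemma cderiv_plus (f g : C -> C) (v df dg : C) :
  cderiv f v df -> cderiv g v dg -> cderiv (fun x => f x + g x) v (df + dg).
Proof.
  exact (is_derive_plus (K := C_AbsRing) (V := AbsRing_NormedModule C_AbsRing) f g v df dg).
Qed.

Lemma cderiv_opp (f : C -> C) (v df : C) :
  cderiv f v df -> cderiv (fun x => - f x) v (- df).
Proof.
  exact (is_derive_opp (K := C_AbsRing) (V := AbsRing_NormedModule C_AbsRing) f v df).
Qed.

Lemma cderiv_minus (f g : C -> C) (v df dg : C) :
  cderiv f v df -> cderiv g v dg -> cderiv (fun x => f x - g x) v (df - dg).
Proof.
  exact (is_derive_minus (K := C_AbsRing) (V := AbsRing_NormedModule C_AbsRing) f g v df dg).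
Qed.

Lemma cderiv_mult (f g : C -> C) (v df dg : C) :
  cderiv f v df -> cderiv g v dg ->
  cderiv (fun x => f x * g x) v (df * g v + f v * dg).
Proof.
  intros Hf Hg.
  exact (is_derive_mult (K := C_AbsRing) f g v df dg Hf Hg Cmult_comm).
Qed.

Lemma cderiv_comp (f g : C -> C) (v df dg : C) :
  cderiv f (g v) df -> cderiv g v dg -> cderiv (fun x => f (g x)) v (dg * df).
Proof.
  exact (is_derive_comp (K := C_AbsRing) (V := AbsRing_NormedModule C_AbsRing) f g v df dg).
Qed.

Lemma cderiv_scal (c : C) (f : C -> C) (v df : C) :
  cderiv f v df -> cderiv (fun x => c * f x) v (c * df).
Proof.
  intros H. replace (c * df) with (0 * f v + c * df) by ring.
  apply (cderiv_mult (fun _ => c)); [apply cderiv_const|exact H].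
Qed.

Lemma cderiv_pow (f : C -> C) (v df : C) (n : nat) :
  cderiv f v df -> exists d, cderiv (fun x => f x ^ n) v d.
Proof.
  intros H. induction n as [|n [d IH]].
  - exists 0. exact (cderiv_const 1 v).
  - exists (df * f v ^ n + f v * d). apply (cderiv_mult f (fun x => f x ^ n)); assumption.
Qed.

Lemma cderiv_ext (f g : C -> C) (v d : C) :
  nbhd_plane v (fun x => f x = g x) -> cderiv f v d -> cderiv g v d.
Proof.
  intros H. apply is_derive_ext_loc.
  apply locally_C, H.
Qed.

Lemma cderiv_continuous (f : C -> C) (v d : C) :
  cderiv f v d -> filterlim f (nbhd_plane v) (nbhd_plane (f v)).
Proof.
  intros H. apply cderivP with (eps := 1%R) in H; [|lra].
  destruct H as [delta [Hd H]].
  apply climP; [typeclasses eauto|]. intros eps He.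
  assert (Hk := Cmod_ge_0 d).
  set (k := (2 + Cmod d)%R). assert (Hk' : (0 < k)%R) by (unfold k; lra).
  apply nbhd_planeP. exists (Rmin delta (eps / k)). split.
  { apply Rmin_glb_lt; [exact Hd|]. apply Rdiv_lt_0_compat; lra. }
  intros y Hy. assert (E1 := Rmin_l delta (eps / k)). assert (E2 := Rmin_r delta (eps / k)).
  specialize (H y ltac:(lra)).
  replace (f y - f v) with ((f y - f v - d * (y - v)) + d * (y - v)) by ring.
  eapply Rle_lt_trans; [apply Cmod_triangle|]. rewrite Cmod_mult.
  assert (Hy' : (Cmod (y - v) * k < eps)%R).
  { replace eps with (eps / k * k)%R by (field; lra). apply Rmult_lt_compat_r; lra. }
  assert (H0 := Cmod_ge_0 (y - v)). unfold k in *. nra.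
Qed.

Lemma Cminus_neq_0 (x y : C) : x <> y -> x - y <> 0.
Proof. intros H E. apply H. replace x with (x - y + y) by ring. rewrite E. ring. Qed.

Lemma Cdiv_neq_0 (x y : C) : x <> 0 -> y <> 0 -> x / y <> 0.
Proof.
  intros Hx Hy E. apply Hx. replace x with (x / y * y) by (field; exact Hy). rewrite E. ring.
Qed.

Lemma Cinv_neq_0 (x : C) : x <> 0 -> / x <> 0.
Proof.
  intros Hx. replace (/ x) with (1 / x) by (field; exact Hx). apply Cdiv_neq_0; [|exact Hx].
  intros E. apply RtoC_inj in E. lra.
Qed.

Lemma cderiv_inv_id (v : C) : v <> 0 -> cderiv (fun x => / x) v (- / (v * v)).
Proof.
  intros Hv. apply cderiv_quotient.
  apply clim_ext with (fun w => - / (w * v)).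
  - unfold within. assert (Hn : nbhd_plane v (fun w => w <> 0)) by (apply clim_neq_0 with v; [exact Hv|apply clim_id]).
    revert Hn. apply filter_imp. intros w Hw Hwv. apply Cminus_neq_0 in Hwv. field. auto.
  - apply clim_opp. apply clim_inv; [apply Cmult_neq_0; auto|].
    apply (clim_mult (fun w => w) (fun _ => v)); [|apply clim_const].
    apply filterlim_within; [typeclasses eauto|apply clim_id].
Qed.

Lemma cderiv_inv (f : C -> C) (v df : C) : f v <> 0 ->
  cderiv f v df -> exists d, cderiv (fun x => / f x) v d.
Proof.
  intros H0 H. eexists.
  apply (cderiv_comp (fun x => / x)); [apply cderiv_inv_id, H0|exact H].
Qed.

(** * Branches of the square root *)

(** The half-angle formula for the root of positive real part. It is relied on only for [0 < Re z],
    where [s] does not vanish. *)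
Definition principal_sqrt (z : C) : C :=
  let s := sqrt ((Cmod z + Re z) / 2) in (s, (Im z / (2 * s))%R).

Lemma principal_sqrt_spec (z : C) : (0 < Re z)%R ->
  principal_sqrt z ^ 2 = z /\ (0 < Re (principal_sqrt z))%R.
Proof.
  intros Hz. unfold principal_sqrt. assert (Hm := Cmod_ge_0 z).
  assert (Hs : (0 < sqrt ((Cmod z + Re z) / 2))%R) by (apply sqrt_lt_R0; lra).
  set (s := sqrt ((Cmod z + Re z) / 2)) in *. split; [|exact Hs].
  assert (Hs2 : (s * s = (Cmod z + Re z) / 2)%R) by (apply sqrt_sqrt; lra).
  assert (Hc : (Cmod z * Cmod z = Re z * Re z + Im z * Im z)%R)
    by (generalize (Cmod2_alt z); simpl; intros E; nra).
  destruct z as [x y]. simpl Re in *; simpl Im in *.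
  set (m := Cmod (x, y)) in *. simpl. rewrite Cmult_1_r. unfold Cmult; simpl. f_equal.
  - replace (s * s - y / (2 * s) * (y / (2 * s)))%R with (s * s - y * y / (4 * (s * s)))%R
      by (field; lra).
    rewrite Hs2. apply Rmult_eq_reg_r with (4 * ((m + x) / 2))%R; [|lra].
    field_simplify; [|lra]. nra.
  - field. lra.
Qed.

(** The branch near [w0 ^ 2] with value [w0] there; it is a square root on the
    half-plane [Re (z / w0 ^ 2) > 0], with values in [Re (w / w0) > 0]. *)
Definition branch (w0 z : C) : C := w0 * principal_sqrt (z / w0 ^ 2).

Lemma Cpow2_neq_0 (w : C) : w <> 0 -> w ^ 2 <> 0.
Proof. intros H. apply Cpow_nz, H. Qed.

Lemma branch_sqr (w0 z : C) : w0 <> 0 -> (0 < Re (z / w0 ^ 2))%R -> branch w0 z ^ 2 = z.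
Proof.
  intros H0 H. unfold branch. rewrite Cpow_mult_l.
  rewrite (proj1 (principal_sqrt_spec _ H)). field. exact H0.
Qed.

Lemma branch_Re (w0 z : C) : w0 <> 0 -> (0 < Re (z / w0 ^ 2))%R ->
  (0 < Re (branch w0 z / w0))%R.
Proof.
  intros H0 H. unfold branch.
  replace (w0 * principal_sqrt (z / w0 ^ 2) / w0) with (principal_sqrt (z / w0 ^ 2)).
  - apply principal_sqrt_spec, H.
  - field. exact H0.
Qed.

Lemma Csqr_eq (x y : C) : x ^ 2 = y ^ 2 -> x = y \/ x = - y.
Proof.
  intros H. destruct (classic (x - y = 0)) as [E|E].
  - left. replace x with (x - y + y) by ring. rewrite E. ring.
  - right. assert (E' : x + y = 0).
    { apply NNPP. intros E'. apply (Cmult_neq_0 _ _ E E').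
      replace ((x - y) * (x + y)) with (x ^ 2 - y ^ 2) by ring. rewrite H. ring. }
    replace x with (x + y - y) by ring. rewrite E'. ring.
Qed.

(** The only other root is the opposite one, whose quotient by [w0] has negative real part. *)
Lemma branch_unique (w0 w z : C) : w0 <> 0 -> (0 < Re (z / w0 ^ 2))%R ->
  w ^ 2 = z -> (0 < Re (w / w0))%R -> branch w0 z = w.
Proof.
  intros H0 Hz Hw Hr. assert (Hb := branch_Re w0 z H0 Hz).
  destruct (Csqr_eq (branch w0 z) w) as [E|E]; [rewrite branch_sqr; auto|exact E|].
  exfalso. rewrite E in Hb. replace (- w / w0) with (- (w / w0)) in Hb by (field; exact H0).
  simpl in *. unfold Re in *. simpl in *. lra.
Qed.

Lemma Re_div_self (w : C) : w <> 0 -> (0 < Re (w / w))%R.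
Proof. intros H. replace (w / w) with (RtoC 1) by (field; exact H). simpl. lra. Qed.

Lemma branch_self (w0 : C) : w0 <> 0 -> branch w0 (w0 ^ 2) = w0.
Proof.
  intros H. apply branch_unique; auto; apply Re_div_self; auto. apply Cpow2_neq_0, H.
Qed.

Lemma branch_opp (w0 z : C) : branch (- w0) z = - branch w0 z.
Proof. unfold branch. replace ((- w0) ^ 2) with (w0 ^ 2) by ring. ring. Qed.

Lemma branch_neq_0 (w0 z : C) : w0 <> 0 -> (0 < Re (z / w0 ^ 2))%R -> branch w0 z <> 0.
Proof.
  intros H0 H E. generalize (branch_Re w0 z H0 H). rewrite E.
  replace (0 / w0) with (RtoC 0) by (field; exact H0). simpl. lra.
Qed.

(** The standard way of checking, near a point, the half-plane condition under which [branch] is a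
    square root. *)
Lemma clim_div_Re {T : Type} (F : (T -> Prop) -> Prop) {FF : Filter F} (g : T -> C) (l w : C) :
  w <> 0 -> (0 < Re (l / w))%R -> filterlim g F (nbhd_plane l) ->
  F (fun p => (0 < Re (g p / w))%R).
Proof.
  intros Hw Hl Hg. apply clim_Re_pos with (l / w); [exact Hl|].
  apply clim_div; [exact Hw|exact Hg|apply clim_const].
Qed.

(** The difference of two values times their sum is [z' - z], and the sum stays away from 0 because
    both values, divided by [w0], have positive real part. *)
Lemma branch_continuous (w0 z : C) : w0 <> 0 -> (0 < Re (z / w0 ^ 2))%R ->
  filterlim (branch w0) (nbhd_plane z) (nbhd_plane (branch w0 z)).
Proof.
  intros H0 Hz. apply climP; [typeclasses eauto|]. intros eps He.
  assert (Hb := branch_Re w0 z H0 Hz). set (m := Re (branch w0 z / w0)) in *.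
  assert (H0' := proj1 (Cmod_gt_0 _) H0).
  assert (HD : nbhd_plane z (fun z' => (0 < Re (z' / w0 ^ 2))%R)).
  { apply clim_div_Re with z; [typeclasses eauto|apply Cpow2_neq_0, H0|exact Hz|apply clim_id]. }
  assert (Hk : (0 < eps * (m * Cmod w0))%R) by (apply Rmult_lt_0_compat; nra).
  generalize (filter_and _ _ HD (nbhd_plane_ball z _ Hk)). apply filter_imp.
  intros z' [Hz' Hd]. assert (Hb' := branch_Re w0 z' H0 Hz').
  assert (Hs : (m * Cmod w0 <= Cmod (branch w0 z' + branch w0 z))%R).
  { replace (branch w0 z' + branch w0 z) with ((branch w0 z' / w0 + branch w0 z / w0) * w0)
      by (field; exact H0).
    rewrite Cmod_mult. apply Rmult_le_compat_r; [lra|].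
    eapply Rle_trans; [|apply re_le_Cmod]. eapply Rle_trans; [|apply Rle_abs].
    unfold m, Re in *. simpl fst at 2. simpl in *. lra. }
  apply Rmult_lt_reg_r with (m * Cmod w0)%R; [nra|].
  apply Rle_lt_trans with (Cmod (z' - z)); [|exact Hd].
  replace (z' - z) with ((branch w0 z' - branch w0 z) * (branch w0 z' + branch w0 z)).
  - rewrite Cmod_mult. apply Rmult_le_compat_l; [apply Cmod_ge_0|exact Hs].
  - rewrite <- (branch_sqr w0 z H0 Hz) at 3. rewrite <- (branch_sqr w0 z' H0 Hz') at 3. ring.
Qed.

(** By the same factorization the difference quotient is the inverse of the sum of two values of the
    branch, so it converges by continuity. *)
Lemma branch_cderiv (w0 z : C) : w0 <> 0 -> (0 < Re (z / w0 ^ 2))%R ->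
  cderiv (branch w0) z (/ (branch w0 z + branch w0 z)).
Proof.
  intros H0 Hz. apply cderiv_quotient.
  assert (Hb := branch_neq_0 w0 z H0 Hz).
  assert (Hb2 : branch w0 z + branch w0 z <> 0).
  { replace (branch w0 z + branch w0 z) with (2 * branch w0 z) by ring.
    apply Cmult_neq_0; [|exact Hb]. intros E. apply RtoC_inj in E. lra. }
  assert (Hc := branch_continuous w0 z H0 Hz).
  assert (Hs : filterlim (fun w => branch w0 w + branch w0 z) (nbhd_plane z)
     (nbhd_plane (branch w0 z + branch w0 z))) by (apply clim_plus; [exact Hc|apply clim_const]).
  apply clim_ext with (fun w => / (branch w0 w + branch w0 z)).
  - assert (HD : nbhd_plane z (fun z' => (0 < Re (z' / w0 ^ 2))%R)).
    { apply clim_div_Re with z; [typeclasses eauto|apply Cpow2_neq_0, H0|exact Hz|apply clim_id]. }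
    unfold within. generalize (filter_and _ _ HD (clim_neq_0 _ _ Hb2 Hs)). apply filter_imp.
    intros w [Hw Hn] Hwz. apply Cminus_neq_0 in Hwz.
    replace (branch w0 w - branch w0 z) with ((w - z) * / (branch w0 w + branch w0 z)).
    + field. auto.
    + rewrite <- (branch_sqr w0 z H0 Hz) at 1. rewrite <- (branch_sqr w0 w H0 Hw) at 1.
      field. exact Hn.
  - apply clim_inv; [exact Hb2|].
    apply filterlim_within; [typeclasses eauto|exact Hs].
Qed.

(** If [Re z <= 0] and [z] is not real, division by [i * Im z], whose root is explicit, gives a
    number of positive real part, so that a suitable [branch] applies. Real numbers that are at most
    0 have a root on the imaginary axis. *)
Lemma sqrt_exists (z : C) : exists w, w ^ 2 = z.
Proof.
  destruct (Rle_lt_dec (Re z) 0) as [H|H].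
  - destruct (Req_dec (Im z) 0) as [E|E].
    + exists (0%R, sqrt (- Re z)). destruct z as [x y]. simpl in *. subst y.
      unfold Cmult; simpl. assert (Hs := sqrt_sqrt (- x) ltac:(lra)). f_equal; nra.
    + assert (Hn : (0 < Re (z / (0%R, Im z)))%R).
      { replace (z / (0%R, Im z)) with ((1%R, (- Re z / Im z)%R) : C).
        - simpl. lra.
        - destruct z as [x y]. simpl in *. unfold Cdiv, Cinv, Cmult. simpl. f_equal; field; auto. }
      assert (Hn2 : exists r, r ^ 2 = (0%R, Im z)).
      { set (y := Im z) in *. clearbody y. destruct (Rle_lt_dec 0 y) as [Hy|Hy].
        - exists (sqrt (y / 2), sqrt (y / 2)). assert (Hs := sqrt_sqrt (y / 2) ltac:(lra)).
          simpl. unfold Cmult; simpl. f_equal; nra.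
        - exists (sqrt (- y / 2), (- sqrt (- y / 2))%R). assert (Hs := sqrt_sqrt (- y / 2) ltac:(lra)).
          simpl. unfold Cmult; simpl. f_equal; nra. }
      destruct Hn2 as [r Hr]. rewrite <- Hr in Hn. exists (branch r z).
      apply branch_sqr; [|exact Hn]. intros E0. apply E.
      change (Im z) with (Im (0%R, Im z)). rewrite <- Hr, E0. simpl. ring.
  - exists (principal_sqrt z). apply principal_sqrt_spec, H.
Qed.

(** * The exponential *)

Lemma Cexp_plus (a b : C) : Cexp (a + b) = Cexp a * Cexp b.
Proof.
  unfold Cexp, Cmult, Re, Im. simpl. rewrite exp_plus, cos_plus, sin_plus. f_equal; ring.
Qed.

Lemma Cexp_0 : Cexp 0 = 1.
Proof. unfold Cexp. simpl. rewrite exp_0, cos_0, sin_0. unfold RtoC. f_equal; ring. Qed.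

Lemma Cexp_neq_0 (a : C) : Cexp a <> 0.
Proof.
  intros E. assert (H := Cexp_plus a (- a)). rewrite E in H.
  replace (a + - a) with (RtoC 0) in H by ring. rewrite Cexp_0, Cmult_0_l in H.
  apply RtoC_inj in H. lra.
Qed.

Lemma Cmod_le_plus (z : C) : (Cmod z <= Rabs (Re z) + Rabs (Im z))%R.
Proof.
  replace z with (RtoC (Re z) + Ci * RtoC (Im z)) at 1.
  - eapply Rle_trans; [apply Cmod_triangle|]. rewrite Cmod_mult, Cmod_Ci, !Cmod_R. lra.
  - destruct z as [x y]. unfold Cplus, Cmult. simpl. f_equal; ring.
Qed.

Lemma im_le_Cmod (c : C) : (Rabs (Im c) <= Cmod c)%R.
Proof. generalize (Rmax_Cmod c) (Rmax_r (Rabs (fst c)) (Rabs (snd c))). unfold Im. lra. Qed.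

Lemma Cexp_cderiv_0 : cderiv Cexp 0 1.
Proof.
  apply cderivP. intros eps He.
  (* The real and imaginary parts of the remainder turn out to be at most [3 * (e * m)] and
     [5 * (e * m)], which explains the 8. *)
  set (e := Rmin 1 (eps / 8)).
  assert (He' : (0 < e)%R) by (apply Rmin_glb_lt; lra).
  assert (E1 := Rmin_l 1 (eps / 8)). assert (E2 := Rmin_r 1 (eps / 8)). fold e in E1, E2.
  destruct (derivable_pt_lim_exp_0 e He') as [d1 H1].
  destruct (derivable_pt_lim_cos 0 e He') as [d2 H2].
  destruct (derivable_pt_lim_sin 0 e He') as [d3 H3].
  assert (P1 := cond_pos d1). assert (P2 := cond_pos d2). assert (P3 := cond_pos d3).
  (* The radius [e] makes the mixed term [x * y] small as well. *)
  exists (Rmin (Rmin d1 d2) (Rmin d3 e)). split.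
  { clearbody e. repeat apply Rmin_glb_lt; assumption. }
  intros h Hh. rewrite Cexp_0. replace (h - 0) with h in * by ring.
  replace (Cexp h - 1 - 1 * h) with (Cexp h - 1 - h) by ring.
  assert (G1 := Rmin_l (Rmin d1 d2) (Rmin d3 e)). assert (G2 := Rmin_r (Rmin d1 d2) (Rmin d3 e)).
  assert (G3 := Rmin_l d1 d2). assert (G4 := Rmin_r d1 d2).
  assert (G5 := Rmin_l d3 e). assert (G6 := Rmin_r d3 e).
  assert (Hx := re_le_Cmod h). assert (Hy := im_le_Cmod h).
  destruct h as [x y]. set (m := Cmod (x, y)) in *.
  unfold Re, Im in Hx, Hy. simpl in Hx, Hy.
  assert (Q : forall (f : R -> R) l a d, (Rabs a < d)%R ->
     (forall h, h <> 0%R -> (Rabs h < d)%R -> (Rabs ((f (0 + h) - f 0) / h - l) < e)%R) ->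
     (Rabs (f a - f 0 - l * a) <= e * Rabs a)%R).
  { intros f l a d Ha H. destruct (Req_dec a 0) as [->|Hn].
    - replace (f 0 - f 0 - l * 0)%R with 0%R by ring. rewrite Rabs_R0. lra.
    - specialize (H a Hn Ha). rewrite Rplus_0_l in H.
      replace (f a - f 0 - l * a)%R with (((f a - f 0) / a - l) * a)%R by (field; exact Hn).
      rewrite Rabs_mult. apply Rmult_le_compat_r; [apply Rabs_pos|lra]. }
  assert (X1 := Q exp 1%R x d1 ltac:(lra) H1).
  assert (X2 := Q cos _ y d2 ltac:(lra) H2).
  assert (X3 := Q sin _ y d3 ltac:(lra) H3).
  rewrite exp_0 in X1. rewrite cos_0, sin_0 in X2. rewrite sin_0, cos_0 in X3.
  replace (cos y - 1 - - 0 * y)%R with (cos y - 1)%R in X2 by ring.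
  replace (sin y - 0 - 1 * y)%R with (sin y - y)%R in X3 by ring.
  replace (exp x - 1 - 1 * x)%R with (exp x - 1 - x)%R in X1 by ring.
  assert (Hm : (0 <= m)%R) by apply Cmod_ge_0.
  assert (C1 : (Rabs (cos y) <= 1)%R) by (apply Rabs_le, COS_bound).
  assert (Xe : (e * Rabs x <= e * m)%R) by nra.
  assert (Ye : (e * Rabs y <= e * m)%R) by nra.
  assert (me : (m <= e)%R) by lra.
  eapply Rle_trans; [apply Cmod_le_plus|].
  unfold Cexp, Re, Im, RtoC, Cminus, Cplus, Copp. simpl.
  (* Both parts are rewritten through the three real remainders, named [A], [B] and [D] below, each
     of which is at most [e * m]. *)
  replace (exp x * cos y + - (1) + - x)%R
    with ((exp x - 1 - x) * cos y + (1 + x) * (cos y - 1))%R by ring.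
  replace (exp x * sin y + - 0 + - y)%R
    with ((exp x - 1 - x) * (sin y - y) + (exp x - 1 - x) * y + x * (sin y - y) + x * y + (sin y - y))%R by ring.
  set (A := (exp x - 1 - x)%R) in *. set (B := (cos y - 1)%R) in *. set (D := (sin y - y)%R) in *.
  assert (Y1 : (Rabs (A * cos y + (1 + x) * B) <= 3 * (e * m))%R).
  { eapply Rle_trans; [apply Rabs_triang|]. rewrite !Rabs_mult.
    assert (Rabs (1 + x) <= 2)%R by (eapply Rle_trans; [apply Rabs_triang|]; rewrite Rabs_R1; lra).
    generalize (Rabs_pos A) (Rabs_pos B) (Rabs_pos (cos y)). nra. }
  assert (Y2 : (Rabs (A * D + A * y + x * D + x * y + D) <= 5 * (e * m))%R).
  { assert (em : (0 <= e * m)%R) by nra. assert (em1 : (e * m <= 1)%R) by nra.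
    assert (Z1 : (Rabs (A * D) <= e * m)%R)
      by (rewrite Rabs_mult; generalize (Rabs_pos A) (Rabs_pos D); nra).
    assert (Z2 : (Rabs (A * y) <= e * m)%R)
      by (rewrite Rabs_mult; generalize (Rabs_pos A) (Rabs_pos y); nra).
    assert (Z3 : (Rabs (x * D) <= e * m)%R)
      by (rewrite Rabs_mult; generalize (Rabs_pos D) (Rabs_pos x); nra).
    assert (Z4 : (Rabs (x * y) <= e * m)%R)
      by (rewrite Rabs_mult; generalize (Rabs_pos y) (Rabs_pos x); nra).
    generalize (Rabs_triang (A * D + A * y + x * D + x * y) D)
      (Rabs_triang (A * D + A * y + x * D) (x * y)) (Rabs_triang (A * D + A * y) (x * D))
      (Rabs_triang (A * D) (A * y)). lra. }
  nra.
Qed.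

Lemma Cexp_cderiv (z : C) : cderiv Cexp z (Cexp z).
Proof.
  apply cderiv_ext with (fun w => Cexp z * Cexp (w - z)).
  - apply filter_forall. intros w. rewrite <- Cexp_plus. f_equal. ring.
  - assert (H : cderiv (fun w => Cexp z * Cexp (w - z)) z (Cexp z * ((1 - 0) * 1))).
    { apply cderiv_scal. apply (cderiv_comp Cexp (fun w => w - z)).
      - replace (z - z) with (RtoC 0) by ring. apply Cexp_cderiv_0.
      - apply cderiv_minus; [apply cderiv_id|apply cderiv_const]. }
    replace (Cexp z * ((1 - 0) * 1)) with (Cexp z) in H by ring. exact H.
Qed.

Global Opaque cderiv.

Lemma C_ext (z w : C) : Re z = Re w -> Im z = Im w -> z = w.
Proof. destruct z, w. simpl. intros -> ->. reflexivity. Qed.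

Lemma RtoC_half : RtoC (/ 2) = / 2.
Proof. apply RtoC_inv. lra. Qed.

Lemma filterlim_Re (z : C) : filterlim Re (nbhd_plane z) (locally (Re z)).
Proof. apply (continuous_fst (U := R_UniformSpace) (V := R_UniformSpace)). Qed.

Lemma filterlim_Im (z : C) : filterlim Im (nbhd_plane z) (locally (Im z)).
Proof. apply (continuous_snd (U := R_UniformSpace) (V := R_UniformSpace)). Qed.

Lemma clim_RtoC (x : R) : filterlim RtoC (locally x) (nbhd_plane (RtoC x)).
Proof.
  apply climP; [typeclasses eauto|]. intros eps He. exists (mkposreal eps He).
  intros y Hy. rewrite <- RtoC_minus, Cmod_R. exact Hy.
Qed.

(** * Integrals along segments *)

(** Two real integrals, so that the theory of [RInt] for real functions applies to each
    component. *)
Definition Cint (f : R -> C) : C := (RInt (fun s => Re (f s)) 0 1, RInt (fun s => Im (f s)) 0 1).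

Definition Cint_able (f : R -> C) : Prop :=
  ex_RInt (fun s => Re (f s)) 0 1 /\ ex_RInt (fun s => Im (f s)) 0 1.

Lemma Cint_ext (f g : R -> C) : (forall s, (0 <= s <= 1)%R -> f s = g s) -> Cint f = Cint g.
Proof.
  intros H. unfold Cint. f_equal; apply RInt_ext; intros s Hs;
    rewrite Rmin_left, Rmax_right in Hs by lra; rewrite H; auto; lra.
Qed.

Lemma Cint_plus (f g : R -> C) : Cint_able f -> Cint_able g ->
  Cint (fun s => f s + g s) = Cint f + Cint g.
Proof.
  intros [F1 F2] [G1 G2]. unfold Cint, Cplus. simpl. f_equal.
  - apply (RInt_plus (V := R_CompleteNormedModule) (fun s => Re (f s)) (fun s => Re (g s))); assumption.
  - apply (RInt_plus (V := R_CompleteNormedModule) (fun s => Im (f s)) (fun s => Im (g s))); assumption.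
Qed.

Lemma Cint_able_plus (f g : R -> C) : Cint_able f -> Cint_able g ->
  Cint_able (fun s => f s + g s).
Proof.
  intros [F1 F2] [G1 G2]. split.
  - apply (ex_RInt_plus (V := R_NormedModule) (fun s => Re (f s)) (fun s => Re (g s))); assumption.
  - apply (ex_RInt_plus (V := R_NormedModule) (fun s => Im (f s)) (fun s => Im (g s))); assumption.
Qed.

Lemma Cint_able_opp (f : R -> C) : Cint_able f -> Cint_able (fun s => - f s).
Proof.
  intros [F1 F2]. split.
  - apply (ex_RInt_opp (V := R_NormedModule) (fun s => Re (f s))); assumption.
  - apply (ex_RInt_opp (V := R_NormedModule) (fun s => Im (f s))); assumption.
Qed.

Lemma Cint_able_affine (p q : C) : Cint_able (fun s => p + RtoC s * q).
Proof.
  split; apply (ex_RInt_continuous (V := R_CompleteNormedModule)); intros s _; simpl;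
    apply (ex_derive_continuous (V := R_NormedModule)); auto_derive; auto.
Qed.

Lemma RInt_affine (p q : R) : RInt (fun s => p + s * q)%R 0 1 = (p + q / 2)%R.
Proof.
  apply is_RInt_unique.
  replace (p + q / 2)%R with (minus ((fun s => p * s + s * s * q / 2)%R 1) ((fun s => p * s + s * s * q / 2)%R 0)%R)
    by (unfold minus, plus, opp; simpl; field).
  apply (is_RInt_derive (V := R_CompleteNormedModule) (fun s => p * s + s * s * q / 2)%R).
  - intros x _. auto_derive; auto. field.
  - intros x _. apply (ex_derive_continuous (V := R_NormedModule)). auto_derive; auto.
Qed.

Lemma Cint_affine (p q : C) : Cint (fun s => p + RtoC s * q) = p + q / 2.
Proof.
  replace (q / 2) with (RtoC (/ 2) * q) by (rewrite RtoC_half; field).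
  unfold Cint. apply C_ext; simpl.
  - rewrite (RInt_ext _ (fun s => Re p + s * Re q)%R).
    + rewrite RInt_affine. destruct p, q; simpl. field.
    + intros; unfold Re; simpl; ring.
  - rewrite (RInt_ext _ (fun s => Im p + s * Im q)%R).
    + rewrite RInt_affine. destruct p, q; simpl. field.
    + intros; unfold Im; simpl; ring.
Qed.

Lemma RInt_01_bound (f : R -> R) (M : R) : ex_RInt f 0 1 ->
  (forall s, (0 <= s <= 1)%R -> (Rabs (f s) <= M)%R) -> (Rabs (RInt f 0 1) <= M)%R.
Proof.
  intros Hf HM. replace M with ((1 - 0) * M)%R by ring.
  apply (norm_RInt_le_const (V := R_NormedModule) f 0 1); [lra|exact HM|].
  apply (RInt_correct (V := R_CompleteNormedModule)), Hf.
Qed.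

(** The two components are estimated separately, hence the factor 2 in place of the sharp 1. *)
Lemma Cint_bound (f : R -> C) (M : R) : Cint_able f ->
  (forall s, (0 <= s <= 1)%R -> (Cmod (f s) <= M)%R) -> (Cmod (Cint f) <= 2 * M)%R.
Proof.
  intros [F1 F2] HM. eapply Rle_trans; [apply Cmod_le_plus|].
  assert (Rabs (Re (Cint f)) <= M)%R.
  { apply RInt_01_bound; [exact F1|]. intros s Hs.
    eapply Rle_trans; [apply re_le_Cmod|apply HM, Hs]. }
  assert (Rabs (Im (Cint f)) <= M)%R.
  { apply RInt_01_bound; [exact F2|]. intros s Hs.
    eapply Rle_trans; [apply im_le_Cmod|apply HM, Hs]. }
  lra.
Qed.

Lemma RInt_01_rev (f : R -> R) : ex_RInt f 0 1 -> RInt (fun s => f (1 - s)%R) 0 1 = RInt f 0 1.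
Proof.
  intros Hf.
  rewrite (RInt_ext _ (fun s => opp (scal (-1)%R (f (-1 * s + 1)%R)))).
  2:{ intros x _. unfold opp, scal; simpl; unfold mult; simpl. replace (-1 * x + 1)%R with (1 - x)%R by ring. ring. }
  assert (H1 : is_RInt (fun s => scal (-1)%R (f (-1 * s + 1)%R)) 0 1 (RInt f 1 0)).
  { apply (is_RInt_comp_lin (V := R_NormedModule) f (-1) 1 0 1).
    replace (-1 * 0 + 1)%R with 1%R by ring. replace (-1 * 1 + 1)%R with 0%R by ring.
    apply (RInt_correct (V := R_CompleteNormedModule)). apply ex_RInt_swap, Hf. }
  rewrite (RInt_opp (V := R_CompleteNormedModule)) by (eexists; exact H1).
  rewrite (is_RInt_unique _ _ _ _ H1).
  rewrite (opp_RInt_swap (V := R_CompleteNormedModule)); [reflexivity|].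
  apply ex_RInt_swap, Hf.
Qed.

(** Together with the reversal above, this is what the subdivision of triangles needs: reversing a
    side and cutting it at its midpoint. *)
Lemma RInt_01_split (f : R -> R) : ex_RInt f 0 1 ->
  (RInt f 0 1 = / 2 * RInt (fun s => f (/ 2 * s)%R) 0 1
    + / 2 * RInt (fun s => f (/ 2 * s + / 2)%R) 0 1)%R.
Proof.
  intros Hf.
  assert (F1 : ex_RInt f 0 (/ 2)) by (apply (ex_RInt_Chasles_1 (V := R_CompleteNormedModule)) with 1%R; [lra|exact Hf]).
  assert (F2 : ex_RInt f (/ 2) 1) by (apply (ex_RInt_Chasles_2 (V := R_CompleteNormedModule)) with 0%R; [lra|exact Hf]).
  rewrite <- (RInt_Chasles (V := R_CompleteNormedModule) f 0 (/ 2) 1 F1 F2).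
  assert (H1 : is_RInt (fun s => scal (/ 2)%R (f (/ 2 * s + 0)%R)) 0 1 (RInt f 0 (/ 2))).
  { apply (is_RInt_comp_lin (V := R_NormedModule) f (/ 2) 0 0 1).
    replace (/ 2 * 0 + 0)%R with 0%R by ring. replace (/ 2 * 1 + 0)%R with (/ 2)%R by ring.
    apply (RInt_correct (V := R_CompleteNormedModule)), F1. }
  assert (H2 : is_RInt (fun s => scal (/ 2)%R (f (/ 2 * s + / 2)%R)) 0 1 (RInt f (/ 2) 1)).
  { apply (is_RInt_comp_lin (V := R_NormedModule) f (/ 2) (/ 2) 0 1).
    replace (/ 2 * 0 + / 2)%R with (/ 2)%R by ring. replace (/ 2 * 1 + / 2)%R with 1%R by field.
    apply (RInt_correct (V := R_CompleteNormedModule)), F2. }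
  assert (K : forall (h : R -> R) (l : R), is_RInt (fun s => scal (/ 2)%R (h s)) 0 1 l -> (/ 2 * RInt h 0 1 = l)%R).
  { intros h l H. assert (Hh : is_RInt h 0 1 (2 * l)%R).
    { apply (is_RInt_ext (fun s => scal 2%R (scal (/ 2)%R (h s)))).
      - intros x _. unfold scal; simpl; unfold mult; simpl. field.
      - apply (is_RInt_scal (V := R_NormedModule) _ 0 1 2 l), H. }
    rewrite (is_RInt_unique _ _ _ _ Hh). field. }
  rewrite (K (fun s => f (/ 2 * s + / 2)%R) _ H2).
  rewrite (RInt_ext (fun s => f (/ 2 * s)%R) (fun s => f (/ 2 * s + 0)%R))
    by (intros; f_equal; ring).
  rewrite (K (fun s => f (/ 2 * s + 0)%R) _ H1). reflexivity.
Qed.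

Lemma Cint_rev (f : R -> C) : Cint_able f -> Cint (fun s => f (1 - s)%R) = Cint f.
Proof.
  intros [F1 F2]. unfold Cint. f_equal.
  - apply (RInt_01_rev (fun s => Re (f s))), F1.
  - apply (RInt_01_rev (fun s => Im (f s))), F2.
Qed.

Lemma Cint_split (f : R -> C) : Cint_able f ->
  Cint f = / 2 * Cint (fun s => f (/ 2 * s)%R) + / 2 * Cint (fun s => f (/ 2 * s + / 2)%R).
Proof.
  intros [F1 F2]. rewrite <- RtoC_half.
  apply C_ext; simpl.
  - rewrite (RInt_01_split _ F1). field.
  - rewrite (RInt_01_split _ F2). field.
Qed.

Definition segment (a b : C) (s : R) : C := a + RtoC s * (b - a).

Definition seg_int (f : C -> C) (a b : C) : C := (b - a) * Cint (fun s => f (segment a b s)).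

Lemma segment_dist (a b z : C) (s r : R) : (0 <= s <= 1)%R ->
  (Cmod (a - z) <= r)%R -> (Cmod (b - z) <= r)%R -> (Cmod (segment a b s - z) <= r)%R.
Proof.
  intros Hs Ha Hb. unfold segment.
  replace (a + s * (b - a) - z) with (RtoC (1 - s) * (a - z) + RtoC s * (b - z))
    by (rewrite RtoC_minus; ring).
  eapply Rle_trans; [apply Cmod_triangle|]. rewrite !Cmod_mult, !Cmod_R.
  rewrite !Rabs_pos_eq by lra. nra.
Qed.

Lemma segment_continuous (a b : C) (s : R) :
  filterlim (segment a b) (locally s) (nbhd_plane (segment a b s)).
Proof.
  unfold segment. apply clim_plus; [apply clim_const|].
  apply clim_mult; [apply clim_RtoC|apply clim_const].
Qed.

(** The steps add up to a geometric series, and completeness is applied to each coordinate. In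
    Goursat's lemma this gives the point to which the nested triangles shrink, with the rate. *)
Lemma geometric_limit (a : nat -> C) (D : R) :
  (forall n, (Cmod (a (S n) - a n) <= D * (/ 2) ^ n)%R) ->
  exists z, forall n, (Cmod (a n - z) <= 2 * D * (/ 2) ^ n)%R.
Proof.
  intros H.
  assert (HD : (0 <= D)%R).
  { generalize (H 0%nat) (Cmod_ge_0 (a 1%nat - a 0%nat)). simpl. lra. }
  assert (Hp : forall n, (0 < (/ 2) ^ n)%R) by (intros; apply pow_lt; lra).
  (* Keeping the subtracted tail in the bound lets the induction on [k] close. *)
  assert (H1 : forall n k, (Cmod (a (n + k)%nat - a n) <= 2 * D * (/ 2) ^ n - 2 * D * (/ 2) ^ (n + k))%R).
  { intros n k. induction k as [|k IH].
    - rewrite Nat.add_0_r. replace (a n - a n) with (RtoC 0) by ring. rewrite Cmod_0. lra.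
    - rewrite Nat.add_succ_r. specialize (H (n + k)%nat).
      replace (a (S (n + k)) - a n) with ((a (S (n + k)) - a (n + k)%nat) + (a (n + k)%nat - a n)) by ring.
      eapply Rle_trans; [apply Cmod_triangle|]. simpl pow. lra. }
  assert (H2 : forall n m, (n <= m)%nat -> (Cmod (a m - a n) <= 2 * D * (/ 2) ^ n)%R).
  { intros n m Hm. replace m with (n + (m - n))%nat by lia. eapply Rle_trans; [apply H1|].
    generalize (Hp (n + (m - n))%nat). nra. }
  assert (Hsmall : forall e, (0 < e)%R -> exists N, forall n, (n >= N)%nat -> (2 * D * (/ 2) ^ n < e)%R).
  { intros e He. destruct (pow_lt_1_zero (/ 2)%R ltac:(rewrite Rabs_pos_eq; lra) (e / (2 * D + 1))%R) as [N HN].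
    - apply Rdiv_lt_0_compat; lra.
    - exists N. intros n Hn. specialize (HN n Hn). rewrite Rabs_pos_eq in HN by (left; apply Hp).
      apply Rmult_lt_compat_r with (r := (2 * D + 1)%R) in HN; [|lra].
      unfold Rdiv in HN. rewrite Rmult_assoc, Rinv_l in HN by lra. specialize (Hp n). nra. }
  assert (Hc : forall p : C -> R, (forall x y, (Rabs (p x - p y) <= Cmod (x - y))%R) ->
     exists l, Un_cv (fun n => p (a n)) l).
  { intros p Hpp. destruct (Rcomplete.R_complete (fun n => p (a n))) as [l Hl].
    - intros e He. destruct (Hsmall (e / 2)%R ltac:(lra)) as [N HN]. exists N. intros n m Hn Hm.
      unfold Rdist.
      replace (p (a n) - p (a m))%R with ((p (a n) - p (a N)) - (p (a m) - p (a N)))%R by ring.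
      eapply Rle_lt_trans; [apply Rabs_triang|]. rewrite Rabs_Ropp.
      generalize (Hpp (a n) (a N)) (Hpp (a m) (a N)) (H2 N n Hn) (H2 N m Hm) (HN N (le_n N)). lra.
    - exists l. exact Hl. }
  destruct (Hc Re) as [x Hx].
  { intros u v. replace (Re u - Re v)%R with (Re (u - v)) by (unfold Re; simpl; ring). apply re_le_Cmod. }
  destruct (Hc Im) as [y Hy].
  { intros u v. replace (Im u - Im v)%R with (Im (u - v)) by (unfold Im; simpl; ring). apply im_le_Cmod. }
  exists (x, y). intros n. apply Rnot_lt_le. intros Hlt.
  set (e := (Cmod (a n - (x, y)) - 2 * D * (/ 2) ^ n)%R) in *.
  assert (He : (0 < e)%R) by (unfold e; lra).
  destruct (Hx (e / 2)%R ltac:(lra)) as [N1 HN1]. destruct (Hy (e / 2)%R ltac:(lra)) as [N2 HN2].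
  set (m := (n + N1 + N2)%nat).
  specialize (HN1 m ltac:(unfold m; lia)). specialize (HN2 m ltac:(unfold m; lia)).
  assert (Hm := H2 n m ltac:(unfold m; lia)). unfold Rdist in HN1, HN2.
  assert (E1 : (Cmod (a n - (x, y)) <= Cmod (a m - a n) + Cmod (a m - (x, y)))%R).
  { replace (a n - (x, y)) with (- (a m - a n) + (a m - (x, y))) by ring.
    eapply Rle_trans; [apply Cmod_triangle|]. rewrite Cmod_opp. lra. }
  assert (E2 := Cmod_le_plus (a m - (x, y))).
  replace (Re (a m - (x, y))) with (Re (a m) - x)%R in E2 by (unfold Re; simpl; ring).
  replace (Im (a m - (x, y))) with (Im (a m) - y)%R in E2 by (unfold Im; simpl; ring).
  unfold e in *. lra.
Qed.

(** * Goursat's lemma and primitives on a disc *)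

Section Goursat.
Variables (delta : R) (f : C -> C).
Hypothesis Hf : forall v, (Cmod v < delta)%R -> exists d, cderiv f v d.

Lemma Cint_able_segment (a b : C) : (Cmod a < delta)%R -> (Cmod b < delta)%R ->
  Cint_able (fun s => f (segment a b s)).
Proof.
  intros Ha Hb.
  assert (Hc : forall s, (0 <= s <= 1)%R ->
    filterlim (fun s => f (segment a b s)) (locally s) (nbhd_plane (f (segment a b s)))).
  { intros s Hs. eapply filterlim_comp; [apply segment_continuous|].
    destruct (Hf (segment a b s)) as [d Hd].
    - replace (segment a b s) with (segment a b s - 0) by ring.
      apply Rle_lt_trans with (Rmax (Cmod a) (Cmod b)); [|apply Rmax_lub_lt; assumption].
      apply segment_dist; [exact Hs| |]; replace (a - 0) with a by ring; replace (b - 0) with b by ring.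
      apply Rmax_l. apply Rmax_r.
    - apply cderiv_continuous with d, Hd. }
  split; apply (ex_RInt_continuous (V := R_CompleteNormedModule)); intros s Hs;
    rewrite Rmin_left, Rmax_right in Hs by lra.
  - eapply filterlim_comp; [apply Hc, Hs|apply filterlim_Re].
  - eapply filterlim_comp; [apply Hc, Hs|apply filterlim_Im].
Qed.

Lemma seg_int_rev (a b : C) : (Cmod a < delta)%R -> (Cmod b < delta)%R ->
  seg_int f b a = - seg_int f a b.
Proof.
  intros Ha Hb. unfold seg_int.
  rewrite <- (Cint_rev _ (Cint_able_segment a b Ha Hb)).
  rewrite (Cint_ext (fun s => f (segment b a s)) (fun s => f (segment a b (1 - s)%R))).
  - ring.
  - intros s _. f_equal. unfold segment. rewrite RtoC_minus. ring.
Qed.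

Definition midpoint (a b : C) : C := (a + b) / 2.

Lemma seg_int_split (a b : C) : (Cmod a < delta)%R -> (Cmod b < delta)%R ->
  seg_int f a b = seg_int f a (midpoint a b) + seg_int f (midpoint a b) b.
Proof.
  intros Ha Hb. unfold seg_int.
  rewrite (Cint_split _ (Cint_able_segment a b Ha Hb)).
  rewrite (Cint_ext (fun s => f (segment a b (/ 2 * s)%R)) (fun s => f (segment a (midpoint a b) s))).
  rewrite (Cint_ext (fun s => f (segment a b (/ 2 * s + / 2)%R)) (fun s => f (segment (midpoint a b) b s))).
  - unfold midpoint. field.
  - intros s _. f_equal. unfold segment, midpoint.
    rewrite RtoC_plus, RtoC_mult, RtoC_half. field.
  - intros s _. f_equal. unfold segment, midpoint.
    rewrite RtoC_mult, RtoC_half. field.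
Qed.

(** An affine function integrates exactly to its value at the midpoint times [b - a]; the difference
    from it is estimated by [Cint_bound]. *)
Lemma seg_int_approx (a b z al be : C) (M : R) : (Cmod a < delta)%R -> (Cmod b < delta)%R ->
  (forall s, (0 <= s <= 1)%R ->
     (Cmod (f (segment a b s) - (al + be * (segment a b s - z))) <= M)%R) ->
  (Cmod (seg_int f a b - (b - a) * (al + be * (midpoint a b - z))) <= 2 * M * Cmod (b - a))%R.
Proof.
  intros Ha Hb HM.
  set (p := al + be * (a - z)). set (q := be * (b - a)).
  assert (E : al + be * (midpoint a b - z) = Cint (fun s => p + RtoC s * q)).
  { rewrite Cint_affine. unfold p, q, midpoint. field. }
  assert (I1 := Cint_able_segment a b Ha Hb). assert (I2 := Cint_able_affine p q).
  assert (E2 : Cint (fun s => f (segment a b s)) =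
     Cint (fun s => f (segment a b s) + - (p + RtoC s * q)) + Cint (fun s => p + RtoC s * q)).
  { rewrite <- Cint_plus.
    - apply Cint_ext. intros. ring.
    - apply Cint_able_plus; [exact I1|apply Cint_able_opp, I2].
    - exact I2. }
  unfold seg_int. rewrite E, E2.
  match goal with |- (Cmod ?X <= _)%R => replace X with
    ((b - a) * Cint (fun s => f (segment a b s) + - (p + RtoC s * q))) by ring end.
  rewrite Cmod_mult, Rmult_comm. apply Rmult_le_compat_r; [apply Cmod_ge_0|].
  apply Cint_bound.
  - apply Cint_able_plus; [exact I1|apply Cint_able_opp, I2].
  - intros s Hs. specialize (HM s Hs).
    replace (f (segment a b s) + - (p + s * q))
      with (f (segment a b s) - (al + be * (segment a b s - z))) by (unfold p, q, segment; ring).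
    exact HM.
Qed.

Definition tri_int (t : C * C * C) : C :=
  let '(a, b, c) := t in seg_int f a b + seg_int f b c + seg_int f c a.

Definition perimeter (t : C * C * C) : R :=
  let '(a, b, c) := t in (Cmod (b - a) + Cmod (c - b) + Cmod (a - c))%R.

Definition tri_in (r : R) (t : C * C * C) : Prop :=
  let '(a, b, c) := t in (Cmod a <= r)%R /\ (Cmod b <= r)%R /\ (Cmod c <= r)%R.

Lemma midpoint_le (a b : C) (r : R) : (Cmod a <= r)%R -> (Cmod b <= r)%R ->
  (Cmod (midpoint a b) <= r)%R.
Proof.
  intros Ha Hb. replace (midpoint a b) with (segment a b (/ 2) - 0).
  - apply segment_dist; [lra| |]; [replace (a - 0) with a by ring|replace (b - 0) with b by ring]; assumption.
  - unfold segment, midpoint. rewrite RtoC_half. field.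
Qed.

Lemma Cmod_half (z : C) : Cmod (z / 2) = (Cmod z / 2)%R.
Proof.
  rewrite Cmod_div by (intros E; apply RtoC_inj in E; lra).
  rewrite Cmod_R, Rabs_pos_eq by lra. reflexivity.
Qed.

(** The property of having an integral at most [eps] times the squared
    perimeter passes from the four half-sized triangles to the whole. *)
Lemma tri_subdivide (r eps : R) (t : C * C * C) : (r < delta)%R -> tri_in r t ->
  (eps * perimeter t ^ 2 < Cmod (tri_int t))%R ->
  exists t', tri_in r t' /\ (eps * perimeter t' ^ 2 < Cmod (tri_int t'))%R /\
    perimeter t' = (perimeter t / 2)%R /\
    (Cmod (fst (fst t') - fst (fst t)) <= perimeter t)%R.
Proof.
  destruct t as [[a b] c]. intros Hr (Ha & Hb & Hc) H.
  set (m1 := midpoint a b). set (m2 := midpoint b c). set (m3 := midpoint c a).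
  assert (H1 : (Cmod m1 <= r)%R) by (apply midpoint_le; assumption).
  assert (H2 : (Cmod m2 <= r)%R) by (apply midpoint_le; assumption).
  assert (H3 : (Cmod m3 <= r)%R) by (apply midpoint_le; assumption).
  assert (P : forall x y z, (x - y = z / 2 \/ x - y = - (z / 2)) -> Cmod (x - y) = (Cmod z / 2)%R).
  { intros x y z [E|E]; rewrite E; [|rewrite Cmod_opp]; apply Cmod_half. }
  (* The sides of the middle triangle are run twice, in opposite directions, and cancel. *)
  assert (S : tri_int (a, b, c) = tri_int (a, m1, m3) + tri_int (m1, b, m2)
      + tri_int (m3, m2, c) + tri_int (m1, m2, m3)).
  { unfold tri_int.
    rewrite (seg_int_split a b), (seg_int_split b c), (seg_int_split c a) by lra.
    fold m1 m2 m3.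
    rewrite (seg_int_rev m1 m3), (seg_int_rev m1 m2), (seg_int_rev m2 m3) by lra. ring. }
  assert (P1 : perimeter (a, m1, m3) = (perimeter (a, b, c) / 2)%R).
  { unfold perimeter.
    rewrite (P m1 a (b - a)) by (left; unfold m1, midpoint; field).
    rewrite (P m3 m1 (c - b)) by (left; unfold m1, m3, midpoint; field).
    rewrite (P a m3 (a - c)) by (left; unfold m3, midpoint; field). field. }
  assert (P2 : perimeter (m1, b, m2) = (perimeter (a, b, c) / 2)%R).
  { unfold perimeter.
    rewrite (P b m1 (b - a)) by (left; unfold m1, midpoint; field).
    rewrite (P m2 b (c - b)) by (left; unfold m2, midpoint; field).
    rewrite (P m1 m2 (a - c)) by (left; unfold m1, m2, midpoint; field). field. }
  assert (P3 : perimeter (m3, m2, c) = (perimeter (a, b, c) / 2)%R).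
  { unfold perimeter.
    rewrite (P m2 m3 (b - a)) by (left; unfold m2, m3, midpoint; field).
    rewrite (P c m2 (c - b)) by (left; unfold m2, midpoint; field).
    rewrite (P m3 c (a - c)) by (left; unfold m3, midpoint; field). field. }
  assert (P4 : perimeter (m1, m2, m3) = (perimeter (a, b, c) / 2)%R).
  { unfold perimeter.
    rewrite (P m2 m1 (a - c)) by (right; unfold m1, m2, midpoint; field).
    rewrite (P m3 m2 (b - a)) by (right; unfold m2, m3, midpoint; field).
    rewrite (P m1 m3 (c - b)) by (right; unfold m1, m3, midpoint; field). field. }
  assert (D1 : (Cmod (m1 - a) <= perimeter (a, b, c))%R).
  { rewrite (P m1 a (b - a)) by (left; unfold m1, midpoint; field). unfold perimeter.
    generalize (Cmod_ge_0 (b - a)) (Cmod_ge_0 (c - b)) (Cmod_ge_0 (a - c)). lra. }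
  assert (D3 : (Cmod (m3 - a) <= perimeter (a, b, c))%R).
  { rewrite (P m3 a (a - c)) by (right; unfold m3, midpoint; field). unfold perimeter.
    generalize (Cmod_ge_0 (b - a)) (Cmod_ge_0 (c - b)) (Cmod_ge_0 (a - c)). lra. }
  assert (D0 : (Cmod (a - a) <= perimeter (a, b, c))%R).
  { replace (a - a) with (RtoC 0) by ring. rewrite Cmod_0. unfold perimeter.
    generalize (Cmod_ge_0 (b - a)) (Cmod_ge_0 (c - b)) (Cmod_ge_0 (a - c)). lra. }
  set (D := perimeter (a, b, c)) in *.
  destruct (Rlt_le_dec (eps * (D / 2) ^ 2) (Cmod (tri_int (a, m1, m3)))) as [L1|L1].
  { exists (a, m1, m3). rewrite P1. repeat split; assumption. }
  destruct (Rlt_le_dec (eps * (D / 2) ^ 2) (Cmod (tri_int (m1, b, m2)))) as [L2|L2].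
  { exists (m1, b, m2). rewrite P2. repeat split; assumption. }
  destruct (Rlt_le_dec (eps * (D / 2) ^ 2) (Cmod (tri_int (m3, m2, c)))) as [L3|L3].
  { exists (m3, m2, c). rewrite P3. repeat split; assumption. }
  destruct (Rlt_le_dec (eps * (D / 2) ^ 2) (Cmod (tri_int (m1, m2, m3)))) as [L4|L4].
  { exists (m1, m2, m3). rewrite P4. repeat split; assumption. }
  exfalso. rewrite S in H.
  generalize (Cmod_triangle (tri_int (a, m1, m3) + tri_int (m1, b, m2) + tri_int (m3, m2, c)) (tri_int (m1, m2, m3)))
   (Cmod_triangle (tri_int (a, m1, m3) + tri_int (m1, b, m2)) (tri_int (m3, m2, c)))
   (Cmod_triangle (tri_int (a, m1, m3)) (tri_int (m1, b, m2))). 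
  replace (eps * (D / 2) ^ 2)%R with (eps * D ^ 2 / 4)%R in * by field. lra.
Qed.

(** Goursat's argument. If the integral were not 0, repeated subdivision would give triangles of
    perimeter [D / 2 ^ n], shrinking to a point [z], whose integrals exceed [eps] times the squared
    perimeter. Differentiability at [z] forbids this once the triangles are small. *)
Lemma tri_int_0 (t : C * C * C) (r : R) : (r < delta)%R -> tri_in r t -> tri_int t = 0.
Proof.
  intros Hr Ht. apply NNPP. intros Hn. apply Cmod_gt_0 in Hn.
  set (D := perimeter t).
  assert (HD : (0 <= D)%R).
  { unfold D, perimeter. destruct t as [[a b] c].
    generalize (Cmod_ge_0 (b - a)) (Cmod_ge_0 (c - b)) (Cmod_ge_0 (a - c)). lra. }
  (* The [+ 1] covers degenerate triangles, with [D = 0]; the factor 2 makes the inequality for [t]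
     strict. *)
  set (eps := (Cmod (tri_int t) / (2 * (D ^ 2 + 1)))%R).
  assert (HD2 : (0 <= D ^ 2)%R) by nra.
  assert (He : (0 < eps)%R) by (apply Rdiv_lt_0_compat; lra).
  set (bad := fun t => tri_in r t /\ (eps * perimeter t ^ 2 < Cmod (tri_int t))%R).
  assert (Hbad : bad t).
  { split; [exact Ht|]. fold D.
    assert (E : (eps * (2 * (D ^ 2 + 1)) = Cmod (tri_int t))%R) by (unfold eps; field; lra).
    rewrite <- E. apply Rmult_lt_compat_l; lra. }
  (* Choice of a bad triangle of half the size; the value means something only when [t] is bad. *)
  set (next := fun t => epsilon (inhabits t) (fun t' => bad t' /\
    perimeter t' = (perimeter t / 2)%R /\ (Cmod (fst (fst t') - fst (fst t)) <= perimeter t)%R)).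
  assert (Hnext : forall t, bad t -> bad (next t) /\ perimeter (next t) = (perimeter t / 2)%R /\
     (Cmod (fst (fst (next t)) - fst (fst t)) <= perimeter t)%R).
  { intros t' [B1 B2]. apply epsilon_spec.
    destruct (tri_subdivide r eps t' Hr B1 B2) as (t'' & A1 & A2 & A3 & A4).
    exists t''. repeat split; assumption. }
  set (u := fix u n := match n with O => t | S n => next (u n) end).
  assert (Hu : forall n, bad (u n) /\ perimeter (u n) = (D * (/ 2) ^ n)%R).
  { induction n as [|n [IH1 IH2]].
    - simpl. split; [exact Hbad|]. unfold D. ring.
    - destruct (Hnext _ IH1) as (A1 & A2 & _). split; [exact A1|]. simpl u. rewrite A2, IH2. simpl. field. }
  destruct (geometric_limit (fun n => fst (fst (u n))) D) as [z Hz].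
  { intros n. destruct (Hu n) as [A1 A2]. rewrite <- A2. apply (Hnext _ A1). }
  assert (Hp : forall n, (0 < (/ 2) ^ n)%R) by (intros; apply pow_lt; lra).
  assert (Hsmall : forall e, (0 < e)%R -> exists n, (3 * D * (/ 2) ^ n < e)%R).
  { intros e Hpe. destruct (pow_lt_1_zero (/ 2)%R ltac:(rewrite Rabs_pos_eq; lra) (e / (3 * D + 1))%R) as [N HN].
    - apply Rdiv_lt_0_compat; lra.
    - exists N. specialize (HN N (le_n N)). rewrite Rabs_pos_eq in HN by (left; apply Hp).
      apply Rmult_lt_compat_r with (r := (3 * D + 1)%R) in HN; [|lra].
      unfold Rdiv in HN. rewrite Rmult_assoc, Rinv_l in HN by lra. specialize (Hp N). nra. }
  assert (Hzr : (Cmod z <= r)%R).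
  { apply Rnot_lt_le. intros Hlt. destruct (Hsmall (Cmod z - r)%R ltac:(lra)) as [n Hn'].
    specialize (Hz n). destruct (Hu n) as [[B1 _] _]. 
    destruct (u n) as [[a b] c]. simpl in Hz. destruct B1 as (Ha & _).
    generalize (Cmod_minus_triangle z a). rewrite Cmod_minus_sym. 
    assert (0 <= D * (/ 2) ^ n)%R by (generalize (Hp n); nra). lra. }
  destruct (Hf z) as [d Hd]; [lra|].
  (* Points of the selected triangle are within [3 * Dn] of [z]; the error [eps / 6 * (3 * Dn)] of
     the affine approximation, doubled by [seg_int_approx], is [eps * Dn]. *)
  assert (Hd' := proj1 (cderivP f z d) Hd (eps / 6)%R ltac:(lra)).
  destruct Hd' as [del [Hdel Hd']].
  destruct (Hsmall del Hdel) as [n Hn'].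
  destruct (Hu n) as [[B1 B2] B3]. specialize (Hz n). simpl in Hz.
  destruct (u n) as [[a b] c]. simpl in Hz. destruct B1 as (Ha & Hb & Hc).
  set (Dn := (D * (/ 2) ^ n)%R) in *.
  replace (2 * D * (/ 2) ^ n)%R with (2 * Dn)%R in Hz by (unfold Dn; ring).
  replace (3 * D * (/ 2) ^ n)%R with (3 * Dn)%R in Hn' by (unfold Dn; ring).
  assert (HDn : (0 <= Dn)%R) by (unfold Dn; generalize (Hp n); nra).
  assert (B3' := B3). unfold perimeter in B3'.
  assert (G1 := Cmod_ge_0 (b - a)). assert (G2 := Cmod_ge_0 (c - b)). assert (G3 := Cmod_ge_0 (a - c)).
  assert (Va : (Cmod (a - z) <= 3 * Dn)%R) by lra.
  assert (Vb : (Cmod (b - z) <= 3 * Dn)%R).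
  { replace (b - z) with ((b - a) + (a - z)) by ring. eapply Rle_trans; [apply Cmod_triangle|]. lra. }
  assert (Vc : (Cmod (c - z) <= 3 * Dn)%R).
  { replace (c - z) with (- (a - c) + (a - z)) by ring.
    eapply Rle_trans; [apply Cmod_triangle|]. rewrite Cmod_opp. lra. }
  assert (Happ : forall p q, (Cmod (p - z) <= 3 * Dn)%R -> (Cmod (q - z) <= 3 * Dn)%R ->
    (Cmod p <= r)%R -> (Cmod q <= r)%R ->
    (Cmod (seg_int f p q - (q - p) * (f z + d * (midpoint p q - z))) <= eps * Dn * Cmod (q - p))%R).
  { intros p q Hp' Hq' Hpr Hqr.
    replace (eps * Dn)%R with (2 * (eps / 6 * (3 * Dn)))%R by field.
    apply seg_int_approx; [lra|lra|]. intros s Hs.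
    assert (Hw := segment_dist p q z s _ Hs Hp' Hq').
    replace (f (segment p q s) - (f z + d * (segment p q s - z)))
      with (f (segment p q s) - f z - d * (segment p q s - z)) by ring.
    eapply Rle_trans; [apply Hd'; lra|]. apply Rmult_le_compat_l; lra. }
  assert (A1 := Happ a b Va Vb Ha Hb). assert (A2 := Happ b c Vb Vc Hb Hc). assert (A3 := Happ c a Vc Va Hc Ha).
  rewrite B3 in B2. apply (Rlt_not_le _ _ B2).
  (* The integrals of the affine part add up to 0 around the triangle. *)
  replace (tri_int (a, b, c)) with
    ((seg_int f a b - (b - a) * (f z + d * (midpoint a b - z)))
     + (seg_int f b c - (c - b) * (f z + d * (midpoint b c - z)))
     + (seg_int f c a - (a - c) * (f z + d * (midpoint c a - z))))
    by (unfold tri_int, midpoint; field).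
  eapply Rle_trans; [apply Cmod_triangle|].
  eapply Rle_trans; [apply Rplus_le_compat_r, Cmod_triangle|].
  replace (eps * Dn ^ 2)%R with (eps * Dn * Cmod (b - a) + eps * Dn * Cmod (c - b) + eps * Dn * Cmod (a - c))%R
    by (rewrite <- B3'; ring). lra.
Qed.

(** As the triangle [0, z, w] has integral 0, the increment from [z] to [w] is the integral along
    the segment, on which [f] is nearly constant. *)
Lemma holomorphic_primitive : forall z, (Cmod z < delta)%R -> cderiv (seg_int f 0) z (f z).
Proof.
  intros z Hz. destruct (Hf z Hz) as [d Hd]. apply cderiv_continuous in Hd.
  apply cderivP. intros eps He.
  assert (Hc := proj1 (climP _ _ _) Hd (eps / 2)%R ltac:(lra)).
  apply nbhd_planeP in Hc. destruct Hc as [e [He' Hc]].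
  exists (Rmin e (delta - Cmod z)). split; [apply Rmin_glb_lt; lra|].
  intros w Hw. assert (E1 := Rmin_l e (delta - Cmod z)). assert (E2 := Rmin_r e (delta - Cmod z)).
  assert (Hwd : (Cmod w < delta)%R).
  { replace w with ((w - z) + z) by ring. eapply Rle_lt_trans; [apply Cmod_triangle|]. lra. }
  assert (HT : tri_int (RtoC 0, z, w) = 0).
  { apply tri_int_0 with (Rmax (Cmod z) (Cmod w)); [apply Rmax_lub_lt; assumption|].
    split; [rewrite Cmod_0; apply Rle_trans with (Cmod z); [apply Cmod_ge_0|apply Rmax_l]|].
    split; [apply Rmax_l|apply Rmax_r]. }
  assert (Hd0 : (Cmod 0 < delta)%R) by (rewrite Cmod_0; apply Rle_lt_trans with (Cmod z); [apply Cmod_ge_0|exact Hz]).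
  unfold tri_int in HT. rewrite (seg_int_rev 0 w Hd0 Hwd) in HT.
  assert (HI : seg_int f 0 w - seg_int f 0 z = seg_int f z w).
  { replace (seg_int f z w) with (seg_int f 0 z + seg_int f z w + - seg_int f 0 w - (seg_int f 0 z - seg_int f 0 w)) by ring.
    rewrite HT. ring. }
  rewrite HI.
  replace (seg_int f z w - f z * (w - z)) with (seg_int f z w - (w - z) * (f z + 0 * (midpoint z w - 0))) by ring.
  replace (eps * Cmod (w - z))%R with (2 * (eps / 2) * Cmod (w - z))%R by field.
  apply seg_int_approx; [exact Hz|exact Hwd|]. intros s Hs.
  replace (f (segment z w s) - (f z + 0 * (segment z w s - 0))) with (f (segment z w s) - f z) by ring.
  left. apply Hc. apply Rle_lt_trans with (Cmod (w - z)); [|lra].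
  apply segment_dist; [exact Hs| |lra]. replace (z - z) with (RtoC 0) by ring. rewrite Cmod_0. apply Cmod_ge_0.
Qed.
End Goursat.

Lemma primitive_exists (f : C -> C) :
  nbhd_plane 0 (fun v => exists d, cderiv f v d) ->
  exists F, nbhd_plane 0 (fun v => cderiv F v (f v)).
Proof.
  intros H. apply nbhd_planeP in H. destruct H as [delta [Hd H]].
  exists (seg_int f 0). apply nbhd_planeP. exists delta. split; [exact Hd|].
  intros y Hy. replace (y - 0) with y in Hy by ring.
  apply holomorphic_primitive with delta; [|exact Hy].
  intros v Hv. apply H. replace (v - 0) with v by ring. exact Hv.
Qed.

(** Reduces a complex function along a segment to real functions, [p] being [Re] or [Im], so that
    the real mean value theorem applies. *)
Lemma component_derive_0 (g : C -> C) (z w : C) (s : R) (p : C -> R) :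
  (forall x y, p (x - y) = (p x - p y)%R) -> (forall x, (Rabs (p x) <= Cmod x)%R) ->
  cderiv g (segment z w s) 0 -> is_derive (fun s => p (g (segment z w s))) s 0%R.
Proof.
  intros Hlin Hp H. apply is_derive_Reals. intros eps He.
  assert (Hk : (0 < Cmod (w - z) + 1)%R) by (generalize (Cmod_ge_0 (w - z)); lra).
  set (k := (Cmod (w - z) + 1)%R) in *.
  assert (Hek : (0 < eps / (2 * k))%R) by (apply Rdiv_lt_0_compat; lra).
  destruct (proj1 (cderivP _ _ _) H _ Hek) as [delta [Hd H']].
  assert (Hdk : (0 < delta / k)%R) by (apply Rdiv_lt_0_compat; lra).
  exists (mkposreal _ Hdk). intros h Hh Hhd. simpl in Hhd.
  assert (E : segment z w (s + h) - segment z w s = RtoC h * (w - z))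
    by (unfold segment; rewrite RtoC_plus; ring).
  assert (Hb : (Cmod (segment z w (s + h) - segment z w s) <= Rabs h * k)%R).
  { rewrite E, Cmod_mult, Cmod_R. apply Rmult_le_compat_l; [apply Rabs_pos|unfold k; lra]. }
  assert (Hb2 : (Rabs h * k < delta)%R).
  { replace delta with (delta / k * k)%R by (field; lra). apply Rmult_lt_compat_r; lra. }
  specialize (H' (segment z w (s + h)) ltac:(lra)).
  replace (g (segment z w (s + h)) - g (segment z w s) - 0 * (segment z w (s + h) - segment z w s))
    with (g (segment z w (s + h)) - g (segment z w s)) in H' by ring.
  rewrite Rminus_0_r. unfold Rdiv. rewrite Rabs_mult, Rabs_inv, <- Hlin.
  assert (Hh0 := Rabs_pos_lt h Hh).
  apply Rle_lt_trans with ((eps / (2 * k) * (Rabs h * k)) * / Rabs h)%R.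
  - apply Rmult_le_compat_r; [left; apply Rinv_0_lt_compat, Hh0|].
    eapply Rle_trans; [apply Hp|]. eapply Rle_trans; [exact H'|].
    apply Rmult_le_compat_l; lra.
  - replace (eps / (2 * k) * (Rabs h * k) * / Rabs h)%R with (eps / 2)%R by (field; lra). lra.
Qed.

(** The derivative may fail to vanish at the centre, where continuity is enough. *)
Lemma locally_constant (g : C -> C) :
  filterlim g (nbhd_plane 0) (nbhd_plane (g 0)) ->
  nbhd_plane 0 (fun v => v <> 0 -> cderiv g v 0) ->
  nbhd_plane 0 (fun v => g v = g 0).
Proof.
  intros Hc Hd. apply nbhd_planeP in Hd. destruct Hd as [delta [Hdel Hd]].
  apply nbhd_planeP. exists delta. split; [exact Hdel|]. intros v Hv.
  destruct (Ceq_dec v 0) as [->|Hv0]; [reflexivity|].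
  replace (v - 0) with v in Hv by ring.
  assert (Hder : forall s, (0 < s <= 1)%R -> cderiv g (segment 0 v s) 0).
  { intros s Hs. apply Hd; unfold segment.
    - replace (0 + s * (v - 0) - 0) with (s * v) by ring. rewrite Cmod_mult, Cmod_R, Rabs_pos_eq by lra.
      generalize (Cmod_ge_0 v). nra.
    - replace (0 + s * (v - 0)) with (s * v) by ring. apply Cmult_neq_0; [|exact Hv0].
      intros E. apply RtoC_inj in E. lra. }
  assert (S0 : segment 0 v 0 = 0) by (unfold segment; ring).
  assert (S1 : segment 0 v 1 = v) by (unfold segment; ring).
  assert (Hcont : forall s, (0 <= s <= 1)%R ->
     filterlim (fun s => g (segment 0 v s)) (locally s) (nbhd_plane (g (segment 0 v s)))).
  { intros s Hs. eapply filterlim_comp; [apply segment_continuous|].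
    destruct (Req_dec s 0) as [->|Hs0].
    - rewrite S0. exact Hc.
    - apply cderiv_continuous with (RtoC 0), Hder. lra. }
  assert (Hp : forall p : C -> R, (forall x y, p (x - y) = (p x - p y)%R) ->
     (forall x, (Rabs (p x) <= Cmod x)%R) ->
     (forall z, filterlim p (nbhd_plane z) (locally (p z))) -> p (g v) = p (g 0)).
  { intros p Hlin Hb Hpc.
    destruct (MVT_gen (fun s => p (g (segment 0 v s))) 0 1 (fun _ => 0%R)) as [c [_ Hmv]].
    - intros x Hx. rewrite Rmin_left, Rmax_right in Hx by lra.
      apply component_derive_0; auto. apply Hder. lra.
    - intros x Hx. rewrite Rmin_left, Rmax_right in Hx by lra.
      apply continuity_pt_filterlim. eapply filterlim_comp; [apply Hcont; lra|apply Hpc].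
    - rewrite S0, S1 in Hmv. lra. }
  apply C_ext; apply Hp.
  - intros. unfold Re. simpl. ring.
  - apply re_le_Cmod.
  - apply filterlim_Re.
  - intros. unfold Im. simpl. ring.
  - apply im_le_Cmod.
  - apply filterlim_Im.
Qed.

(** * Continuation in a covering *)

(** Compactness of the interval in the form of Cousin: the supremum of the [x] with [P a x] has this
    property itself and cannot lie below [b]. This replaces subdivisions of paths and squares into
    small pieces. *)
Lemma interval_induction (P : R -> R -> Prop) (a b : R) : (a <= b)%R ->
  (forall u v w, (a <= u <= v)%R -> (v <= w <= b)%R -> P u v -> P v w -> P u w) ->
  (forall x, (a <= x <= b)%R -> exists delta, (0 < delta)%R /\
     forall u v, (a <= u <= x)%R -> (x <= v <= b)%R -> (x - delta < u)%R -> (v < x + delta)%R -> P u v) ->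
  P a b.
Proof.
  intros Hab Hadd Hloc.
  destruct (completeness (fun x => (a <= x <= b)%R /\ P a x)) as [m [Hm1 Hm2]].
  - exists b. intros x [Hx _]. lra.
  - exists a. split; [lra|]. destruct (Hloc a ltac:(lra)) as [d [Hd H]]. apply H; lra.
  - assert (Ha : (a <= m)%R).
    { apply Hm1. split; [lra|]. destruct (Hloc a ltac:(lra)) as [d [Hd H]]. apply H; lra. }
    assert (Hb : (m <= b)%R) by (apply Hm2; intros x [Hx _]; lra).
    destruct (Hloc m ltac:(lra)) as [d [Hd H]].
    assert (Hx : exists x, ((a <= x <= b)%R /\ P a x) /\ (m - d < x)%R).
    { apply NNPP. intros Hn. assert (m <= m - d)%R; [|lra]. apply Hm2. intros x Hx.
      apply Rnot_lt_le. intros Hlt. apply Hn. exists x. auto. }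
    destruct Hx as [x [[Hx1 Hx2] Hx3]].
    assert (Hxm : (x <= m)%R) by (apply Hm1; auto).
    assert (Hext : forall v, (m <= v <= b)%R -> (v < m + d)%R -> P a v).
    { intros v Hv1 Hv2. apply Hadd with x; [lra|lra|exact Hx2|]. apply H; lra. }
    destruct (Rlt_le_dec m b) as [Hlt|Hle].
    + exfalso. set (v := Rmin b (m + d / 2)).
      assert (E1 := Rmin_l b (m + d / 2)). assert (E2 := Rmin_r b (m + d / 2)). fold v in E1, E2.
      assert (E3 : (m < v)%R) by (apply Rmin_glb_lt; lra).
      assert (v <= m)%R; [|lra]. apply Hm1. split; [lra|]. apply Hext; lra.
    + replace b with m by lra. apply Hext; lra.
Qed.

(** Local sections are functions [tau : T -> D], of which only the values near a
    point matter; [eqv Q] is equality in the fibre at [Q], [N Q] is the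
    neighbourhood filter and [act] are the deck transformations. *)
Record is_covering {T D G : Type} (N : T -> (T -> Prop) -> Prop) (X : T -> Prop)
    (eqv : T -> D -> D -> Prop) (adm : T -> (T -> D) -> Prop) (act : G -> D -> D) : Prop := {
  cov_sym : forall Q d d', eqv Q d d' -> eqv Q d' d;
  cov_trans : forall Q d d' d'', eqv Q d d' -> eqv Q d' d'' -> eqv Q d d'';
  cov_exists : forall Q, X Q -> exists tau, adm Q tau;
  cov_open : forall Q tau, adm Q tau -> N Q (fun Q' => adm Q' tau);
  cov_refl : forall Q tau, adm Q tau -> eqv Q (tau Q) (tau Q);
  cov_eqv : forall Q tau tau', adm Q tau -> adm Q tau' ->
    N Q (fun Q' => eqv Q' (tau Q') (tau' Q') <-> eqv Q (tau Q) (tau' Q));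
  cov_act_adm : forall Q g tau, adm Q tau -> adm Q (fun Q' => act g (tau Q'));
  cov_act_eqv : forall Q g d d', eqv Q d d' -> eqv Q (act g d) (act g d');
  cov_act_trans : forall Q tau tau', X Q -> adm Q tau -> adm Q tau' ->
    exists g, eqv Q (act g (tau Q)) (tau' Q) }.

Arguments cov_sym {T D G N X eqv adm act}.
Arguments cov_trans {T D G N X eqv adm act}.
Arguments cov_exists {T D G N X eqv adm act}.
Arguments cov_open {T D G N X eqv adm act}.
Arguments cov_refl {T D G N X eqv adm act}.
Arguments cov_eqv {T D G N X eqv adm act}.
Arguments cov_act_adm {T D G N X eqv adm act}.
Arguments cov_act_eqv {T D G N X eqv adm act}.
Arguments cov_act_trans {T D G N X eqv adm act}.

Section Covering.
Context {T D G : Type} {N : T -> (T -> Prop) -> Prop} {X : T -> Prop}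
  {eqv : T -> D -> D -> Prop} {adm : T -> (T -> D) -> Prop} {act : G -> D -> D}.
Hypothesis cov : is_covering N X eqv adm act.

Definition maps_on {U : UniformSpace} (A : U -> Prop) (H : U -> T) : Prop :=
  forall p, A p -> X (H p) /\ filterlim H (within A (locally p)) (N (H p)).

(** A continuous lift [d] of [H] over [A]: near each parameter it is read off from one admissible
    section. This avoids a topology on the total space, which for primitives would be a space of
    germs. *)
Definition family {U : UniformSpace} (A : U -> Prop) (H : U -> T) (d : U -> D) : Prop :=
  forall p, A p -> exists tau, adm (H p) tau /\
    within A (locally p) (fun q => eqv (H q) (d q) (tau (H q))).

(** Agreement of the lifts is decided by their local sections, for which [cov_eqv] makes it locally
    constant. Connectedness of the interval then gives uniqueness of lifts. *)
Lemma family_compare {U : UniformSpace} (A : U -> Prop) (H : U -> T) (d d' : U -> D) :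
  maps_on A H -> family A H d -> family A H d' -> forall p, A p ->
  within A (locally p) (fun q => eqv (H q) (d q) (d' q) <-> eqv (H p) (d p) (d' p)).
Proof.
  intros HH Hd Hd' p Hp.
  destruct (Hd p Hp) as [tau [Ht Hdt]]. destruct (Hd' p Hp) as [tau' [Ht' Hdt']].
  assert (Hc := proj2 (HH p Hp) _ (cov_eqv cov _ _ _ Ht Ht')). unfold filtermap in Hc.
  assert (Hp1 : eqv (H p) (d p) (tau (H p))) by exact (locally_singleton p _ Hdt Hp).
  assert (Hp2 : eqv (H p) (d' p) (tau' (H p))) by exact (locally_singleton p _ Hdt' Hp).
  assert (K : forall q, eqv (H q) (d q) (tau (H q)) -> eqv (H q) (d' q) (tau' (H q)) ->
     (eqv (H q) (d q) (d' q) <-> eqv (H q) (tau (H q)) (tau' (H q)))).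
  { intros q E1 E2. split; intros E.
    - apply (cov_trans cov) with (d q); [apply (cov_sym cov), E1|].
      apply (cov_trans cov) with (d' q); assumption.
    - apply (cov_trans cov) with (tau (H q)); [exact E1|].
      apply (cov_trans cov) with (tau' (H q)); [exact E|apply (cov_sym cov), E2]. }
  generalize (filter_and _ _ (filter_and _ _ Hdt Hdt') Hc).
  apply filter_imp. intros q [[E1 E2] E3]. rewrite (K q E1 E2), (K p Hp1 Hp2). exact E3.
Qed.

Lemma family_comp {U V : UniformSpace} (A : U -> Prop) (B : V -> Prop) (l : U -> V)
    (H : V -> T) (d : V -> D) :
  (forall p, A p -> B (l p)) -> (forall p, A p -> filterlim l (within A (locally p)) (locally (l p))) ->
  family B H d -> family A (fun p => H (l p)) (fun p => d (l p)).
Proof.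
  intros Hl Hc Hd p Hp. destruct (Hd (l p) (Hl p Hp)) as [tau [Ht Hdt]]. exists tau. split; [exact Ht|].
  assert (K := Hc p Hp _ Hdt). unfold filtermap, within in *.
  revert K. apply filter_imp. intros q Hq Aq. apply Hq; auto.
Qed.

Lemma maps_on_comp {U V : UniformSpace} (A : U -> Prop) (B : V -> Prop) (l : U -> V) (H : V -> T) :
  (forall p, A p -> B (l p)) -> (forall p, A p -> filterlim l (within A (locally p)) (locally (l p))) ->
  maps_on B H -> maps_on A (fun p => H (l p)).
Proof.
  intros Hl Hc HH p Hp. destruct (HH (l p) (Hl p Hp)) as [H1 H2]. split; [exact H1|].
  intros P HP. assert (K := Hc p Hp _ (H2 P HP)). unfold filtermap, within in *.
  revert K. apply filter_imp. intros q Hq Aq. apply Hq; auto.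
Qed.

Lemma family_sub {U : UniformSpace} (A B : U -> Prop) (H : U -> T) (d : U -> D) :
  (forall p, A p -> B p) -> family B H d -> family A H d.
Proof.
  intros HAB. apply (family_comp A B (fun p => p)); [exact HAB|].
  intros p _. apply filterlim_within; [typeclasses eauto|apply filterlim_id].
Qed.

Lemma maps_on_sub {U : UniformSpace} (A B : U -> Prop) (H : U -> T) :
  (forall p, A p -> B p) -> maps_on B H -> maps_on A H.
Proof.
  intros HAB. apply (maps_on_comp A B (fun p => p)); [exact HAB|].
  intros p _. apply filterlim_within; [typeclasses eauto|apply filterlim_id].
Qed.

Lemma family_interval (a b : R) (H : R -> T) (d d' : R -> D) : (a <= b)%R ->
  maps_on (fun r => a <= r <= b)%R H ->
  family (fun r => a <= r <= b)%R H d -> family (fun r => a <= r <= b)%R H d' ->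
  (eqv (H a) (d a) (d' a) <-> eqv (H b) (d b) (d' b)).
Proof.
  intros Hab HH Hd Hd'.
  apply (interval_induction (fun u v => eqv (H u) (d u) (d' u) <-> eqv (H v) (d v) (d' v))); [exact Hab| |].
  - intros. tauto.
  - intros x Hx. destruct (family_compare _ H d d' HH Hd Hd' x Hx) as [delta Hc].
    exists delta. split; [apply cond_pos|]. intros u v Hu Hv H1 H2.
    assert (K : forall w, (a <= w <= b)%R -> (x - delta < w < x + delta)%R ->
      (eqv (H w) (d w) (d' w) <-> eqv (H x) (d x) (d' x))).
    { intros w Hw Hwx. apply Hc; [|exact Hw]. apply Rabs_def1; unfold minus, plus, opp; simpl; lra. }
    rewrite (K u), (K v) by lra. tauto.
Qed.

Lemma family_unique (H : R -> T) (d d' : R -> D) (r0 : R) : I01 r0 ->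
  maps_on I01 H -> family I01 H d -> family I01 H d' -> eqv (H r0) (d r0) (d' r0) ->
  forall r, I01 r -> eqv (H r) (d r) (d' r).
Proof.
  unfold I01. intros Hr0 HH Hd Hd' E r Hr.
  assert (K : forall u, (0 <= u <= 1)%R -> (eqv (H 0%R) (d 0%R) (d' 0%R) <-> eqv (H u) (d u) (d' u))).
  { intros u Hu. apply family_interval; [lra| | |].
    - revert HH. apply maps_on_sub. intros; lra.
    - revert Hd. apply family_sub. intros; lra.
    - revert Hd'. apply family_sub. intros; lra. }
  apply (K r Hr), (K r0 Hr0), E.
Qed.

Lemma family_act {U : UniformSpace} (A : U -> Prop) (H : U -> T) (d : U -> D) (g : G) :
  family A H d -> family A H (fun p => act g (d p)).
Proof.
  intros Hd p Hp. destruct (Hd p Hp) as [tau [Ht Hdt]].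
  exists (fun Q => act g (tau Q)). split; [apply (cov_act_adm cov), Ht|].
  revert Hdt. apply filter_imp. intros q. apply (cov_act_eqv cov).
Qed.

(** Supplies the deck transformation by which one lift is corrected before it is glued to, or
    compared with, another. *)
Lemma family_transitive {U : UniformSpace} (A B : U -> Prop) (H : U -> T) (d d' : U -> D) (p : U) :
  A p -> B p -> X (H p) -> family A H d -> family B H d' ->
  exists g, eqv (H p) (act g (d p)) (d' p).
Proof.
  intros Ap Bp Xp Hd Hd'. destruct (Hd p Ap) as [tau [Ht Hdt]]. destruct (Hd' p Bp) as [tau' [Ht' Hdt']].
  destruct (cov_act_trans cov (H p) tau tau' Xp Ht Ht') as [g Hg]. exists g.
  assert (Hp1 : eqv (H p) (d p) (tau (H p))) by exact (locally_singleton p _ Hdt Ap).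
  assert (Hp2 : eqv (H p) (d' p) (tau' (H p))) by exact (locally_singleton p _ Hdt' Bp).
  apply (cov_trans cov) with (act g (tau (H p))); [apply (cov_act_eqv cov), Hp1|].
  apply (cov_trans cov) with (tau' (H p)); [exact Hg|apply (cov_sym cov), Hp2].
Qed.

(** Where [A] and [B] meet, the two local sections agree at the point, hence nearby. At a point of
    one set only, closedness keeps the other set away from a neighbourhood. *)
Lemma family_glue_agree {U : UniformSpace} (A B : U -> Prop) (H : U -> T) (d1 d2 : U -> D) :
  (forall p, ~ A p -> locally p (fun q => ~ A q)) ->
  (forall p, ~ B p -> locally p (fun q => ~ B q)) ->
  maps_on (fun p => A p \/ B p) H -> family A H d1 -> family B H d2 ->
  (forall p, A p -> B p -> eqv (H p) (d1 p) (d2 p)) ->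
  exists d, family (fun p => A p \/ B p) H d /\
    (forall p, A p -> d p = d1 p) /\ (forall p, ~ A p -> d p = d2 p).
Proof.
  intros CA CB HH H1 H2 Hag.
  set (d := fun p => if excluded_middle_informative (A p) then d1 p else d2 p).
  assert (E1 : forall p, A p -> d p = d1 p) by (intros p Ap; unfold d; destruct excluded_middle_informative; tauto).
  assert (E2 : forall p, ~ A p -> d p = d2 p) by (intros p Ap; unfold d; destruct excluded_middle_informative; tauto).
  exists d. split; [|auto]. intros p [Ap|Bp].
  - destruct (H1 p Ap) as [tau [Ht Hdt]]. exists tau. split; [exact Ht|].
    destruct (classic (B p)) as [Bp|Bp].
    + destruct (H2 p Bp) as [tau' [Ht' Hdt']].
      assert (Hc := proj2 (HH p (or_introl Ap)) _ (cov_eqv cov _ _ _ Ht Ht')). unfold filtermap in Hc.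
      assert (Hpp : eqv (H p) (tau (H p)) (tau' (H p))).
      { apply (cov_trans cov) with (d1 p).
        - apply (cov_sym cov). exact (locally_singleton p _ Hdt Ap).
        - apply (cov_trans cov) with (d2 p); [apply Hag; assumption|].
          exact (locally_singleton p _ Hdt' Bp). }
      unfold within in *. generalize (filter_and _ _ (filter_and _ _ Hdt Hdt') Hc).
      apply filter_imp. intros q [[F1 F2] F3] AB.
      destruct (classic (A q)) as [Aq|Aq]; [rewrite E1 by exact Aq; apply F1, Aq|].
      rewrite E2 by exact Aq. destruct AB as [AB|AB]; [contradiction|].
      apply (cov_trans cov) with (tau' (H q)); [apply F2, AB|].
      apply (cov_sym cov). apply F3; auto.
    + unfold within in *. generalize (filter_and _ _ Hdt (CB p Bp)). apply filter_imp.
      intros q [F1 F2] AB. destruct AB as [Aq|Bq]; [|contradiction]. rewrite E1 by exact Aq. apply F1, Aq.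
  - destruct (classic (A p)) as [Ap|Ap].
    + destruct (H1 p Ap) as [tau [Ht Hdt]]. destruct (H2 p Bp) as [tau' [Ht' Hdt']].
      exists tau'. split; [exact Ht'|].
      assert (Hc := proj2 (HH p (or_introl Ap)) _ (cov_eqv cov _ _ _ Ht Ht')). unfold filtermap in Hc.
      assert (Hpp : eqv (H p) (tau (H p)) (tau' (H p))).
      { apply (cov_trans cov) with (d1 p).
        - apply (cov_sym cov). exact (locally_singleton p _ Hdt Ap).
        - apply (cov_trans cov) with (d2 p); [apply Hag; assumption|].
          exact (locally_singleton p _ Hdt' Bp). }
      unfold within in *. generalize (filter_and _ _ (filter_and _ _ Hdt Hdt') Hc).
      apply filter_imp. intros q [[F1 F2] F3] AB.
      destruct (classic (A q)) as [Aq|Aq].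
      * rewrite E1 by exact Aq. apply (cov_trans cov) with (tau (H q)); [apply F1, Aq|].
        apply F3; auto.
      * rewrite E2 by exact Aq. destruct AB as [AB|AB]; [contradiction|]. apply F2, AB.
    + destruct (H2 p Bp) as [tau [Ht Hdt]]. exists tau. split; [exact Ht|].
      unfold within in *. generalize (filter_and _ _ Hdt (CA p Ap)). apply filter_imp.
      intros q [F1 F2] AB. rewrite E2 by exact F2. destruct AB as [Aq|Bq]; [contradiction|]. apply F1, Bq.
Qed.

(** The lift over [A] is moved by a deck transformation so as to agree with the other at [p0];
    uniqueness along paths in the overlap spreads the agreement. *)
Lemma family_glue {U : UniformSpace} (A B : U -> Prop) (H : U -> T) (d1 d2 : U -> D) (p0 : U) :
  (forall p, ~ A p -> locally p (fun q => ~ A q)) ->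
  (forall p, ~ B p -> locally p (fun q => ~ B q)) ->
  A p0 -> B p0 ->
  (forall p, A p -> B p -> exists l : R -> U, (forall r, I01 r -> A (l r) /\ B (l r)) /\
     (forall r, filterlim l (locally r) (locally (l r))) /\ l 0%R = p0 /\ l 1%R = p) ->
  maps_on (fun p => A p \/ B p) H -> family A H d1 -> family B H d2 ->
  exists d, family (fun p => A p \/ B p) H d.
Proof.
  intros CA CB Ap0 Bp0 Hconn HH H1 H2.
  destruct (family_transitive A B H d1 d2 p0 Ap0 Bp0 (proj1 (HH p0 (or_introl Ap0))) H1 H2) as [g Hg].
  destruct (family_glue_agree A B H (fun p => act g (d1 p)) d2 CA CB HH) as [d [Hd _]];
    [apply family_act, H1|exact H2| |exists d; exact Hd].
  intros p Ap Bp. destruct (Hconn p Ap Bp) as [l [L1 [L2 [L3 L4]]]].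
  assert (Lc : forall r, I01 r -> filterlim l (within I01 (locally r)) (locally (l r)))
    by (intros r _; apply filterlim_within; [typeclasses eauto|apply L2]).
  rewrite <- L4.
  apply (family_unique (fun r => H (l r)) (fun r => act g (d1 (l r))) (fun r => d2 (l r)) 0%R).
  - unfold I01. lra.
  - apply (maps_on_comp I01 (fun p => A p \/ B p)); [intros r Hr; left; apply L1, Hr|exact Lc|exact HH].
  - apply (family_comp I01 A l H (fun p => act g (d1 p))); [intros r Hr; apply L1, Hr|exact Lc|].
    apply family_act, H1.
  - apply (family_comp I01 B l H d2); [intros r Hr; apply L1, Hr|exact Lc|exact H2].
  - rewrite L3. exact Hg.
  - unfold I01. lra.
Qed.

Lemma family_local {U : UniformSpace} (A : U -> Prop) (H : U -> T) (p : U) : maps_on A H -> A p ->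
  exists (eps : posreal) (d : U -> D), family (fun q => A q /\ ball p eps q) H d.
Proof.
  intros HH Ap. destruct (HH p Ap) as [Xp Hc].
  destruct (cov_exists cov (H p) Xp) as [tau Ht].
  destruct (Hc _ (cov_open cov _ _ Ht)) as [eps He].
  exists eps, (fun q => tau (H q)). intros q [Aq Bq]. exists tau.
  split; [apply He; assumption|].
  destruct (HH q Aq) as [_ Hcq].
  assert (K := Hcq _ (cov_open cov _ _ (He q Bq Aq))).
  unfold filtermap, within in *. revert K. apply filter_imp. intros x Hx [Ax _].
  apply (cov_refl cov). apply Hx, Ax.
Qed.

Definition rectangle (a b c e : R) (q : R * R) : Prop :=
  (a <= fst q <= b)%R /\ (c <= snd q <= e)%R.

Lemma rectangle_closed (a b c e : R) (p : R * R) :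
  ~ rectangle a b c e p -> locally p (fun q => ~ rectangle a b c e q).
Proof.
  intros Hn. destruct p as [s r].
  assert (K : exists eps, (0 < eps)%R /\ forall s' r', (Rabs (s' - s) < eps)%R -> (Rabs (r' - r) < eps)%R ->
    ~ rectangle a b c e (s', r')).
  { unfold rectangle in *. simpl in *.
    destruct (Rlt_le_dec s a); [exists (a - s)%R; split; [lra|]; intros s' r' H1 _ H2; apply Rabs_def2 in H1; lra|].
    destruct (Rlt_le_dec b s); [exists (s - b)%R; split; [lra|]; intros s' r' H1 _ H2; apply Rabs_def2 in H1; lra|].
    destruct (Rlt_le_dec r c); [exists (c - r)%R; split; [lra|]; intros s' r' _ H1 H2; apply Rabs_def2 in H1; lra|].
    exists (r - e)%R. split; [lra|]. intros s' r' _ H1 H2. apply Rabs_def2 in H1. lra. }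
  destruct K as [eps [He K]]. exists (mkposreal eps He). intros [s' r'] [B1 B2]. apply K; assumption.
Qed.

(** Pairs of reals are complex numbers with the same neighbourhoods, so the limit rules of the plane
    apply. *)
Lemma filterlim_affine_pair (x y dx dy r : R) :
  filterlim (fun r => ((x + r * dx)%R, (y + r * dy)%R)) (locally r)
    (locally (((x + r * dx)%R, (y + r * dy)%R) : R * R)).
Proof.
  assert (E : forall r, ((x + r * dx)%R, (y + r * dy)%R) = (x, y) + RtoC r * (dx, dy)).
  { intros r'. unfold Cplus, Cmult. simpl. f_equal; ring. }
  rewrite E. apply (clim_ext (fun r => (x, y) + RtoC r * (dx, dy))).
  - apply filter_forall. intros r'. symmetry. apply E.
  - apply clim_plus; [apply clim_const|]. apply clim_mult; [apply clim_RtoC|apply clim_const].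
Qed.

(** Two rectangles meet in a convex set, so the paths that [family_glue] asks for are segments. *)
Lemma rectangle_glue (a b c e a' b' c' e' : R) (H : R * R -> T) (d1 d2 : R * R -> D) (p0 : R * R) :
  rectangle a b c e p0 -> rectangle a' b' c' e' p0 ->
  maps_on (fun p => rectangle a b c e p \/ rectangle a' b' c' e' p) H ->
  family (rectangle a b c e) H d1 -> family (rectangle a' b' c' e') H d2 ->
  exists d, family (fun p => rectangle a b c e p \/ rectangle a' b' c' e' p) H d.
Proof.
  intros P1 P2 HH H1 H2.
  apply (family_glue _ _ H d1 d2 p0 (rectangle_closed a b c e) (rectangle_closed a' b' c' e') P1 P2); auto.
  intros [s r] Q1 Q2. destruct p0 as [s0 r0]. unfold rectangle in *. simpl in *.
  exists (fun u => (s0 + u * (s - s0), r0 + u * (r - r0))%R). split; [|split; [|split]].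
  - unfold I01. intros u Hu. simpl. repeat split; nra.
  - intros u. apply filterlim_affine_pair.
  - simpl. f_equal; ring.
  - simpl. f_equal; ring.
Qed.

Lemma rectangle_cover (H : R * R -> T) (A : R * R -> Prop) (a b c e a' b' c' e' : R) (p0 : R * R) :
  maps_on square01 H -> (forall p, A p -> rectangle a b c e p \/ rectangle a' b' c' e' p) ->
  (forall p, rectangle a b c e p -> square01 p) -> (forall p, rectangle a' b' c' e' p -> square01 p) ->
  rectangle a b c e p0 -> rectangle a' b' c' e' p0 ->
  (exists d, family (rectangle a b c e) H d) -> (exists d, family (rectangle a' b' c' e') H d) ->
  exists d, family A H d.
Proof.
  intros HH HA I1 I2 P1 P2 [d1 H1] [d2 H2].
  destruct (rectangle_glue a b c e a' b' c' e' H d1 d2 p0 P1 P2) as [d Hd]; auto.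
  - revert HH. apply maps_on_sub. intros p [Hp|Hp]; auto.
  - exists d. revert Hd. apply family_sub, HA.
Qed.

(** Interval induction on the second coordinate: lifts over small squares centred on the column [s]
    are glued upwards, each time with the smaller of the two widths. *)
Lemma family_strip (H : R * R -> T) (s : R) : maps_on square01 H -> I01 s ->
  exists delta, (0 < delta)%R /\ exists d,
    family (rectangle (Rmax 0 (s - delta)) (Rmin 1 (s + delta)) 0 1) H d.
Proof.
  intros HH Hs. unfold I01 in Hs.
  assert (M : forall de, (0 < de)%R -> (0 <= Rmax 0 (s - de) <= s /\ s <= Rmin 1 (s + de) <= 1)%R).
  { intros de Hde. generalize (Rmax_l 0 (s - de)) (Rmin_l 1 (s + de)).
    assert (Rmax 0 (s - de) <= s)%R by (apply Rmax_lub; lra).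
    assert (s <= Rmin 1 (s + de))%R by (apply Rmin_glb; lra). lra. }
  assert (Mono : forall de de' q, (de <= de')%R -> forall u v,
     rectangle (Rmax 0 (s - de)) (Rmin 1 (s + de)) u v q -> rectangle (Rmax 0 (s - de')) (Rmin 1 (s + de')) u v q).
  { intros de de' q Hde u v [Q1 Q2]. split; [|exact Q2].
    assert (Rmax 0 (s - de') <= Rmax 0 (s - de))%R by (apply Rle_max_compat_l; lra).
    assert (Rmin 1 (s + de) <= Rmin 1 (s + de'))%R by (apply Rle_min_compat_l; lra). lra. }
  apply (interval_induction (fun u v => exists delta, (0 < delta)%R /\ exists d,
    family (rectangle (Rmax 0 (s - delta)) (Rmin 1 (s + delta)) u v) H d)); [lra| |].
  - intros u v w Huv Hvw [e1 [He1 [d1 H1]]] [e2 [He2 [d2 H2]]].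
    exists (Rmin e1 e2). assert (He : (0 < Rmin e1 e2)%R) by (apply Rmin_glb_lt; assumption).
    split; [exact He|]. specialize (M _ He).
    set (a := Rmax 0 (s - Rmin e1 e2)) in *. set (b := Rmin 1 (s + Rmin e1 e2)) in *.
    apply (rectangle_cover H _ a b u v a b v w (s, v)); auto.
    + intros p [Q1 Q2]. destruct (Rle_lt_dec (snd p) v); [left|right]; split; auto; lra.
    + intros p [Q1 Q2]. split; unfold I01; lra.
    + intros p [Q1 Q2]. split; unfold I01; lra.
    + split; simpl; lra.
    + split; simpl; lra.
    + exists d1. revert H1. apply family_sub. intros q. apply Mono, Rmin_l.
    + exists d2. revert H2. apply family_sub. intros q. apply Mono, Rmin_r.
  - intros r Hr. destruct (family_local square01 H (s, r) HH) as [eps [d Hd]]; [split; unfold I01; simpl; lra|].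
    assert (Hp := cond_pos eps). exists eps. split; [exact Hp|]. intros u v Hu Hv H1 H2.
    exists (eps / 2)%R. split; [lra|]. exists d. revert Hd. apply family_sub. intros [s' r'] [Q1 Q2]. simpl in *.
    specialize (M (eps / 2)%R ltac:(lra)).
    assert (E1 := Rmax_r 0 (s - eps / 2)). assert (E2 := Rmin_r 1 (s + eps / 2)). split.
    + split; unfold I01; simpl; lra.
    + split; apply Rabs_def1; unfold minus, plus, opp; simpl; lra.
Qed.

(** A second interval induction, on the first coordinate, glues the vertical strips. *)
Theorem family_square (H : R * R -> T) : maps_on square01 H -> exists d, family square01 H d.
Proof.
  intros HH.
  assert (K : exists d, family (rectangle 0 1 0 1) H d).
  { apply (interval_induction (fun u v => exists d, family (rectangle u v 0 1) H d)); [lra| |].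
    - intros u v w Huv Hvw D1 D2.
      apply (rectangle_cover H _ u v 0 1 v w 0 1 (v, 0%R)); auto.
      + intros p [Q1 Q2]. destruct (Rle_lt_dec (fst p) v); [left|right]; split; auto; lra.
      + intros p [Q1 Q2]. split; unfold I01; lra.
      + intros p [Q1 Q2]. split; unfold I01; lra.
      + split; simpl; lra.
      + split; simpl; lra.
    - intros s Hs. destruct (family_strip H s HH Hs) as [delta [Hd [d K]]].
      exists delta. split; [exact Hd|]. intros u v Hu Hv H1 H2. exists d. revert K. apply family_sub.
      intros q [Q1 Q2]. split; [|exact Q2].
      assert (Rmax 0 (s - delta) <= u)%R by (apply Rmax_lub; lra).
      assert (v <= Rmin 1 (s + delta))%R by (apply Rmin_glb; lra). lra. }
  exact K.
Qed.

(** A path is treated as a square that does not depend on its first coordinate. *)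
Lemma family_path (c : R -> T) : maps_on I01 c -> exists d, family I01 c d.
Proof.
  intros Hc. destruct (family_square (fun q => c (snd q))) as [d Hd].
  - apply (maps_on_comp square01 I01 snd c); [intros p Hp; apply Hp| |exact Hc].
    intros [s r] _. apply filterlim_within; [typeclasses eauto|]. apply continuous_snd.
  - exists (fun r => d (0%R, r)).
    apply (family_comp I01 square01 (fun r => (0%R, r)) (fun q => c (snd q)) d); [| |exact Hd].
    + intros r Hr. split; unfold I01 in *; simpl; lra.
    + intros r _. apply filterlim_within; [typeclasses eauto|].
      apply (filterlim_ext (fun r => (0 + r * 0, 0 + r * 1)%R)); [intros; apply injective_projections; simpl; ring|].
      replace ((0, r)%R : R * R) with ((0 + r * 0, 0 + r * 1)%R) by (apply injective_projections; simpl; ring).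
      apply filterlim_affine_pair.
Qed.

Lemma family_ext {U : UniformSpace} (A : U -> Prop) (H H' : U -> T) (d d' : U -> D) :
  (forall p, A p -> H p = H' p) -> (forall p, A p -> eqv (H p) (d p) (d' p)) ->
  family A H d -> family A H' d'.
Proof.
  intros E1 E2 Hd p Ap. destruct (Hd p Ap) as [tau [Ht Hdt]]. exists tau.
  rewrite <- E1 by exact Ap. split; [exact Ht|].
  unfold within in *. revert Hdt. apply filter_imp. intros q Hq Aq. rewrite <- E1 by exact Aq.
  apply (cov_trans cov) with (d q); [apply (cov_sym cov), E2, Aq|apply Hq, Aq].
Qed.

Lemma family_refl {U : UniformSpace} (A : U -> Prop) (H : U -> T) (d : U -> D) (p : U) :
  family A H d -> A p -> eqv (H p) (d p) (d p).
Proof.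
  intros Hd Ap. destruct (Hd p Ap) as [tau [_ Hdt]].
  assert (E : eqv (H p) (d p) (tau (H p))) by exact (locally_singleton p _ Hdt Ap).
  apply (cov_trans cov) with (tau (H p)); [exact E|apply (cov_sym cov), E].
Qed.

Lemma maps_on_ext {U : UniformSpace} (A : U -> Prop) (H H' : U -> T) :
  (forall p, A p -> H p = H' p) -> maps_on A H -> maps_on A H'.
Proof.
  intros E HH p Ap. rewrite <- E by exact Ap. destruct (HH p Ap) as [H1 H2]. split; [exact H1|].
  apply (filterlim_within_ext A H); [exact E|exact H2].
Qed.

Lemma maps_on_union {U : UniformSpace} (A B : U -> Prop) (H : U -> T) :
  (forall p, ~ A p -> locally p (fun q => ~ A q)) ->
  (forall p, ~ B p -> locally p (fun q => ~ B q)) ->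
  maps_on A H -> maps_on B H -> maps_on (fun p => A p \/ B p) H.
Proof.
  intros CA CB HA HB p Hp.
  assert (K : forall (D' : U -> Prop), (forall q, ~ D' q -> locally q (fun q => ~ D' q)) -> maps_on D' H ->
     forall P, N (H p) P -> locally p (fun q => D' q -> P (H q))).
  { intros D' CD HD P HP. destruct (classic (D' p)) as [Dp|Dp].
    - apply (proj2 (HD p Dp) P HP).
    - generalize (CD p Dp). apply filter_imp. intros q Hq Dq. contradiction. }
  split; [destruct Hp as [Ap|Bp]; [apply HA, Ap|apply HB, Bp]|].
  intros P HP. unfold filtermap, within.
  generalize (filter_and _ _ (K A CA HA P HP) (K B CB HB P HP)). apply filter_imp.
  intros q [K1 K2] [Aq|Bq]; auto.
Qed.

Lemma family_union {U : UniformSpace} (A B : U -> Prop) (H : U -> T) (d : U -> D) :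
  (forall p, ~ A p -> locally p (fun q => ~ A q)) ->
  (forall p, ~ B p -> locally p (fun q => ~ B q)) ->
  maps_on (fun p => A p \/ B p) H -> family A H d -> family B H d ->
  family (fun p => A p \/ B p) H d.
Proof.
  intros CA CB HH HA HB.
  destruct (family_glue_agree A B H d d CA CB HH HA HB) as [d' [Hd' [E1 E2]]].
  - intros p Ap _. apply (family_refl A H d p HA Ap).
  - revert Hd'. apply family_ext; [reflexivity|]. intros p AB.
    assert (E : d' p = d p) by (destruct (classic (A p)); auto). rewrite E.
    destruct AB as [Ap|Bp]; [apply (family_refl A H d p HA Ap)|apply (family_refl B H d p HB Bp)].
Qed.

Lemma closed_interval_closed (a b p : R) :
  ~ (a <= p <= b)%R -> locally p (fun q => ~ (a <= q <= b)%R).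
Proof.
  intros Hn. destruct (Rlt_le_dec p a) as [H|H].
  - assert (Ha : (0 < a - p)%R) by lra. exists (mkposreal _ Ha). intros q Hq Hab. apply Rabs_def2 in Hq.
    unfold minus, plus, opp in Hq; simpl in Hq. lra.
  - assert (Hb : (0 < p - b)%R) by lra. exists (mkposreal _ Hb). intros q Hq Hab. apply Rabs_def2 in Hq.
    unfold minus, plus, opp in Hq; simpl in Hq. lra.
Qed.

Lemma filterlim_affine (A : R -> Prop) (m q r : R) :
  filterlim (fun r => (m * r + q)%R) (within A (locally r)) (locally (m * r + q)%R).
Proof.
  apply filterlim_within; [typeclasses eauto|].
  apply (ex_derive_continuous (V := R_NormedModule) (fun r => (m * r + q)%R)). auto_derive. auto.
Qed.

Lemma concat_left {S : Type} (g h : R -> S) (r : R) : (0 <= r <= 1 / 2)%R -> concat g h r = g (2 * r + 0)%R.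
Proof. intros Hr. unfold concat. destruct Rle_dec; [f_equal; ring|lra]. Qed.

Lemma concat_right {S : Type} (g h : R -> S) (r : R) : (1 / 2 < r)%R -> concat g h r = h (2 * r + -1)%R.
Proof. intros Hr. unfold concat. destruct Rle_dec; [lra|f_equal; ring]. Qed.

Lemma concat_half {S : Type} (g h : R -> S) (r : R) : r = (1 / 2)%R -> concat g h r = g 1%R.
Proof. intros ->. rewrite concat_left by lra. f_equal. field. Qed.

Lemma maps_on_concat (g h : R -> T) : maps_on I01 g -> maps_on I01 h -> g 1%R = h 0%R ->
  maps_on I01 (concat g h).
Proof.
  intros Hg Hh E. apply (maps_on_sub I01 (fun r => (0 <= r <= 1 / 2)%R \/ (1 / 2 <= r <= 1)%R)).
  { unfold I01. intros r. lra. }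
  apply maps_on_union; [apply closed_interval_closed|apply closed_interval_closed| |].
  - apply (maps_on_ext _ (fun r => g (2 * r + 0)%R)); [intros r Hr; symmetry; apply concat_left, Hr|].
    apply (maps_on_comp _ I01 (fun r => 2 * r + 0)%R); [unfold I01; intros; lra| |exact Hg].
    intros r _. apply filterlim_affine.
  - apply (maps_on_ext _ (fun r => h (2 * r + -1)%R)).
    + intros r Hr. destruct (Req_dec r (1 / 2)) as [Er|Er].
      * rewrite concat_half, E by exact Er. f_equal. lra.
      * symmetry. apply concat_right. lra.
    + apply (maps_on_comp _ I01 (fun r => 2 * r + -1)%R); [unfold I01; intros; lra| |exact Hh].
      intros r _. apply filterlim_affine.
Qed.

Lemma family_concat (g h : R -> T) (d d' : R -> D) : maps_on I01 g -> maps_on I01 h -> g 1%R = h 0%R ->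
  family I01 g d -> family I01 h d' -> eqv (g 1%R) (d 1%R) (d' 0%R) ->
  family I01 (concat g h) (concat d d').
Proof.
  intros Hg Hh E Hd Hd' Ed.
  apply (family_sub I01 (fun r => (0 <= r <= 1 / 2)%R \/ (1 / 2 <= r <= 1)%R)).
  { unfold I01. intros r. lra. }
  apply family_union; [apply closed_interval_closed|apply closed_interval_closed| | |].
  - apply (maps_on_sub _ I01); [unfold I01; intros r; lra|]. apply maps_on_concat; assumption.
  - apply (family_ext _ (fun r => g (2 * r + 0)%R) _ (fun r => d (2 * r + 0)%R)).
    + intros r Hr. symmetry. apply concat_left, Hr.
    + intros r Hr. rewrite concat_left by exact Hr. apply (family_refl I01 g d); [exact Hd|unfold I01; lra].
    + apply (family_comp _ I01 (fun r => 2 * r + 0)%R); [unfold I01; intros; lra| |exact Hd].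
      intros r _. apply filterlim_affine.
  - apply (family_ext _ (fun r => h (2 * r + -1)%R) _ (fun r => d' (2 * r + -1)%R)).
    + intros r Hr. destruct (Req_dec r (1 / 2)) as [Er|Er].
      * rewrite concat_half, E by exact Er. f_equal. lra.
      * symmetry. apply concat_right. lra.
    (* At the junction [concat] takes the end value of [d], which is only equivalent to the initial
       value of [d']. *)
    + intros r Hr. destruct (Req_dec r (1 / 2)) as [Er|Er].
      * rewrite (concat_half d) by exact Er. replace (2 * r + -1)%R with 0%R by lra.
        rewrite <- E. apply (cov_sym cov), Ed.
      * rewrite (concat_right d) by lra. apply (family_refl I01 h d'); [exact Hd'|unfold I01; lra].
    + apply (family_comp _ I01 (fun r => 2 * r + -1)%R); [unfold I01; intros; lra| |exact Hd'].
      intros r _. apply filterlim_affine.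
Qed.

Lemma maps_on_reverse (g : R -> T) : maps_on I01 g -> maps_on I01 (reverse g).
Proof.
  intros Hg. apply (maps_on_ext _ (fun r => g (-1 * r + 1)%R)); [intros r _; unfold reverse; f_equal; ring|].
  apply (maps_on_comp _ I01 (fun r => -1 * r + 1)%R); [unfold I01; intros; lra| |exact Hg].
  intros r _. apply filterlim_affine.
Qed.

Lemma family_reverse (g : R -> T) (d : R -> D) : family I01 g d -> family I01 (reverse g) (reverse d).
Proof.
  intros Hd. assert (E : forall r, (-1 * r + 1 = 1 - r)%R) by (intros; ring).
  apply (family_ext _ (fun r => g (-1 * r + 1)%R) _ (fun r => d (-1 * r + 1)%R)).
  - intros r _. rewrite E. reflexivity.
  - intros r Hr. unfold reverse. rewrite E. apply (family_refl I01 g d); [exact Hd|unfold I01 in *; lra].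
  - apply (family_comp _ I01 (fun r => -1 * r + 1)%R); [unfold I01; intros; lra| |exact Hd].
    intros r _. apply filterlim_affine.
Qed.

Lemma family_const (g : R -> T) (d : R -> D) (r0 : R) : I01 r0 ->
  family I01 g d -> family I01 (fun _ => g r0) (fun _ => d r0).
Proof.
  intros H0 Hd r _. destruct (Hd r0 H0) as [tau [Ht Hdt]]. exists tau. split; [exact Ht|].
  assert (E : eqv (g r0) (d r0) (tau (g r0))) by exact (locally_singleton r0 _ Hdt H0).
  apply filter_forall. intros _. exact E.
Qed.

Lemma filterlim_row (A : R -> Prop) (s r : R) :
  filterlim (fun r => (s, r)) (within A (locally r)) (locally ((s, r) : R * R)).
Proof.
  apply filterlim_within; [typeclasses eauto|].
  apply (filterlim_ext (fun r => (s + r * 0, 0 + r * 1)%R)); [intros; apply injective_projections; simpl; ring|].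
  replace ((s, r) : R * R) with ((s + r * 0)%R, (0 + r * 1)%R) by (apply injective_projections; simpl; ring).
  apply filterlim_affine_pair.
Qed.

Lemma filterlim_column (A : R -> Prop) (r s : R) :
  filterlim (fun s => (s, r)) (within A (locally s)) (locally ((s, r) : R * R)).
Proof.
  apply filterlim_within; [typeclasses eauto|].
  apply (filterlim_ext (fun s => (0 + s * 1, r + s * 0)%R)); [intros; apply injective_projections; simpl; ring|].
  replace ((s, r) : R * R) with ((0 + s * 1)%R, (r + s * 0)%R) by (apply injective_projections; simpl; ring).
  apply filterlim_affine_pair.
Qed.

Lemma family_row (H : R * R -> T) (d : R * R -> D) (s : R) : I01 s ->
  family square01 H d -> family I01 (fun r => H (s, r)) (fun r => d (s, r)).
Proof.
  intros Hs. apply (family_comp I01 square01 (fun r => (s, r))).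
  - intros r Hr. split; assumption.
  - intros r _. apply filterlim_row.
Qed.

Lemma family_column (H : R * R -> T) (d : R * R -> D) (r : R) : I01 r ->
  family square01 H d -> family I01 (fun s => H (s, r)) (fun s => d (s, r)).
Proof.
  intros Hr. apply (family_comp I01 square01 (fun s => (s, r))).
  - intros s Hs. split; assumption.
  - intros s _. apply filterlim_column.
Qed.

Lemma maps_on_row (H : R * R -> T) (s : R) : I01 s ->
  maps_on square01 H -> maps_on I01 (fun r => H (s, r)).
Proof.
  intros Hs. apply (maps_on_comp I01 square01 (fun r => (s, r))).
  - intros r Hr. split; assumption.
  - intros r _. apply filterlim_row.
Qed.

Lemma maps_on_column (H : R * R -> T) (r : R) : I01 r ->
  maps_on square01 H -> maps_on I01 (fun s => H (s, r)).
Proof.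
  intros Hr. apply (maps_on_comp I01 square01 (fun s => (s, r))).
  - intros s Hs. split; assumption.
  - intros s _. apply filterlim_column.
Qed.

Lemma I01_0 : I01 0.
Proof. unfold I01. lra. Qed.
Lemma I01_1 : I01 1.
Proof. unfold I01. lra. Qed.

(** Any lift of the square restricts to a lift of the edge [s = 0]; one deck transformation makes it
    agree with the prescribed lift. *)
Lemma family_square_from (H : R * R -> T) (d : R -> D) : maps_on square01 H ->
  family I01 (fun r => H (0%R, r)) d ->
  exists D', family square01 H D' /\ forall r, I01 r -> eqv (H (0%R, r)) (D' (0%R, r)) (d r).
Proof.
  intros HH Hd. destruct (family_square H HH) as [D' HD].
  assert (HR := family_row H D' 0 I01_0 HD).
  destruct (family_transitive I01 I01 (fun r => H (0%R, r)) (fun r => D' (0%R, r)) d 0%R I01_0 I01_0) as [g Hg].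
  - apply HH. split; apply I01_0.
  - exact HR.
  - exact Hd.
  - exists (fun p => act g (D' p)). assert (HD' := family_act _ _ _ g HD). split; [exact HD'|].
    apply (family_unique (fun r => H (0%R, r)) _ d 0%R I01_0); [apply maps_on_row; [apply I01_0|exact HH]| |exact Hd|exact Hg].
    apply (family_row H _ 0 I01_0 HD').
Qed.

(** On the edges [r = 0] and [r = 1] the map is constant, so that constant families are lifts there,
    and uniqueness keeps the end values fixed during the homotopy. *)
Lemma family_homotopy (H : R * R -> T) (d : R -> D) : maps_on square01 H ->
  (forall s, I01 s -> H (s, 0%R) = H (0%R, 0%R)) -> (forall s, I01 s -> H (s, 1%R) = H (0%R, 1%R)) ->
  family I01 (fun r => H (0%R, r)) d ->
  exists D', family square01 H D' /\ (forall r, I01 r -> eqv (H (0%R, r)) (D' (0%R, r)) (d r)) /\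
    (forall s, I01 s -> eqv (H (0%R, 0%R)) (D' (s, 0%R)) (d 0%R)) /\
    (forall s, I01 s -> eqv (H (0%R, 1%R)) (D' (s, 1%R)) (d 1%R)).
Proof.
  intros HH H0 H1 Hd. destruct (family_square_from H d HH Hd) as [D' [HD HDd]].
  exists D'. split; [exact HD|]. split; [exact HDd|].
  assert (K : forall r, I01 r -> (forall s, I01 s -> H (s, r) = H (0%R, r)) ->
    forall s, I01 s -> eqv (H (0%R, r)) (D' (s, r)) (d r)).
  { intros r Hr Hc s Hs.
    assert (E : eqv (H (s, r)) (D' (s, r)) (d r)).
    { apply (family_unique (fun s => H (s, r)) (fun s => D' (s, r)) (fun _ => d r) 0%R I01_0); [| | | |exact Hs].
      - apply maps_on_column; assumption.
      - apply family_column; assumption.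
      - apply (family_ext I01 (fun _ => H (0%R, r)) _ (fun _ => d r)).
        + intros s' Hs'. symmetry. apply Hc, Hs'.
        + intros s' _. apply (family_refl I01 (fun r => H (0%R, r)) d r Hd Hr).
        + apply (family_const (fun r => H (0%R, r)) d r Hr Hd).
      - apply HDd, Hr. }
    rewrite Hc in E by exact Hs. exact E. }
  split; [apply K; [apply I01_0|exact H0]|apply K; [apply I01_1|exact H1]].
Qed.
End Covering.

(** * The topology of the curves *)

Lemma nbhd_scale_mono (a b c d : R) : (a < b * c)%R -> (0 <= c)%R -> (b <= d)%R -> (a < d * c)%R.
Proof. intros. nra. Qed.

Global Instance nbhdE_filter (Q : Ept) : Filter (nbhdE Q).
Proof.
  constructor.
  - exists 1%R. split; [lra|]. destruct Q; auto.
  - intros A B [e1 [H1 HA]] [e2 [H2 HB]].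
    assert (L1 := Rmin_l e1 e2). assert (L2 := Rmin_r e1 e2).
    exists (Rmin e1 e2). split; [apply Rmin_glb_lt; assumption|]. destruct Q as [x0 y0|].
    + intros x y Hx Hy. split; [apply HA|apply HB]; lra.
    + destruct HA as [A1 A2]. destruct HB as [B1 B2]. split; [auto|]. intros x y Hx Hy.
      assert (H0 := Cmod_ge_0 y).
      split; [apply A2|apply B2]; eapply nbhd_scale_mono; eauto.
  - intros A B HAB [e [He HA]]. exists e. split; [exact He|]. destruct Q; [auto|].
    destruct HA as [A1 A2]. auto.
Qed.

Global Instance nbhdC_filter (P : Cpt) : Filter (nbhdC P).
Proof.
  constructor.
  - exists 1%R. split; [lra|]. destruct P; auto.
  - intros A B [e1 [H1 HA]] [e2 [H2 HB]].
    assert (L1 := Rmin_l e1 e2). assert (L2 := Rmin_r e1 e2).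
    exists (Rmin e1 e2). split; [apply Rmin_glb_lt; assumption|]. destruct P as [x0 y0|b].
    + intros x y Hx Hy. split; [apply HA|apply HB]; lra.
    + destruct HA as [A1 A2]. destruct HB as [B1 B2]. split; [auto|]. intros x y Hx Hy.
      assert (H0 := Cmod_ge_0 x).
      split; [apply A2|apply B2]; (eapply nbhd_scale_mono; eauto) || lra.
  - intros A B HAB [e [He HA]]. exists e. split; [exact He|]. destruct P; [auto|].
    destruct HA as [A1 A2]. auto.
Qed.

Lemma Cminus_self (x : C) : x - x = 0.
Proof. ring. Qed.

Lemma nbhdE_self (Q : Ept) (A : Ept -> Prop) : nbhdE Q A -> A Q.
Proof.
  intros [e [He H]]. destruct Q as [x y|]; [|apply H].
  apply H; rewrite Cminus_self, Cmod_0; exact He.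
Qed.

Lemma nbhdC_self (P : Cpt) (A : Cpt -> Prop) : nbhdC P A -> A P.
Proof.
  intros [e [He H]]. destruct P as [x y|]; [|apply H].
  apply H; rewrite Cminus_self, Cmod_0; exact He.
Qed.

Definition x_coordE (Q : Ept) : C := match Q with Eaff x _ => x | Einf => 0 end.
Definition y_coordE (Q : Ept) : C := match Q with Eaff _ y => y | Einf => 0 end.
Definition y_coordC (P : Cpt) : C := match P with Caff _ y => y | Cinf _ => 0 end.
Definition slope_coord (P : Cpt) : C :=
  match P with Caff xi y => y / xi ^ 3 | Cinf b => slope_at_infinity b end.

Lemma slope_neq_0 (b : bool) : slope_at_infinity b <> 0.
Proof.
  assert (Ci <> 0) by (intros E; injection E; lra).
  destruct b; simpl; [assumption|]. intros E. apply H.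
  replace Ci with (- - Ci) by ring. rewrite E. ring.
Qed.

Lemma slope_sqr (b : bool) : slope_at_infinity b ^ 2 = - (1).
Proof.
  assert (Ci * Ci = - (1)) by (unfold Ci, Cmult, Copp; simpl; f_equal; ring).
  destruct b; simpl; [rewrite <- H|rewrite <- H]; ring.
Qed.

Lemma slope_negb (b : bool) : slope_at_infinity (negb b) = - slope_at_infinity b.
Proof. destruct b; simpl; ring. Qed.

Section Coordinates.
Context {T : Type} {F : (T -> Prop) -> Prop} {FF : Filter F}.

Lemma lim_Eaff (x y : T -> C) (x0 y0 : C) :
  filterlim x F (nbhd_plane x0) -> filterlim y F (nbhd_plane y0) ->
  filterlim (fun p => Eaff (x p) (y p)) F (nbhdE (Eaff x0 y0)).
Proof.
  intros Hx Hy A [e [He HA]]. unfold filtermap.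
  generalize (filter_and _ _ (proj1 (climP F x x0) Hx e He) (proj1 (climP F y y0) Hy e He)).
  apply filter_imp. intros p [H1 H2]. apply HA; assumption.
Qed.

Lemma lim_Caff (x y : T -> C) (x0 y0 : C) :
  filterlim x F (nbhd_plane x0) -> filterlim y F (nbhd_plane y0) ->
  filterlim (fun p => Caff (x p) (y p)) F (nbhdC (Caff x0 y0)).
Proof.
  intros Hx Hy A [e [He HA]]. unfold filtermap.
  generalize (filter_and _ _ (proj1 (climP F x x0) Hx e He) (proj1 (climP F y y0) Hy e He)).
  apply filter_imp. intros p [H1 H2]. apply HA; assumption.
Qed.

Lemma inv_small (z : C) (e : R) : (0 < e)%R -> z <> 0 -> (Cmod (/ z - 0) < e)%R ->
  (1 < e * Cmod z)%R.
Proof.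
  intros He Hz H. replace (/ z - 0) with (/ z) in H by ring. rewrite Cmod_inv in H by exact Hz.
  apply Cmod_gt_0 in Hz. apply Rmult_lt_compat_r with (r := Cmod z) in H; [|exact Hz].
  rewrite Rinv_l in H by lra. exact H.
Qed.

(** Convergence to infinity is tested on functions [a] and [b] that extend [1 / y] and [x / y], the
    two quantities that [nbhdE] makes small. *)
Lemma lim_Einf (g : T -> Ept) (a b : T -> C) :
  filterlim a F (nbhd_plane 0) -> filterlim b F (nbhd_plane 0) ->
  F (fun p => g p = Einf \/ exists x y, g p = Eaff x y /\ y <> 0 /\ a p = / y /\ b p = x / y) ->
  filterlim g F (nbhdE Einf).
Proof.
  intros Ha Hb Hg A [e [He [A1 A2]]]. unfold filtermap.
  generalize (filter_and _ _ Hg (filter_and _ _ (proj1 (climP F a 0) Ha e He) (proj1 (climP F b 0) Hb e He))).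
  apply filter_imp. intros p [[E|(x & y & E & Hy & E1 & E2)] [H1 H2]]; rewrite E; [exact A1|].
  rewrite E1 in H1. rewrite E2 in H2. apply A2.
  - apply inv_small; assumption.
  - replace (x / y - 0) with (x / y) in H2 by ring. rewrite Cmod_div in H2 by exact Hy.
    apply Cmod_gt_0 in Hy. apply Rmult_lt_compat_r with (r := Cmod y) in H2; [|exact Hy].
    unfold Rdiv in H2. rewrite Rmult_assoc, Rinv_l in H2 by lra. lra.
Qed.

Lemma lim_Cinf (g : T -> Cpt) (b : bool) (a e : T -> C) :
  filterlim a F (nbhd_plane 0) -> filterlim e F (nbhd_plane (slope_at_infinity b)) ->
  F (fun p => g p = Cinf b \/ exists xi y, g p = Caff xi y /\ xi <> 0 /\ a p = / xi /\ e p = y / xi ^ 3) ->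
  filterlim g F (nbhdC (Cinf b)).
Proof.
  intros Ha Hb Hg A [d [Hd [A1 A2]]]. unfold filtermap.
  generalize (filter_and _ _ Hg (filter_and _ _ (proj1 (climP F a 0) Ha d Hd) (proj1 (climP F e _) Hb d Hd))).
  apply filter_imp. intros p [[E|(x & y & E & Hx & E1 & E2)] [H1 H2]]; rewrite E; [exact A1|].
  rewrite E1 in H1. rewrite E2 in H2. apply A2; [|exact H2].
  apply inv_small; assumption.
Qed.
End Coordinates.

Lemma x_coordE_lim (x y : C) : filterlim x_coordE (nbhdE (Eaff x y)) (nbhd_plane x).
Proof. apply climP; [typeclasses eauto|]. intros e He. exists e. auto. Qed.

Lemma y_coordE_lim (x y : C) : filterlim y_coordE (nbhdE (Eaff x y)) (nbhd_plane y).
Proof. apply climP; [typeclasses eauto|]. intros e He. exists e. auto. Qed.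

Lemma xi_coord_lim (x y : C) : filterlim xi_coord (nbhdC (Caff x y)) (nbhd_plane x).
Proof. apply climP; [typeclasses eauto|]. intros e He. exists e. auto. Qed.

Lemma y_coordC_lim (x y : C) : filterlim y_coordC (nbhdC (Caff x y)) (nbhd_plane y).
Proof. apply climP; [typeclasses eauto|]. intros e He. exists e. auto. Qed.

Lemma nbhdE_affine (x y : C) : nbhdE (Eaff x y) (fun Q => Q = Eaff (x_coordE Q) (y_coordE Q)).
Proof. exists 1%R. split; [lra|]. reflexivity. Qed.

Lemma nbhdC_affine (x y : C) : nbhdC (Caff x y) (fun Q => Q = Caff (xi_coord Q) (y_coordC Q)).
Proof. exists 1%R. split; [lra|]. reflexivity. Qed.

Lemma large_neq_0 (z : C) (e : R) : (1 < e * Cmod z)%R -> z <> 0.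
Proof. intros H E. rewrite E, Cmod_0 in H. lra. Qed.

Lemma inv_xi_lim (b : bool) : filterlim inv_xi (nbhdC (Cinf b)) (nbhd_plane 0).
Proof.
  apply climP; [typeclasses eauto|]. intros e He. exists e. split; [exact He|]. simpl. split.
  - rewrite Cminus_self, Cmod_0. exact He.
  - intros xi y H _. assert (H0 := large_neq_0 _ _ H).
    replace (/ xi - 0) with (/ xi) by ring. rewrite Cmod_inv by exact H0.
    apply Cmod_gt_0 in H0. apply Rmult_lt_reg_r with (Cmod xi); [exact H0|]. rewrite Rinv_l by lra. exact H.
Qed.

Lemma slope_coord_lim (b : bool) :
  filterlim slope_coord (nbhdC (Cinf b)) (nbhd_plane (slope_at_infinity b)).
Proof.
  apply climP; [typeclasses eauto|]. intros e He. exists e. split; [exact He|]. simpl. split.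
  - rewrite Cminus_self, Cmod_0. exact He.
  - intros xi y _ H. exact H.
Qed.

Lemma nbhdC_inf (b : bool) :
  nbhdC (Cinf b) (fun P => P = Cinf b \/ exists xi y, P = Caff xi y /\ xi <> 0).
Proof.
  exists 1%R. split; [lra|]. split; [auto|]. intros xi y H _. right. exists xi, y.
  split; [reflexivity|]. apply large_neq_0 in H. exact H.
Qed.

Lemma nbhdC_open (P : Cpt) (A : Cpt -> Prop) : nbhdC P A -> nbhdC P (fun P' => nbhdC P' A).
Proof.
  intros HA. destruct P as [x0 y0|b].
  - destruct HA as [e [He HA]]. exists (e / 2)%R. split; [lra|]. intros x y Hx Hy.
    exists (e / 2)%R. split; [lra|]. intros x' y' Hx' Hy'. apply HA.
    + replace (x' - x0) with ((x' - x) + (x - x0)) by ring. eapply Rle_lt_trans; [apply Cmod_triangle|]. lra.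
    + replace (y' - y0) with ((y' - y) + (y - y0)) by ring. eapply Rle_lt_trans; [apply Cmod_triangle|]. lra.
  - generalize HA. intros [e [He [A1 A2]]]. exists e. split; [exact He|]. split; [exact HA|].
    intros xi y Hx Hy. assert (H0 := large_neq_0 _ _ Hx).
    assert (L1 := xi_coord_lim xi y). assert (L2 := y_coordC_lim xi y).
    assert (L3 : filterlim (fun P => y_coordC P / xi_coord P ^ 3) (nbhdC (Caff xi y)) (nbhd_plane (y / xi ^ 3))).
    { apply clim_div; [apply Cpow_nz, H0|exact L2|apply clim_pow, L1]. }
    set (m := Cmod (y / xi ^ 3 - slope_at_infinity b)) in *.
    (* The margins left in the two strict inequalities, [k - 1] and [e - m], measure how far the
       point may move. *)
    set (k := (e * Cmod xi)%R) in *.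
    assert (Hk : (0 < (k - 1) / e)%R) by (apply Rdiv_lt_0_compat; lra).
    generalize (filter_and _ _ (nbhdC_affine xi y)
      (filter_and _ _ (proj1 (climP _ _ _) L1 _ Hk) (proj1 (climP _ _ _) L3 (e - m)%R ltac:(lra)))).
    apply filter_imp. intros P (E & H1 & H2). rewrite E. apply A2.
    + generalize (Cmod_minus_triangle xi (xi_coord P)). rewrite Cmod_minus_sym. intros H3.
      apply Rmult_lt_compat_l with (r := e) in H1; [|exact He].
      replace (e * ((k - 1) / e))%R with (k - 1)%R in H1 by (field; lra). unfold k in H1. nra.
    + replace (y_coordC P / xi_coord P ^ 3 - slope_at_infinity b)
        with ((y_coordC P / xi_coord P ^ 3 - y / xi ^ 3) + (y / xi ^ 3 - slope_at_infinity b)) by ring.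
      eapply Rle_lt_trans; [apply Cmod_triangle|]. fold m. lra.
Qed.

Lemma nbhdE_open (Q : Ept) (A : Ept -> Prop) : nbhdE Q A -> nbhdE Q (fun Q' => nbhdE Q' A).
Proof.
  intros HA. destruct Q as [x0 y0|].
  - destruct HA as [e [He HA]]. exists (e / 2)%R. split; [lra|]. intros x y Hx Hy.
    exists (e / 2)%R. split; [lra|]. intros x' y' Hx' Hy'. apply HA.
    + replace (x' - x0) with ((x' - x) + (x - x0)) by ring. eapply Rle_lt_trans; [apply Cmod_triangle|]. lra.
    + replace (y' - y0) with ((y' - y) + (y - y0)) by ring. eapply Rle_lt_trans; [apply Cmod_triangle|]. lra.
  - generalize HA. intros [e [He [A1 A2]]]. exists e. split; [exact He|]. split; [exact HA|].
    intros x y Hy Hx.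
    set (k := (e * Cmod y)%R) in *.
    set (d := Rmin ((k - 1) / e) ((k - Cmod x) / (1 + e))).
    assert (Hd : (0 < d)%R) by (apply Rmin_glb_lt; apply Rdiv_lt_0_compat; lra).
    assert (D1 := Rmin_l ((k - 1) / e) ((k - Cmod x) / (1 + e))).
    assert (D2 := Rmin_r ((k - 1) / e) ((k - Cmod x) / (1 + e))). fold d in D1, D2.
    assert (D3 : (e * d <= k - 1)%R).
    { replace (k - 1)%R with (e * ((k - 1) / e))%R by (field; lra). apply Rmult_le_compat_l; lra. }
    assert (D4 : ((1 + e) * d <= k - Cmod x)%R).
    { replace (k - Cmod x)%R with ((1 + e) * ((k - Cmod x) / (1 + e)))%R by (field; lra).
      apply Rmult_le_compat_l; lra. }
    exists d. split; [exact Hd|]. intros x' y' Hx' Hy'.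
    generalize (Cmod_minus_triangle y y'). rewrite Cmod_minus_sym. intros H3.
    generalize (Cmod_minus_triangle x' x). intros H4. unfold k in *. apply A2; nra.
Qed.

Definition deck (P : Cpt) : Cpt :=
  match P with Caff xi y => Caff (- xi) y | Cinf b => Cinf (negb b) end.

Lemma deck_deck (P : Cpt) : deck (deck P) = P.
Proof. destruct P as [x y|b]; simpl; [f_equal; ring|]. rewrite Bool.negb_involutive. reflexivity. Qed.

Lemma deck_continuous (P : Cpt) : filterlim deck (nbhdC P) (nbhdC (deck P)).
Proof.
  intros A [e [He HA]]. exists e. split; [exact He|]. destruct P as [x y|b]; cbn [deck] in *.
  - intros x' y' Hx Hy. apply HA; [|exact Hy].
    replace (- x' - - x) with (- (x' - x)) by ring. rewrite Cmod_opp. exact Hx.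
  - destruct HA as [A1 A2]. split; [exact A1|]. intros xi y Hx Hy.
    assert (H0 := large_neq_0 _ _ Hx). apply A2; [rewrite Cmod_opp; exact Hx|].
    replace (y / (- xi) ^ 3 - slope_at_infinity (negb b)) with (- (y / xi ^ 3 - slope_at_infinity b)).
    + rewrite Cmod_opp. exact Hy.
    + rewrite slope_negb. field. exact H0.
Qed.

Lemma fcov_deck (t' : C) (P : Cpt) : fcov t' (deck P) = fcov t' P.
Proof. destruct P as [x y|b]; simpl; [f_equal; ring|reflexivity]. Qed.

Lemma fcov_fibre (t' : C) (P P' : Cpt) : fcov t' P = fcov t' P' -> P = P' \/ P = deck P'.
Proof.
  destruct P as [x y|b], P' as [x' y'|b']; cbn [fcov]; try discriminate.
  - intros E. assert (E1 := f_equal x_coordE E). assert (E2 := f_equal y_coordE E). cbn [x_coordE y_coordE] in E1, E2. subst y'. destruct (Csqr_eq x x') as [H|H].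
    + replace (x ^ 2) with (t' - (t' - x ^ 2)) by ring. rewrite E1. ring.
    + left. rewrite H. reflexivity.
    + right. rewrite H. reflexivity.
  - intros _. destruct b, b'; auto.
Qed.

Lemma clim_sqr_0 {T : Type} (F : (T -> Prop) -> Prop) {FF : Filter F} (g : T -> C) :
  filterlim (fun p => g p ^ 2) F (nbhd_plane 0) -> filterlim g F (nbhd_plane 0).
Proof.
  intros H. apply climP; [exact FF|]. intros e He.
  assert (H' := proj1 (climP F _ _) H (e * e)%R ltac:(nra)). revert H'. apply filter_imp.
  intros p Hp. replace (g p ^ 2 - 0) with (g p * g p) in Hp by ring.
  rewrite Cmod_mult in Hp. replace (g p - 0) with (g p) by ring.
  generalize (Cmod_ge_0 (g p)). nra.
Qed.

(** * Filters along the curves and the equation of C *)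

Section Curves.
Variables t t' : C.
Hypothesis Htt' : admissible t t'.

(** [nearE] and [nearC] are these filters by conversion. In this form the lemmas on filters apply,
    and [change] passes from one to the other. *)
Definition nE (Q : Ept) : (Ept -> Prop) -> Prop := within (onE t) (nbhdE Q).
Definition nC (P : Cpt) : (Cpt -> Prop) -> Prop := within (onC t t') (nbhdC P).

Global Instance nE_filter (Q : Ept) : Filter (nE Q).
Proof. unfold nE. typeclasses eauto. Qed.
Global Instance nC_filter (P : Cpt) : Filter (nC P).
Proof. unfold nC. typeclasses eauto. Qed.

Lemma nE_self Q A : onE t Q -> nE Q A -> A Q.
Proof. intros HQ H. exact (nbhdE_self Q _ H HQ). Qed.
Lemma nC_self P A : onC t t' P -> nC P A -> A P.
Proof. intros HP H. exact (nbhdC_self P _ H HP). Qed.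

Lemma nE_open Q A : nE Q A -> nE Q (fun Q' => nE Q' A).
Proof.
  intros H. apply nbhdE_open in H. unfold nE, within in *. revert H. apply filter_imp. auto.
Qed.
Lemma nC_open P A : nC P A -> nC P (fun P' => nC P' A).
Proof.
  intros H. apply nbhdC_open in H. unfold nC, within in *. revert H. apply filter_imp. auto.
Qed.

Lemma nE_onE Q : nE Q (onE t).
Proof. unfold nE, within. apply filter_forall. auto. Qed.
Lemma nC_onC P : nC P (onC t t').
Proof. unfold nC, within. apply filter_forall. auto. Qed.

Lemma nE_of_nbhd Q A : nbhdE Q A -> nE Q A.
Proof. unfold nE, within. apply filter_imp. auto. Qed.
Lemma nC_of_nbhd P A : nbhdC P A -> nC P A.
Proof. unfold nC, within. apply filter_imp. auto. Qed.

Lemma lim_nE_of {T} (F : (T -> Prop) -> Prop) {FF : Filter F} (g : T -> Ept) Q :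
  filterlim g F (nbhdE Q) -> F (fun p => onE t (g p)) -> filterlim g F (nE Q).
Proof.
  intros H1 H2 A HA. assert (H := H1 _ HA). unfold filtermap in *.
  generalize (filter_and _ _ H H2). apply filter_imp. intros p [K1 K2]. auto.
Qed.
Lemma lim_nC_of {T} (F : (T -> Prop) -> Prop) {FF : Filter F} (g : T -> Cpt) P :
  filterlim g F (nbhdC P) -> F (fun p => onC t t' (g p)) -> filterlim g F (nC P).
Proof.
  intros H1 H2 A HA. assert (H := H1 _ HA). unfold filtermap in *.
  generalize (filter_and _ _ H H2). apply filter_imp. intros p [K1 K2]. auto.
Qed.

Lemma lim_from_nE {U} (G : (U -> Prop) -> Prop) (g : Ept -> U) Q :
  filterlim g (nbhdE Q) G -> filterlim g (nE Q) G.
Proof. apply filterlim_within. typeclasses eauto. Qed.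
Lemma lim_from_nC {U} (G : (U -> Prop) -> Prop) (g : Cpt -> U) P :
  filterlim g (nbhdC P) G -> filterlim g (nC P) G.
Proof. apply filterlim_within. typeclasses eauto. Qed.

(** [polyC] is the right-hand side of the equation of C, and
    [polyC xi = xi ^ 6 * polyC_inf (1 / xi ^ 2)]. *)
Definition polyC (xi : C) : C := (t' - xi ^ 2) * (t' - 1 - xi ^ 2) * (t' - t - xi ^ 2).
Definition polyC_inf (u : C) : C := - ((1 - t' * u) * (1 - (t' - 1) * u) * (1 - (t' - t) * u)).

Lemma polyC_lim {T} (F : (T -> Prop) -> Prop) {FF : Filter F} (g : T -> C) (l : C) :
  filterlim g F (nbhd_plane l) -> filterlim (fun p => polyC (g p)) F (nbhd_plane (polyC l)).
Proof.
  intros H. assert (H2 := clim_pow g l 2 H). unfold polyC.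
  apply (clim_mult3 (fun p => t' - g p ^ 2) (fun p => t' - 1 - g p ^ 2) (fun p => t' - t - g p ^ 2)).
  - apply (clim_minus (fun _ => t')); [apply clim_const|exact H2].
  - apply (clim_minus (fun _ => t' - 1)); [apply clim_const|exact H2].
  - apply (clim_minus (fun _ => t' - t)); [apply clim_const|exact H2].
Qed.

Lemma polyC_inf_lim {T} (F : (T -> Prop) -> Prop) {FF : Filter F} (g : T -> C) (l : C) :
  filterlim g F (nbhd_plane l) -> filterlim (fun p => polyC_inf (g p)) F (nbhd_plane (polyC_inf l)).
Proof.
  intros H. unfold polyC_inf.
  assert (K : forall c, filterlim (fun p => 1 - c * g p) F (nbhd_plane (1 - c * l))).
  { intros c. apply (clim_minus (fun _ => RtoC 1)); [apply clim_const|].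
    apply (clim_mult (fun _ => c)); [apply clim_const|exact H]. }
  apply (clim_opp (fun p => (1 - t' * g p) * (1 - (t' - 1) * g p) * (1 - (t' - t) * g p))).
  apply (clim_mult3 (fun p => 1 - t' * g p)); apply K.
Qed.

Lemma polyC_inf_0 b : polyC_inf 0 = slope_at_infinity b ^ 2.
Proof. rewrite slope_sqr. unfold polyC_inf. ring. Qed.

Lemma polyC_inf_0_Re b : (0 < Re (polyC_inf 0 / slope_at_infinity b ^ 2))%R.
Proof. rewrite (polyC_inf_0 b). apply Re_div_self, Cpow2_neq_0, slope_neq_0. Qed.

Lemma polyC_inf_spec (xi : C) : xi <> 0 -> polyC xi = xi ^ 6 * polyC_inf (/ xi ^ 2).
Proof. intros H. unfold polyC, polyC_inf. field. exact H. Qed.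

(** * The double covering of the punctured curve E *)

Lemma onE_fcov P : onC t t' P -> onE t (fcov t' P).
Proof. destruct P as [x y|b]; simpl; [|auto]. intros ->. ring. Qed.

Lemma onC_of_fcov P : onE t (fcov t' P) -> onC t t' P.
Proof. destruct P as [x y|b]; simpl; [|auto]. intros ->. ring. Qed.

Lemma onC_deck P : onC t t' P -> onC t t' (deck P).
Proof. intros H. apply onC_of_fcov. rewrite fcov_deck. apply onE_fcov, H. Qed.

Lemma punctured_fcov P : puncturedC t t' P -> puncturedE t t' (fcov t' P).
Proof.
  intros [H1 H2]. split; [apply onE_fcov, H1|]. intros y E. destruct P as [x y'|b]; cbn [fcov] in E; [|discriminate].
  assert (E1 := f_equal x_coordE E). assert (E2 := f_equal y_coordE E). cbn [x_coordE y_coordE] in E1, E2. apply (H2 y'). f_equal. apply NNPP. intros Hx. apply (Cpow2_neq_0 _ Hx).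
  replace (x ^ 2) with (t' - (t' - x ^ 2)) by ring. rewrite E1. ring.
Qed.

Lemma punctured_of_fcov P : puncturedE t t' (fcov t' P) -> puncturedC t t' P.
Proof.
  intros [H1 H2]. split; [apply onC_of_fcov, H1|]. intros y ->. apply (H2 y). simpl. f_equal. ring.
Qed.

Lemma punctured_deck_neq P : puncturedC t t' P -> deck P <> P.
Proof.
  intros [_ H]. destruct P as [x y|b]; cbn [deck].
  - intros E. apply (f_equal xi_coord) in E. cbn [xi_coord] in E. apply (H y). f_equal.
    assert (E2 : 2 * x = 0) by (replace (2 * x) with (x - - x) by ring; rewrite E; ring).
    apply NNPP. intros Hx. apply (Cmult_neq_0 2 x); [|exact Hx|exact E2].
    intros E3. apply RtoC_inj in E3. lra.
  - destruct b; discriminate.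
Qed.

Lemma punctured_inf b : puncturedC t t' (Cinf b).
Proof. split; [exact I|]. discriminate. Qed.

Lemma deck_nC P : filterlim deck (nC P) (nC (deck P)).
Proof.
  apply lim_nC_of; [typeclasses eauto|apply lim_from_nC, deck_continuous|].
  generalize (nC_onC P). apply filter_imp. apply onC_deck.
Qed.

Lemma fcov_continuous P : filterlim (fcov t') (nC P) (nE (fcov t' P)).
Proof.
  apply lim_nE_of; [typeclasses eauto| |generalize (nC_onC P); apply filter_imp; apply onE_fcov].
  apply lim_from_nC. destruct P as [x y|b]; simpl.
  - apply (filterlim_ext_loc (fun P => Eaff (t' - xi_coord P ^ 2) (y_coordC P))).
    + generalize (nbhdC_affine x y). apply filter_imp. intros P E. rewrite E. reflexivity.
    + apply lim_Eaff; [|apply y_coordC_lim].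
      apply (clim_minus (fun _ => t') (fun P => xi_coord P ^ 2)); [apply clim_const|].
      apply (clim_pow _ _ 2), xi_coord_lim.
  - assert (L1 := inv_xi_lim b). assert (L2 := slope_coord_lim b). assert (S0 := slope_neq_0 b).
    (* With [s = y / xi ^ 3] and [v = 1 / xi], one has [1 / y = v ^ 3 / s] and
       [x / y = (t' * v ^ 2 - 1) * v / s]. *)
    apply (lim_Einf _ (fun P => inv_xi P ^ 3 / slope_coord P)
      (fun P => (t' * inv_xi P ^ 2 - 1) * inv_xi P / slope_coord P)).
    + replace (RtoC 0) with (0 ^ 3 / slope_at_infinity b) by (field; exact S0).
      apply clim_div; [exact S0|apply clim_pow, L1|exact L2].
    + replace (RtoC 0) with ((t' * 0 ^ 2 - 1) * 0 / slope_at_infinity b) by (field; exact S0).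
      apply clim_div; [exact S0| |exact L2]. apply clim_mult; [|exact L1].
      apply clim_minus; [|apply clim_const]. apply clim_mult; [apply clim_const|apply clim_pow, L1].
    + generalize (filter_and _ _ (nbhdC_inf b) (clim_neq_0 _ _ S0 L2)). apply filter_imp.
      intros P [[E|(xi & y & E & Hxi)] Hs]; [left; rewrite E; reflexivity|right].
      rewrite E in *. simpl in Hs.
      assert (Hy : y <> 0) by (intros Ey; apply Hs; rewrite Ey; field; exact Hxi).
      exists (t' - xi ^ 2), y. split; [reflexivity|]. split; [exact Hy|]. simpl. split; field; auto.
Qed.

(** Near [fcov P], the inverse of the restriction of [fcov] to a neighbourhood
    of an unramified point [P]. *)
Definition lift (P : Cpt) (Q : Ept) : Cpt :=
  match P, Q with
  | Caff xi0 _, Eaff x y => Caff (branch xi0 (t' - x)) y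
  | Caff _ _, Einf => Cinf true
  | Cinf b, Eaff x y =>
      Caff (y / (branch (slope_at_infinity b) (polyC_inf (/ (t' - x))) * (t' - x))) y
  | Cinf b, Einf => Cinf b
  end.

(** The function [1 / xi ^ 2] of C, which is invariant under [deck], seen on E. *)
Definition inv_depth (Q : Ept) : C := match Q with Eaff x _ => / (t' - x) | Einf => 0 end.

(** The cubic equation bounds [y] by [x]: if [Cmod x <= M], then [Cmod y ^ 2 <= 4 * M ^ 3 < B]. So
    [x] tends to infinity with [y]. *)
Lemma onE_large (M0 : R) :
  nE Einf (fun Q => match Q with Eaff x y => (M0 < Cmod (t' - x) /\ 0 < Cmod y)%R | Einf => True end).
Proof.
  set (M := (Cmod t' + Cmod t + Rabs M0 + 1)%R).
  assert (Ht := Cmod_ge_0 t). assert (Ht' := Cmod_ge_0 t'). assert (H0 := Rabs_pos M0).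
  assert (HM0 := Rle_abs M0).
  set (B := (M * (M * M) * 4 + 1)%R).
  assert (HB : (1 <= B)%R).
  { unfold B. assert (0 <= M * (M * M))%R by (repeat apply Rmult_le_pos; unfold M; lra). lra. }
  exists (/ B)%R. split; [apply Rinv_0_lt_compat; lra|]. split; [auto|].
  intros x y Hy _ HE. simpl in HE.
  assert (Hy' : (B < Cmod y)%R).
  { apply Rmult_lt_compat_l with (r := B) in Hy; [|lra].
    rewrite <- Rmult_assoc, Rinv_r in Hy by lra. lra. }
  split; [|lra].
  assert (Hx : (M < Cmod x)%R).
  { apply Rnot_le_lt. intros Hx.
    assert (E : Cmod (y ^ 2) = Cmod (x * (x - 1) * (x - t))) by (simpl; rewrite HE; reflexivity).
    rewrite Cmod_pow, !Cmod_mult in E.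
    assert (H1 : (Cmod (x - 1) <= 2 * M)%R).
    { eapply Rle_trans; [apply Cmod_triangle|]. rewrite Cmod_opp, Cmod_1. unfold M in *. lra. }
    assert (H2 : (Cmod (x - t) <= 2 * M)%R).
    { eapply Rle_trans; [apply Cmod_triangle|]. rewrite Cmod_opp. unfold M in *. lra. }
    assert (H3 : (Cmod x * Cmod (x - 1) * Cmod (x - t) <= M * (2 * M) * (2 * M))%R).
    { repeat apply Rmult_le_compat; try apply Cmod_ge_0; try assumption.
      apply Rmult_le_pos; apply Cmod_ge_0. }
    unfold B in *. simpl in E. nra. }
  generalize (Cmod_minus_triangle x t'). rewrite (Cmod_minus_sym x t'). unfold M in Hx. lra.
Qed.

Lemma inv_depth_lim : filterlim inv_depth (nE Einf) (nbhd_plane 0).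
Proof.
  apply climP; [typeclasses eauto|]. intros e He.
  assert (Hie : (0 < / e)%R) by (apply Rinv_0_lt_compat, He).
  generalize (onE_large (/ e)). apply filter_imp. intros [x y|]; simpl.
  - intros [Hz _]. assert (Hz0 : t' - x <> 0) by (apply Cmod_gt_0; lra).
    replace (/ (t' - x) - 0) with (/ (t' - x)) by ring. rewrite Cmod_inv by exact Hz0.
    apply Rmult_lt_reg_r with (Cmod (t' - x)); [lra|]. rewrite Rinv_l by lra.
    apply Rmult_lt_compat_l with (r := e) in Hz; [|exact He]. rewrite Rinv_r in Hz by lra. exact Hz.
  - intros _. rewrite Cminus_self, Cmod_0. exact He.
Qed.

Definition lift_inf_dom (b : bool) (Q : Ept) : Prop :=
  match Q with
  | Einf => True
  | Eaff x y => y <> 0 /\ t' - x <> 0 /\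
      (0 < Re (polyC_inf (/ (t' - x)) / slope_at_infinity b ^ 2))%R
  end.

Lemma lift_inf_dom_near b : nE Einf (lift_inf_dom b).
Proof.
  assert (R1 : nE Einf (fun Q => (0 < Re (polyC_inf (inv_depth Q) / slope_at_infinity b ^ 2))%R)).
  { apply clim_div_Re with (polyC_inf 0); [typeclasses eauto|apply Cpow2_neq_0, slope_neq_0|apply polyC_inf_0_Re|].
    apply polyC_inf_lim; [typeclasses eauto|exact inv_depth_lim]. }
  generalize (filter_and _ _ R1 (onE_large 0)). apply filter_imp. intros [x y|]; [|intros _; exact I].
  intros [H1 [H2 H3]]. split; [apply Cmod_gt_0, H3|]. split; [apply Cmod_gt_0, H2|exact H1].
Qed.

(** [S] is the branch of [y / xi ^ 3] that takes the value of the chosen slope at infinity. As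
    [xi ^ 2 = t' - x], this forces [xi = y / (S * (t' - x))], which is the formula in [lift]. *)
Lemma lift_inf_spec b x y : onE t (Eaff x y) -> lift_inf_dom b (Eaff x y) ->
  let S := branch (slope_at_infinity b) (polyC_inf (/ (t' - x))) in
  let xi := y / (S * (t' - x)) in
  S <> 0 /\ xi <> 0 /\ xi ^ 2 = t' - x /\ y / xi ^ 3 = S.
Proof.
  intros HE (Hy & Hz & HRe) S xi. simpl in HE.
  assert (HS : S <> 0) by (apply branch_neq_0; [apply slope_neq_0|exact HRe]).
  assert (HS2 : S ^ 2 = polyC_inf (/ (t' - x))) by (apply branch_sqr; [apply slope_neq_0|exact HRe]).
  assert (Hxi : xi <> 0).
  { unfold xi. apply Cdiv_neq_0; [exact Hy|]. apply Cmult_neq_0; assumption. }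
  assert (E : y ^ 2 = (t' - x) ^ 3 * S ^ 2).
  { rewrite HS2. unfold polyC_inf. replace (y ^ 2) with (y * (y * 1)) by ring. rewrite HE. field. exact Hz. }
  assert (E2 : xi ^ 2 = t' - x).
  { unfold xi. replace ((y / (S * (t' - x))) ^ 2) with (y ^ 2 / (S ^ 2 * (t' - x) ^ 2)) by (field; auto).
    rewrite E. field. auto. }
  split; [exact HS|]. split; [exact Hxi|]. split; [exact E2|].
  replace (xi ^ 3) with (xi * xi ^ 2) by ring. rewrite E2. unfold xi. field. auto.
Qed.

Lemma lift_fcov_inf b Q : onE t Q -> lift_inf_dom b Q -> fcov t' (lift (Cinf b) Q) = Q.
Proof.
  intros HE HD. destruct Q as [x y|]; [|reflexivity]. simpl. f_equal.
  destruct (lift_inf_spec b x y HE HD) as (_ & _ & E & _). cbv zeta in E. simpl in E. rewrite E. ring.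
Qed.

Lemma lim_nC_lift (F : (Ept -> Prop) -> Prop) {FF : Filter F} (g : Ept -> Cpt) P :
  F (onE t) -> F (fun Q => fcov t' (g Q) = Q) -> filterlim g F (nbhdC P) -> filterlim g F (nC P).
Proof.
  intros H1 H2 H. apply lim_nC_of; [exact FF|exact H|].
  generalize (filter_and _ _ H1 H2). apply filter_imp. intros Q [K1 K2]. apply onC_of_fcov. rewrite K2. exact K1.
Qed.

(** Continuity is required at all points near [Q], not only at [Q], so that admissibility is an open
    condition. *)
Definition section_near (Q : Ept) (tau : Ept -> Cpt) : Prop :=
  puncturedE t t' Q /\
  nE Q (fun Q' => filterlim tau (nE Q') (nC (tau Q')) /\ fcov t' (tau Q') = Q').

Lemma lift_near_inf b : section_near Einf (lift (Cinf b)).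
Proof.
  split; [apply (punctured_fcov (Cinf b)), punctured_inf|].
  assert (HD := lift_inf_dom_near b). assert (HDD := nE_open _ _ HD).
  generalize (filter_and _ _ HDD (filter_and _ _ HD (nE_onE Einf))). apply filter_imp.
  intros Q [H1 [H2 H3]].
  assert (Hf : nE Q (fun Q' => fcov t' (lift (Cinf b) Q') = Q')).
  { generalize (filter_and _ _ H1 (nE_onE Q)). apply filter_imp. intros Q' [K1 K2]. apply lift_fcov_inf; assumption. }
  split; [|apply lift_fcov_inf; assumption].
  apply lim_nC_lift; [typeclasses eauto|apply nE_onE|exact Hf|].
  assert (S0 := slope_neq_0 b).
  destruct Q as [x y|].
  - destruct H2 as (Hy & Hz & HRe). apply lim_from_nE.
    apply (filterlim_ext_loc (fun Q => lift (Cinf b) (Eaff (x_coordE Q) (y_coordE Q)))).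
    { generalize (nbhdE_affine x y). apply filter_imp. intros Q E. rewrite E at 3. reflexivity. }
    assert (Lx := x_coordE_lim x y). assert (Ly := y_coordE_lim x y).
    assert (Lz : filterlim (fun Q => t' - x_coordE Q) (nbhdE (Eaff x y)) (nbhd_plane (t' - x)))
      by (apply clim_minus; [apply clim_const|exact Lx]).
    assert (HS : branch (slope_at_infinity b) (polyC_inf (/ (t' - x))) <> 0)
      by (apply branch_neq_0; assumption).
    simpl. apply lim_Caff; [|exact Ly].
    apply clim_div; [apply Cmult_neq_0; assumption|exact Ly|].
    apply clim_mult; [|exact Lz].
    eapply filterlim_comp; [|apply branch_continuous; assumption].
    apply polyC_inf_lim; [typeclasses eauto|]. apply clim_inv; assumption.
  - assert (Hq : filterlim (fun Q => branch (slope_at_infinity b) (polyC_inf (inv_depth Q))) (nE Einf)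
       (nbhd_plane (slope_at_infinity b))).
    { replace (nbhd_plane (slope_at_infinity b))
        with (nbhd_plane (branch (slope_at_infinity b) (polyC_inf 0)))
        by (rewrite (polyC_inf_0 b), (branch_self _ S0); reflexivity).
      eapply filterlim_comp; [|apply branch_continuous; [exact S0|apply polyC_inf_0_Re]].
      apply polyC_inf_lim; [typeclasses eauto|exact inv_depth_lim]. }
    simpl lift at 2. apply (lim_Cinf _ b (fun Q => inv_xi (lift (Cinf b) Q))
      (fun Q => branch (slope_at_infinity b) (polyC_inf (inv_depth Q)))); [|exact Hq|].
    (* Only the square of [1 / xi], which is [inv_depth], is known to tend to 0. *)
    + apply clim_sqr_0; [typeclasses eauto|].
      apply (clim_ext inv_depth); [|exact inv_depth_lim].
      generalize (filter_and _ _ HD (nE_onE Einf)). apply filter_imp. intros [x y|] [K1 K2].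
      * destruct (lift_inf_spec b x y K2 K1) as (_ & K3 & K4 & _). cbv zeta in K3, K4.
        cbn [inv_xi lift inv_depth]. set (xi := y / _) in *. clearbody xi.
        rewrite <- K4. field. exact K3.
      * simpl. ring.
    + generalize (filter_and _ _ HD (nE_onE Einf)). apply filter_imp. intros [x y|] [K1 K2]; [right|left; reflexivity].
      destruct (lift_inf_spec b x y K2 K1) as (_ & K3 & _ & K5). cbv zeta in K3, K5.
      eexists; eexists. split; [reflexivity|]. split; [exact K3|]. split; [reflexivity|].
      symmetry. exact K5.
Qed.

Lemma lift_near_aff xi0 y0 : puncturedC t t' (Caff xi0 y0) ->
  section_near (fcov t' (Caff xi0 y0)) (lift (Caff xi0 y0)).
Proof.
  intros HP. assert (H0 : xi0 <> 0) by (intros E; apply (proj2 HP y0); rewrite E; reflexivity).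
  split; [apply punctured_fcov, HP|].
  assert (HD : nbhdE (fcov t' (Caff xi0 y0)) (fun Q => exists x y, Q = Eaff x y /\ (0 < Re ((t' - x) / xi0 ^ 2))%R)).
  { simpl. assert (HR : nbhdE (Eaff (t' - xi0 ^ 2) y0) (fun Q => (0 < Re ((t' - x_coordE Q) / xi0 ^ 2))%R)).
    { apply clim_div_Re with (t' - (t' - xi0 ^ 2)); [typeclasses eauto|apply Cpow2_neq_0, H0| |].
      - replace (t' - (t' - xi0 ^ 2)) with (xi0 ^ 2) by ring. apply Re_div_self, Cpow2_neq_0, H0.
      - apply clim_minus; [apply clim_const|apply x_coordE_lim]. }
    generalize (filter_and _ _ HR (nbhdE_affine (t' - xi0 ^ 2) y0)). apply filter_imp.
    intros Q [K1 K2]. eauto. }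
  assert (HF : forall Q, (exists x y, Q = Eaff x y /\ (0 < Re ((t' - x) / xi0 ^ 2))%R) -> fcov t' (lift (Caff xi0 y0) Q) = Q).
  { intros Q (x & y & -> & K). cbn [lift fcov]. rewrite branch_sqr by assumption. f_equal. ring. }
  generalize (nE_of_nbhd _ _ (filter_and _ _ HD (nbhdE_open _ _ HD))). apply filter_imp.
  intros Q [K1 K2]. split; [|apply HF, K1].
  apply lim_nC_lift; [typeclasses eauto|apply nE_onE| |].
  { generalize (nE_of_nbhd _ _ K2). apply filter_imp. exact HF. }
  destruct K1 as (x & y & -> & K). apply lim_from_nE.
  apply (filterlim_ext_loc (fun Q => lift (Caff xi0 y0) (Eaff (x_coordE Q) (y_coordE Q)))).
  { generalize (nbhdE_affine x y). apply filter_imp. intros Q E. rewrite E at 3. reflexivity. }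
  simpl. apply lim_Caff; [|apply y_coordE_lim].
  eapply filterlim_comp; [|apply branch_continuous; assumption].
  apply clim_minus; [apply clim_const|apply x_coordE_lim].
Qed.

Lemma lift_near P : puncturedC t t' P -> section_near (fcov t' P) (lift P).
Proof. destruct P as [x y|b]; [apply lift_near_aff|intros _; apply lift_near_inf]. Qed.

(** Near an affine [P] the sign of [xi] is fixed by [0 < Re (xi / xi0)]; near infinity the sheet is
    recognized by [y / xi ^ 3], which stays close to its slope. In both cases [branch_unique]
    identifies the root. *)
Lemma lift_retract P : puncturedC t t' P -> nC P (fun P' => lift P (fcov t' P') = P').
Proof.
  intros HP. destruct P as [xi0 y0|b].
  - assert (H0 : xi0 <> 0) by (intros E; apply (proj2 HP y0); rewrite E; reflexivity).
    apply nC_of_nbhd. assert (L := xi_coord_lim xi0 y0).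
    assert (R1 : nbhdC (Caff xi0 y0) (fun P => (0 < Re (xi_coord P / xi0))%R))
      by (apply clim_div_Re with xi0; [typeclasses eauto|exact H0|apply Re_div_self, H0|exact L]).
    assert (R2 : nbhdC (Caff xi0 y0) (fun P => (0 < Re (xi_coord P ^ 2 / xi0 ^ 2))%R)).
    { apply clim_div_Re with (xi0 ^ 2); [typeclasses eauto|apply Cpow2_neq_0, H0|apply Re_div_self, Cpow2_neq_0, H0|].
      apply clim_pow, L. }
    generalize (filter_and _ _ (nbhdC_affine xi0 y0) (filter_and _ _ R1 R2)). apply filter_imp.
    intros P (E & K1 & K2). rewrite E. cbn [fcov lift]. f_equal.
    replace (t' - (t' - xi_coord P ^ 2)) with (xi_coord P ^ 2) by ring.
    apply branch_unique; auto.
  - assert (L1 := inv_xi_lim b). assert (L2 := slope_coord_lim b). assert (S0 := slope_neq_0 b).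
    assert (R1 : nbhdC (Cinf b) (fun P => (0 < Re (slope_coord P / slope_at_infinity b))%R))
      by (apply clim_div_Re with (slope_at_infinity b); [typeclasses eauto|exact S0|apply Re_div_self, S0|exact L2]).
    assert (R2 : nbhdC (Cinf b) (fun P => (0 < Re (polyC_inf (inv_xi P ^ 2) / slope_at_infinity b ^ 2))%R)).
    { apply clim_div_Re with (polyC_inf (0 ^ 2)); [typeclasses eauto|apply Cpow2_neq_0, S0| |].
      - replace (0 ^ 2) with (RtoC 0) by ring. apply polyC_inf_0_Re.
      - apply polyC_inf_lim; [typeclasses eauto|apply clim_pow, L1]. }
    generalize (filter_and _ _ (nC_onC (Cinf b)) (nC_of_nbhd _ _ (filter_and _ _ (nbhdC_inf b) (filter_and _ _ R1 R2)))).
    apply filter_imp. intros P (K0 & [E|(xi & y & E & Hxi)] & K1 & K2); rewrite E; [reflexivity|].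
    rewrite E in *. cbn [slope_coord inv_xi] in K1, K2. cbn [fcov lift]. f_equal.
    replace (t' - (t' - xi ^ 2)) with (xi ^ 2) by ring.
    replace (/ (xi ^ 2)) with ((/ xi) ^ 2) by (field; exact Hxi).
    assert (Ey : y ^ 2 = xi ^ 6 * polyC_inf (/ xi ^ 2)) by (rewrite <- polyC_inf_spec by exact Hxi; exact K0).
    assert (HS : branch (slope_at_infinity b) (polyC_inf ((/ xi) ^ 2)) = y / xi ^ 3).
    { apply branch_unique; auto.
      replace ((y / xi ^ 3) ^ 2) with (y ^ 2 / xi ^ 6) by (field; exact Hxi). rewrite Ey.
      replace ((/ xi) ^ 2) with (/ xi ^ 2) by (field; exact Hxi). field. exact Hxi. }
    assert (Hn : y <> 0).
    { intros E0. rewrite E0 in K1. replace (0 / xi ^ 3 / slope_at_infinity b) with (RtoC 0) in K1 by (field; auto).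
      simpl in K1. lra. }
    rewrite HS. field. auto.
Qed.

Lemma lift_fcov P : puncturedC t t' P -> lift P (fcov t' P) = P.
Proof. intros HP. apply (nC_self P _ (proj1 HP) (lift_retract P HP)). Qed.

Lemma punctured_open Q : puncturedE t t' Q -> nE Q (puncturedE t t').
Proof.
  intros [H1 H2].
  assert (K : nbhdE Q (fun Q' => forall y, Q' <> Eaff t' y) \/ Q = Einf).
  { destruct Q as [x y|]; [left|right; reflexivity].
    assert (Hx : x - t' <> 0) by (apply Cminus_neq_0; intros ->; apply (H2 y); reflexivity).
    assert (L : nbhdE (Eaff x y) (fun Q => x_coordE Q - t' <> 0)).
    { apply clim_neq_0 with (x - t'); [exact Hx|]. apply clim_minus; [apply x_coordE_lim|apply clim_const]. }
    revert L. apply filter_imp. intros Q HQ y' ->. apply HQ. simpl. ring. }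
  destruct K as [K| ->].
  - generalize (filter_and _ _ (nE_onE Q) (nE_of_nbhd _ _ K)). apply filter_imp. intros Q' [A B]. split; assumption.
  - generalize (filter_and _ _ (nE_onE Einf) (onE_large 0)). apply filter_imp. intros Q' [A B]. split; [exact A|].
    intros y ->. destruct B as [B _]. rewrite Cminus_self, Cmod_0 in B. lra.
Qed.

Lemma section_self Q tau : section_near Q tau ->
  filterlim tau (nE Q) (nC (tau Q)) /\ fcov t' (tau Q) = Q /\ puncturedC t t' (tau Q).
Proof.
  intros [HX H]. destruct (nE_self Q _ (proj1 HX) H) as [H1 H2]. split; [exact H1|]. split; [exact H2|].
  apply punctured_of_fcov. rewrite H2. exact HX.
Qed.

(** By continuity [tau] stays where [lift (tau Q)] inverts [fcov], so locally there is only one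
    section through a given point. *)
Lemma section_near_lift Q tau : section_near Q tau -> nE Q (fun Q' => tau Q' = lift (tau Q) Q').
Proof.
  intros H. destruct (section_self Q tau H) as (H1 & H2 & H3).
  assert (K := H1 _ (lift_retract _ H3)). unfold filtermap in K.
  generalize (filter_and _ _ K (proj2 H)). apply filter_imp. intros Q' [K1 [_ K2]].
  rewrite K2 in K1. symmetry. exact K1.
Qed.

Lemma section_near_deck Q tau : section_near Q tau -> section_near Q (fun Q' => deck (tau Q')).
Proof.
  intros [HX H]. split; [exact HX|]. revert H. apply filter_imp. intros Q' [H1 H2]. split.
  - eapply filterlim_comp; [exact H1|apply deck_nC].
  - rewrite fcov_deck. exact H2.
Qed.

Lemma fcov_surj Q : exists P, fcov t' P = Q.
Proof.
  destruct Q as [x y|]; [|exists (Cinf true); reflexivity].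
  destruct (sqrt_exists (t' - x)) as [xi Hxi]. exists (Caff xi y). cbn [fcov]. rewrite Hxi. f_equal. ring.
Qed.

(** Two sections over [Q] either meet there or are exchanged by [deck]. The first case persists
    nearby by local uniqueness of sections, the second also because [deck] has no fixed point on the
    punctured curve. *)
Lemma covering_E : is_covering nE (puncturedE t t') (fun _ P P' => P = P') section_near
  (fun (g : bool) P => if g then deck P else P).
Proof.
  constructor.
  - congruence.
  - congruence.
  - intros Q HQ. destruct (fcov_surj Q) as [P HP]. exists (lift P). rewrite <- HP. apply lift_near.
    apply punctured_of_fcov. rewrite HP. exact HQ.
  - intros Q tau [HX H]. generalize (filter_and _ _ (punctured_open Q HX) (nE_open Q _ H)). apply filter_imp.
    intros Q' [A B]. split; assumption.
  - reflexivity.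
  - intros Q tau tau' H H'.
    destruct (section_self Q tau H) as (A1 & A2 & A3). destruct (section_self Q tau' H') as (B1 & B2 & B3).
    destruct (fcov_fibre t' (tau Q) (tau' Q)) as [E|E]; [congruence| |].
    + generalize (filter_and _ _ (section_near_lift Q tau H) (section_near_lift Q tau' H')). apply filter_imp.
      intros Q' [K1 K2]. rewrite K1, K2, E. tauto.
    + generalize (filter_and _ _ (filter_and _ _ (punctured_open Q (proj1 H)) (proj2 H'))
       (filter_and _ _ (section_near_lift Q tau H) (section_near_lift Q _ (section_near_deck Q tau' H')))). apply filter_imp.
      intros Q' [[KX [_ KF]] [K1 K2]]. rewrite <- E in K2. rewrite K1, <- K2, E.
      assert (KP : puncturedC t t' (tau' Q')) by (apply punctured_of_fcov; rewrite KF; exact KX).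
      assert (N1 := punctured_deck_neq _ KP). assert (N2 := punctured_deck_neq _ B3). tauto.
  - intros Q [|] tau H; [apply section_near_deck, H|exact H].
  - intros Q g d d' ->. reflexivity.
  - intros Q tau tau' HX H H'.
    destruct (section_self Q tau H) as (A1 & A2 & A3). destruct (section_self Q tau' H') as (B1 & B2 & B3).
    destruct (fcov_fibre t' (tau' Q) (tau Q)) as [E|E]; [congruence| |].
    + exists false. auto.
    + exists true. auto.
Qed.

(** * Charts *)

Lemma Cdiv_neq_0_inv (x y : C) : y <> 0 -> x / y <> 0 -> x <> 0.
Proof. intros Hy H E. apply H. rewrite E. field. exact Hy. Qed.

(** [chi] is a local parametrization at [Q = chi v], [kappa] its inverse and
    [crd] another coordinate; [N] is the neighbourhood filter of [Q]. *)
Lemma quotient_of_cderiv {T : Type} (N : (T -> Prop) -> Prop) {FN : Filter N} (Q : T)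
    (chi : C -> T) (kappa crd h : T -> C) (v a j : C) :
  chi v = Q -> filterlim kappa N (nbhd_plane v) -> N (fun Q' => chi (kappa Q') = Q') -> j <> 0 ->
  cderiv (fun w => crd (chi w)) v j -> cderiv (fun w => h (chi w)) v a ->
  filterlim (fun Q' => (h Q' - h Q) / (crd Q' - crd Q)) (within (fun Q' => Q' <> Q) N) (nbhd_plane (a / j)).
Proof.
  intros HQ Hk Hck Hj Hcrd Hh. apply cderiv_quotient in Hcrd. apply cderiv_quotient in Hh.
  assert (Hkw : filterlim kappa (within (fun Q' => Q' <> Q) N) (within (fun w => w <> v) (nbhd_plane v))).
  { intros A HA. assert (K := Hk _ HA). unfold filtermap, within in *.
    generalize (filter_and _ _ K Hck). apply filter_imp. intros Q' [K1 K2] Hn. apply K1.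
    intros E. apply Hn. rewrite <- K2, E. exact HQ. }
  assert (L1 := filterlim_comp _ _ _ _ _ _ _ _ Hkw Hh).
  assert (L2 := filterlim_comp _ _ _ _ _ _ _ _ Hkw Hcrd).
  assert (L := clim_div _ _ _ _ Hj L1 L2). revert L. apply filterlim_ext_loc.
  assert (Hn0 := clim_neq_0 _ _ Hj L2). unfold within in *.
  generalize (filter_and _ _ Hn0 Hck). apply filter_imp. intros Q' [K1 K2] Hn.
  specialize (K1 Hn). rewrite K2, HQ in *.
  assert (Hkv : kappa Q' - v <> 0).
  { apply Cminus_neq_0. intros E. apply Hn. rewrite <- K2, E. exact HQ. }
  apply Cdiv_neq_0_inv in K1; [|exact Hkv]. field. auto.
Qed.

(** The converse passage, from the quotient along the curve to the derivative in the chart;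
    injectivity of [chi] at [v] keeps the quotient away from 0 / 0. *)
Lemma cderiv_of_quotient {T : Type} (N : (T -> Prop) -> Prop) (Q : T)
    (chi : C -> T) (crd h : T -> C) (v d j : C) :
  chi v = Q -> filterlim chi (nbhd_plane v) N -> nbhd_plane v (fun w => chi w = Q -> w = v) -> j <> 0 ->
  cderiv (fun w => crd (chi w)) v j ->
  filterlim (fun Q' => (h Q' - h Q) / (crd Q' - crd Q)) (within (fun Q' => Q' <> Q) N) (nbhd_plane d) ->
  cderiv (fun w => h (chi w)) v (d * j).
Proof.
  intros HQ Hc Hinj Hj Hcrd Hh. apply cderiv_quotient in Hcrd. apply cderiv_quotient.
  assert (Hcw : filterlim chi (within (fun w => w <> v) (nbhd_plane v)) (within (fun Q' => Q' <> Q) N)).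
  { intros A HA. assert (K := Hc _ HA). unfold filtermap, within in *.
    generalize (filter_and _ _ K Hinj). apply filter_imp. intros w [K1 K2] Hn. apply K1.
    intros E. apply Hn, K2, E. }
  assert (L1 := filterlim_comp _ _ _ _ _ _ _ _ Hcw Hh).
  assert (L := clim_mult _ _ _ _ L1 Hcrd). revert L. apply filterlim_ext_loc.
  assert (Hn0 := clim_neq_0 _ _ Hj Hcrd). unfold within in *.
  revert Hn0. apply filter_imp. intros w K1 Hn. specialize (K1 Hn). rewrite HQ in *.
  apply Cminus_neq_0 in Hn. apply Cdiv_neq_0_inv in K1; [|exact Hn]. field. auto.
Qed.

(** A boolean indexes the two forms, so that one argument serves both [z1] ([false]) and [z2]
    ([true]). *)
Definition form (second : bool) : C -> C -> C := if second then omega2 else omega1.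

(** At [v] in the domain of the chart [chi], with inverse [kappa]; [J] is the
    derivative of the standard coordinate, and [W second] is the coefficient of
    the form [form second] in the chart. *)
Record chart_at (chi : C -> Cpt) (kappa : Cpt -> C) (W : bool -> C -> C) (v : C) : Prop := {
  ch_cont : filterlim chi (nbhd_plane v) (nC (chi v));
  ch_left : kappa (chi v) = v;
  ch_kappa : filterlim kappa (nC (chi v)) (nbhd_plane v);
  ch_right : nC (chi v) (fun P' => chi (kappa P') = P');
  ch_coord : exists J : C, J <> 0 /\ cderiv (fun w => coordC (chi v) (chi w)) v J /\
    forall xi y, chi v = Caff xi y -> y <> 0 -> forall k, W k v = form k xi y * J;
  ch_holo : forall k, exists d, cderiv (W k) v d;
  ch_regular : v <> 0 -> exists xi y, chi v = Caff xi y /\ y <> 0;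
  ch_below : puncturedC t t' (chi v) -> (exists d, cderiv (fun w => inv_xi (chi w)) v d) /\
    exists j : C, j <> 0 /\ cderiv (fun w => coordE (fcov t' (chi v)) (fcov t' (chi w))) v j }.

Arguments ch_cont {chi kappa W v}.
Arguments ch_left {chi kappa W v}.
Arguments ch_kappa {chi kappa W v}.
Arguments ch_right {chi kappa W v}.
Arguments ch_coord {chi kappa W v}.
Arguments ch_holo {chi kappa W v}.
Arguments ch_regular {chi kappa W v}.
Arguments ch_below {chi kappa W v}.

Lemma coordC_regular (xi y : C) : y <> 0 -> coordC (Caff xi y) = xi_coord.
Proof. intros H. simpl. destruct Ceq_dec; [contradiction|reflexivity]. Qed.

Lemma coordE_regular (x y : C) : y <> 0 -> coordE (Eaff x y) = x_coordE.
Proof. intros H. simpl. destruct Ceq_dec; [contradiction|reflexivity]. Qed.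

Lemma cderiv_eq (f : C -> C) (v d d' : C) : cderiv f v d -> d = d' -> cderiv f v d'.
Proof. intros H <-. exact H. Qed.

(** At a point where y <> 0 everything follows from the derivative of xi. *)
Lemma chart_at_regular (chi : C -> Cpt) (kappa : Cpt -> C) (W : bool -> C -> C) (X Y : C -> C) (v J : C) :
  nbhd_plane v (fun w => chi w = Caff (X w) (Y w)) -> Y v <> 0 ->
  filterlim Y (nbhd_plane v) (nbhd_plane (Y v)) ->
  nbhd_plane v (fun w => onC t t' (chi w)) ->
  cderiv X v J -> J <> 0 -> (forall k, W k v = form k (X v) (Y v) * J) ->
  (forall k, exists d, cderiv (W k) v d) ->
  kappa (chi v) = v -> filterlim kappa (nbhdC (chi v)) (nbhd_plane v) ->
  nC (chi v) (fun P' => chi (kappa P') = P') ->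
  chart_at chi kappa W v.
Proof.
  intros Hchi HY0 HYc HonC HX HJ HW HWd Hk1 Hk2 Hk3.
  assert (Ev : chi v = Caff (X v) (Y v)) by exact (nbhd_plane_self v _ Hchi).
  assert (HXc := cderiv_continuous _ _ _ HX).
  constructor.
  - apply lim_nC_of; [typeclasses eauto| |exact HonC]. rewrite Ev.
    apply (filterlim_ext_loc (fun w => Caff (X w) (Y w))).
    + revert Hchi. apply filter_imp. auto.
    + apply lim_Caff; assumption.
  - exact Hk1.
  - apply lim_from_nC, Hk2.
  - exact Hk3.
  - exists J. split; [exact HJ|]. rewrite Ev, coordC_regular by exact HY0. split.
    + revert HX. apply cderiv_ext. revert Hchi. apply filter_imp. intros w E. rewrite E. reflexivity.
    + intros xi y E _ k. rewrite HW.
      assert (E1 := f_equal xi_coord E). assert (E2 := f_equal y_coordC E). cbn [xi_coord y_coordC] in E1, E2.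
      rewrite E1, E2. reflexivity.
  - exact HWd.
  - intros _. exists (X v), (Y v). auto.
  - intros HP. rewrite Ev in HP.
    assert (HX0 : X v <> 0) by (intros E; apply (proj2 HP (Y v)); rewrite E; reflexivity).
    split.
    + destruct (cderiv_inv X v J HX0 HX) as [d Hd]. exists d. revert Hd. apply cderiv_ext.
      revert Hchi. apply filter_imp. intros w E. rewrite E. reflexivity.
    + exists (0 - (J * X v + X v * J)). split.
      * replace (0 - (J * X v + X v * J)) with (- (2 * (X v * J))) by ring. intros E.
        assert (E2 : 2 * (X v * J) = 0) by (replace (2 * (X v * J)) with (- - (2 * (X v * J))) by ring; rewrite E; ring).
        revert E2. repeat apply Cmult_neq_0; auto. intros E2. apply RtoC_inj in E2. lra.
      * rewrite Ev. cbn [fcov]. rewrite coordE_regular by exact HY0.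
        apply (cderiv_ext (fun w => t' - X w * X w)).
        -- revert Hchi. apply filter_imp. intros w E. rewrite E. cbn [fcov x_coordE]. ring.
        -- apply cderiv_minus; [apply cderiv_const|apply cderiv_mult; exact HX].
Qed.

Lemma form_holo (X Y : C -> C) (v : C) : Y v <> 0 -> (exists d, cderiv X v d) -> (exists d, cderiv Y v d) ->
  forall k, exists d, cderiv (fun w => form k (X w) (Y w)) v d.
Proof.
  intros H0 [dX HX] [dY HY]. destruct (cderiv_inv Y v dY H0 HY) as [d Hd]. intros [|].
  - eexists. apply (cderiv_mult X (fun w => / Y w)); eassumption.
  - exists d. exact Hd.
Qed.

Lemma polyC_cderiv (f : C -> C) (v d : C) : cderiv f v d -> exists d', cderiv (fun w => polyC (f w)) v d'.
Proof.
  intros H. unfold polyC. destruct (cderiv_pow f v d 2 H) as [d2 H2]. eexists.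
  apply (cderiv_mult (fun w => (t' - f w ^ 2) * (t' - 1 - f w ^ 2)) (fun w => t' - t - f w ^ 2)).
  - apply (cderiv_mult (fun w => t' - f w ^ 2) (fun w => t' - 1 - f w ^ 2)).
    + apply (cderiv_minus (fun _ => t')); [apply cderiv_const|exact H2].
    + apply (cderiv_minus (fun _ => t' - 1)); [apply cderiv_const|exact H2].
  - apply (cderiv_minus (fun _ => t' - t)); [apply cderiv_const|exact H2].
Qed.

Lemma polyC_inf_cderiv (f : C -> C) (v d : C) : cderiv f v d ->
  exists d', cderiv (fun w => polyC_inf (f w)) v d'.
Proof.
  intros H. unfold polyC_inf.
  assert (K : forall c, exists d', cderiv (fun w => 1 - c * f w) v d').
  { intros c. eexists. apply (cderiv_minus (fun _ => RtoC 1)); [apply cderiv_const|].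
    apply cderiv_scal, H. }
  destruct (K t') as [d1 K1]. destruct (K (t' - 1)) as [d2 K2]. destruct (K (t' - t)) as [d3 K3]. eexists.
  apply (cderiv_opp (fun w => (1 - t' * f w) * (1 - (t' - 1) * f w) * (1 - (t' - t) * f w))).
  apply (cderiv_mult (fun w => (1 - t' * f w) * (1 - (t' - 1) * f w)) (fun w => 1 - (t' - t) * f w)); [|exact K3].
  apply (cderiv_mult (fun w => 1 - t' * f w) (fun w => 1 - (t' - 1) * f w)); eassumption.
Qed.

Lemma branch_comp_cderiv (w0 : C) (f : C -> C) (v d : C) : w0 <> 0 -> (0 < Re (f v / w0 ^ 2))%R ->
  cderiv f v d -> exists d', cderiv (fun w => branch w0 (f w)) v d'.
Proof.
  intros H0 HR H. eexists. apply (cderiv_comp (branch w0) f); [apply branch_cderiv; assumption|exact H].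
Qed.

Lemma shift_cderiv (c v : C) : cderiv (fun w => c + w) v 1.
Proof.
  apply cderiv_eq with (0 + 1); [|ring]. apply cderiv_plus; [apply cderiv_const|apply cderiv_id].
Qed.

Lemma sqr_cderiv (v : C) : cderiv (fun w => w ^ 2) v (2 * v).
Proof.
  apply (cderiv_ext (fun w => w * w)).
  - apply filter_forall. intros w. ring.
  - apply cderiv_eq with (1 * v + v * 1); [|ring]. apply cderiv_mult; apply cderiv_id.
Qed.

Lemma onC_polyC (xi y : C) : y ^ 2 = polyC xi -> onC t t' (Caff xi y).
Proof. intros H. exact H. Qed.

(** Here [xi - xi0] is the chart coordinate, and [y] is the branch of the root of [polyC] through
    [y0]. *)
Lemma chart_y_neq_0 (xi0 y0 : C) : onC t t' (Caff xi0 y0) -> y0 <> 0 ->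
  exists (chi : C -> Cpt) (kappa : Cpt -> C) (W : bool -> C -> C), chi 0 = Caff xi0 y0 /\ nbhd_plane 0 (chart_at chi kappa W).
Proof.
  intros HP Hy0. change (y0 ^ 2 = polyC xi0) in HP.
  set (Y := fun v => branch y0 (polyC (xi0 + v))).
  exists (fun v => Caff (xi0 + v) (Y v)), (fun P => xi_coord P - xi0), (fun k v => form k (xi0 + v) (Y v)).
  assert (L0 : filterlim (fun v => xi0 + v) (nbhd_plane 0) (nbhd_plane (xi0 + 0)))
    by (apply clim_plus; [apply clim_const|apply clim_id]).
  split.
  { unfold Y. replace (xi0 + 0) with xi0 by ring. rewrite <- HP, branch_self by exact Hy0. reflexivity. }
  assert (HD : nbhd_plane 0 (fun v => (0 < Re (polyC (xi0 + v) / y0 ^ 2))%R)).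
  { apply clim_div_Re with (polyC (xi0 + 0)); [typeclasses eauto|apply Cpow2_neq_0, Hy0| |].
    - replace (xi0 + 0) with xi0 by ring. rewrite <- HP. apply Re_div_self, Cpow2_neq_0, Hy0.
    - apply polyC_lim; [typeclasses eauto|exact L0]. }
  generalize (filter_and _ _ HD (nbhd_plane_open _ _ HD)). apply filter_imp. intros v [Hv Hvn].
  assert (HX := shift_cderiv xi0 v).
  assert (HYv : Y v <> 0) by (apply branch_neq_0; assumption).
  assert (HYd : exists d, cderiv Y v d).
  { destruct (polyC_cderiv _ v _ HX) as [d Hd]. apply (branch_comp_cderiv y0 _ v d Hy0 Hv Hd). }
  apply (chart_at_regular _ _ _ (fun v => xi0 + v) Y v 1).
  - apply filter_forall. reflexivity.
  - exact HYv.
  - destruct HYd as [d Hd]. apply (cderiv_continuous _ _ _ Hd).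
  - revert Hvn. apply filter_imp. intros w Hw. apply onC_polyC. apply branch_sqr; assumption.
  - exact HX.
  - intros E. apply RtoC_inj in E. lra.
  - intros k. ring.
  - apply form_holo; [exact HYv|eexists; exact HX|exact HYd].
  - simpl. ring.
  - replace (nbhd_plane v) with (nbhd_plane (xi0 + v - xi0)) by (f_equal; ring).
    apply (clim_minus xi_coord); [apply xi_coord_lim|apply clim_const].
  - assert (Lx := xi_coord_lim (xi0 + v) (Y v)). assert (Ly := y_coordC_lim (xi0 + v) (Y v)).
    assert (R1 : nbhdC (Caff (xi0 + v) (Y v)) (fun P => (0 < Re (polyC (xi_coord P) / y0 ^ 2))%R)).
    { apply clim_div_Re with (polyC (xi0 + v)); [typeclasses eauto|apply Cpow2_neq_0, Hy0|exact Hv|].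
      apply polyC_lim; [typeclasses eauto|exact Lx]. }
    assert (R2 : nbhdC (Caff (xi0 + v) (Y v)) (fun P => (0 < Re (y_coordC P / y0))%R)).
    { apply clim_div_Re with (Y v); [typeclasses eauto|exact Hy0|apply branch_Re; assumption|exact Ly]. }
    generalize (filter_and _ _ (nC_onC (Caff (xi0 + v) (Y v)))
      (nC_of_nbhd _ _ (filter_and _ _ (nbhdC_affine _ _) (filter_and _ _ R1 R2)))).
    apply filter_imp. intros P (K0 & E & K1 & K2). rewrite E in K0.
    transitivity (Caff (xi_coord P) (y_coordC P)); [|symmetry; exact E].
    unfold Y. replace (xi0 + (xi_coord P - xi0)) with (xi_coord P) by ring. f_equal.
    apply branch_unique; assumption.
Qed.

(** At a Weierstrass point (xi0, 0) the chart is
    (xi, y) = (xi0 + v ^ 2, v * sqrt (quo (v ^ 2))), where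
    polyC (xi0 + u) = u * quo u. *)
Lemma polyC_root (xi0 : C) : polyC xi0 = 0 ->
  exists quo : C -> C, quo 0 <> 0 /\ (forall u, polyC (xi0 + u) = u * quo u) /\
    forall f v d, cderiv f v d -> exists d', cderiv (fun w => quo (f w)) v d'.
Proof.
  intros H.
  set (e1 := (t' - xi0 ^ 2) + (t' - 1 - xi0 ^ 2) + (t' - t - xi0 ^ 2)).
  set (e2 := (t' - xi0 ^ 2) * (t' - 1 - xi0 ^ 2) + (t' - xi0 ^ 2) * (t' - t - xi0 ^ 2)
     + (t' - 1 - xi0 ^ 2) * (t' - t - xi0 ^ 2)).
  destruct Htt' as (T0 & T1 & T0' & T1' & Tn).
  (* At 0 the polynomial takes the value [t' * (t' - 1) * (t' - t)]. *)
  assert (Hxi : xi0 <> 0).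
  { intros ->. revert H. unfold polyC.
    replace (t' - 0 ^ 2) with t' by ring. replace (t' - 1 - 0 ^ 2) with (t' - 1) by ring.
    replace (t' - t - 0 ^ 2) with (t' - t) by ring.
    repeat apply Cmult_neq_0; auto; apply Cminus_neq_0; auto. }
  (* Up to sign [e2] is the derivative, with respect to [xi ^ 2], of the cubic with roots [t'],
     [t' - 1], [t' - t]; these are simple because 0, 1 and [t] are distinct. *)
  assert (He2 : e2 <> 0).
  { assert (K : t' - xi0 ^ 2 = 0 \/ t' - 1 - xi0 ^ 2 = 0 \/ t' - t - xi0 ^ 2 = 0).
    { apply NNPP. intros Hn. revert H. unfold polyC. repeat apply Cmult_neq_0; tauto. }
    unfold e2. destruct K as [K|[K|K]].
    - replace (t' - 1 - xi0 ^ 2) with (- (1) + (t' - xi0 ^ 2)) by ring.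
      replace (t' - t - xi0 ^ 2) with (- t + (t' - xi0 ^ 2)) by ring. rewrite K.
      match goal with |- ?x <> RtoC 0 => replace x with t by ring end. exact T0.
    - replace (t' - xi0 ^ 2) with (1 + (t' - 1 - xi0 ^ 2)) by ring.
      replace (t' - t - xi0 ^ 2) with (1 - t + (t' - 1 - xi0 ^ 2)) by ring. rewrite K.
      match goal with |- ?x <> RtoC 0 => replace x with (1 - t) by ring end. apply Cminus_neq_0. auto.
    - replace (t' - xi0 ^ 2) with (t + (t' - t - xi0 ^ 2)) by ring.
      replace (t' - 1 - xi0 ^ 2) with (t - 1 + (t' - t - xi0 ^ 2)) by ring. rewrite K.
      match goal with |- ?x <> RtoC 0 => replace x with (t * (t - 1)) by ring end.
      apply Cmult_neq_0; [exact T0|]. apply Cminus_neq_0, T1. }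
  exists (fun u => (2 * xi0 + u) * (- e2 + u * (2 * xi0 + u) * (e1 - u * (2 * xi0 + u)))).
  split; [|split].
  - match goal with |- ?x <> RtoC 0 => replace x with (- (2 * xi0 * e2)) by ring end. intros E.
    assert (E2 : 2 * xi0 * e2 = 0) by (replace (2 * xi0 * e2) with (- - (2 * xi0 * e2)) by ring; rewrite E; ring).
    revert E2. repeat apply Cmult_neq_0; auto. intros E2. apply RtoC_inj in E2. lra.
  - intros u. transitivity (polyC xi0 + u * ((2 * xi0 + u) * (- e2 + u * (2 * xi0 + u) * (e1 - u * (2 * xi0 + u))))).
    + unfold polyC, e1, e2. ring.
    + rewrite H. ring.
  - intros f v d Hf.
    assert (K1 : exists d', cderiv (fun w => 2 * xi0 + f w) v d')
      by (eexists; apply (cderiv_plus (fun _ => 2 * xi0)); [apply cderiv_const|exact Hf]).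
    destruct K1 as [d1 K1]. assert (K2 := cderiv_mult _ _ _ _ _ Hf K1).
    eexists. apply (cderiv_mult (fun w => 2 * xi0 + f w)); [exact K1|].
    apply (cderiv_plus (fun _ => - e2)); [apply cderiv_const|].
    apply (cderiv_mult (fun w => f w * (2 * xi0 + f w))); [exact K2|].
    apply (cderiv_minus (fun _ => e1)); [apply cderiv_const|exact K2].
Qed.

Lemma chart_y_eq_0 (xi0 : C) : onC t t' (Caff xi0 0) ->
  exists (chi : C -> Cpt) (kappa : Cpt -> C) (W : bool -> C -> C),
    chi 0 = Caff xi0 0 /\ nbhd_plane 0 (chart_at chi kappa W).
Proof.
  intros HP. assert (HP0 : polyC xi0 = 0) by (rewrite <- HP; ring). clear HP.
  destruct (polyC_root xi0 HP0) as (quo & Hq0 & Hq & Hqd).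
  destruct (sqrt_exists (quo 0)) as [r0 Hr0].
  assert (Hr : r0 <> 0) by (intros E; apply Hq0; rewrite <- Hr0, E; ring).
  assert (Hql : forall {T} (F : (T -> Prop) -> Prop) (FF : Filter F) (f : T -> C) l,
     filterlim f F (nbhd_plane l) -> filterlim (fun p => quo (f p)) F (nbhd_plane (quo l))).
  { intros T F FF f l Hf. destruct (Hqd (fun w => w) l 1 (cderiv_id l)) as [d Hd].
    eapply filterlim_comp; [exact Hf|]. apply (cderiv_continuous _ _ _ Hd). }
  set (S := fun u => branch r0 (quo u)).
  set (X := fun v : C => xi0 + v ^ 2). set (Y := fun v : C => v * S (v ^ 2)).
  (* The coefficients come from [dxi = 2 v dv] and [y = v * S (v ^ 2)]: the factor [v] cancels in
     [dxi / y], so both forms are regular at the centre. *)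
  exists (fun v => Caff (X v) (Y v)), (fun P => y_coordC P / S (xi_coord P - xi0)),
    (fun (k : bool) v => (if k then X v else 1) * (2 / S (v ^ 2))).
  split; [unfold X, Y; f_equal; ring|].
  set (D := fun u => (0 < Re (quo u / r0 ^ 2))%R).
  assert (HD : nbhd_plane 0 (fun v => D (v ^ 2))).
  { apply clim_div_Re with (quo (0 ^ 2)); [typeclasses eauto|apply Cpow2_neq_0, Hr| |].
    - replace (0 ^ 2) with (RtoC 0) by ring. rewrite <- Hr0. apply Re_div_self, Cpow2_neq_0, Hr.
    - apply Hql; [typeclasses eauto|]. apply clim_pow, clim_id. }
  generalize (filter_and _ _ HD (nbhd_plane_open _ _ HD)). apply filter_imp. intros v [Hv Hvn].
  assert (HSv : S (v ^ 2) <> 0) by (apply branch_neq_0; assumption).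
  assert (HSd : exists d, cderiv (fun w => S (w ^ 2)) v d).
  { destruct (Hqd _ v _ (sqr_cderiv v)) as [d Hd]. apply (branch_comp_cderiv r0 _ v d Hr Hv Hd). }
  destruct HSd as [dS HSd].
  assert (HX : cderiv X v (2 * v)).
  { apply cderiv_eq with (0 + 2 * v); [|ring]. apply cderiv_plus; [apply cderiv_const|apply sqr_cderiv]. }
  assert (HY := cderiv_mult _ _ _ _ _ (cderiv_id v) HSd). change (fun x : C => x * S (x ^ 2)) with Y in HY.
  assert (HSl : forall {T} (F : (T -> Prop) -> Prop) (FF : Filter F) (f : T -> C),
     filterlim f F (nbhd_plane (v ^ 2)) -> filterlim (fun p => S (f p)) F (nbhd_plane (S (v ^ 2)))).
  { intros T F FF f Hf. unfold S. eapply filterlim_comp; [apply Hql; [exact FF|exact Hf]|].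
    apply branch_continuous; assumption. }
  assert (HonC : nbhd_plane v (fun w => onC t t' (Caff (X w) (Y w)))).
  { revert Hvn. apply filter_imp. intros w Hw. apply onC_polyC. unfold X. rewrite Hq.
    rewrite <- (branch_sqr r0 (quo (w ^ 2)) Hr Hw). unfold Y, S. ring. }
  assert (HXv : X v - xi0 = v ^ 2) by (unfold X; ring).
  assert (Lx := xi_coord_lim (X v) (Y v)). assert (Ly := y_coordC_lim (X v) (Y v)).
  assert (Lu : filterlim (fun P => xi_coord P - xi0) (nbhdC (Caff (X v) (Y v))) (nbhd_plane (v ^ 2))).
  { rewrite <- HXv. apply clim_minus; [exact Lx|apply clim_const]. }
  assert (Hleft : Y v / S (X v - xi0) = v) by (rewrite HXv; unfold Y; field; exact HSv).
  assert (Hkap : filterlim (fun P => y_coordC P / S (xi_coord P - xi0)) (nbhdC (Caff (X v) (Y v))) (nbhd_plane v)).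
  { replace (nbhd_plane v) with (nbhd_plane (Y v / S (v ^ 2)))
      by (f_equal; rewrite <- HXv; exact Hleft).
    apply (clim_div y_coordC); [exact HSv|exact Ly|].
    apply HSl; [typeclasses eauto|exact Lu]. }
  assert (Hright : nC (Caff (X v) (Y v)) (fun P' => Caff (X (y_coordC P' / S (xi_coord P' - xi0)))
     (Y (y_coordC P' / S (xi_coord P' - xi0))) = P')).
  { assert (R1 : nbhdC (Caff (X v) (Y v)) (fun P => D (xi_coord P - xi0))).
    { apply clim_div_Re with (quo (v ^ 2)); [typeclasses eauto|apply Cpow2_neq_0, Hr|exact Hv|].
      apply Hql; [typeclasses eauto|exact Lu]. }
    generalize (filter_and _ _ (nC_onC (Caff (X v) (Y v)))
      (nC_of_nbhd _ _ (filter_and _ _ (nbhdC_affine _ _) R1))).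
    apply filter_imp. intros P (K0 & E & K1). rewrite E in K0.
    transitivity (Caff (xi_coord P) (y_coordC P)); [|symmetry; exact E].
    set (xi := xi_coord P) in *. set (y := y_coordC P) in *. clearbody xi y. clear E.
    assert (HS : S (xi - xi0) <> 0) by (apply branch_neq_0; assumption).
    assert (E1 : (y / S (xi - xi0)) ^ 2 = xi - xi0).
    { change (y ^ 2 = polyC xi) in K0.
      replace xi with (xi0 + (xi - xi0)) in K0 at 1 by ring. rewrite Hq in K0.
      rewrite <- (branch_sqr r0 (quo (xi - xi0)) Hr K1) in K0. fold (S (xi - xi0)) in K0.
      replace ((y / S (xi - xi0)) ^ 2) with (y ^ 2 / S (xi - xi0) ^ 2) by (field; exact HS).
      rewrite K0. field. exact HS. }
    unfold X, Y. rewrite E1. f_equal; [ring|field; exact HS]. }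
  assert (HWd : forall k : bool, exists d, cderiv (fun v => (if k then X v else 1) * (2 / S (v ^ 2))) v d).
  { destruct (cderiv_inv (fun w => S (w ^ 2)) v dS HSv HSd) as [d Hd].
    intros [|]; eexists.
    - apply (cderiv_mult X (fun v => 2 / S (v ^ 2))); [exact HX|apply cderiv_scal, Hd].
    - apply (cderiv_mult (fun _ => RtoC 1) (fun v => 2 / S (v ^ 2))); [apply cderiv_const|apply cderiv_scal, Hd]. }
  (* At the centre [y] is the standard coordinate of both curves; elsewhere [y <> 0] and the general
     lemma applies. *)
  destruct (Ceq_dec v 0) as [Ev|Hv0].
  - assert (EY : Y v = 0) by (rewrite Ev; unfold Y; ring).
    assert (HY' : cderiv Y v (S (v ^ 2))) by (apply (cderiv_eq _ _ _ _ HY); rewrite Ev; ring).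
    assert (Hc : forall (A : Type) (a b : A), (if Ceq_dec (Y v) 0 then a else b) = a)
      by (intros A a b; rewrite EY; destruct Ceq_dec; [reflexivity|congruence]).
    constructor.
    + apply lim_nC_of; [typeclasses eauto| |exact HonC].
      apply lim_Caff; [apply (cderiv_continuous _ _ _ HX)|apply (cderiv_continuous _ _ _ HY')].
    + exact Hleft.
    + apply lim_from_nC, Hkap.
    + exact Hright.
    + exists (S (v ^ 2)). split; [exact HSv|]. split.
      * cbn [coordC]. rewrite Hc. exact HY'.
      * intros xi y E Hy. exfalso. apply Hy. apply (f_equal y_coordC) in E. cbn [y_coordC] in E. congruence.
    + exact HWd.
    + intros Hn. contradiction.
    + intros HPv. assert (HX0 : X v <> 0) by (intros E; apply (proj2 HPv (Y v)); rewrite E; reflexivity).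
      split; [apply (cderiv_inv X v _ HX0 HX)|].
      exists (S (v ^ 2)). split; [exact HSv|]. cbn [fcov coordE]. rewrite Hc. exact HY'.
  - apply (chart_at_regular _ _ _ X Y v (2 * v)).
    + apply filter_forall. reflexivity.
    + unfold Y. apply Cmult_neq_0; assumption.
    + apply (cderiv_continuous _ _ _ HY).
    + exact HonC.
    + exact HX.
    + apply Cmult_neq_0; [|exact Hv0]. intros E. apply RtoC_inj in E. lra.
    + intros [|]; unfold form, omega1, omega2, Y; field; auto.
    + exact HWd.
    + exact Hleft.
    + exact Hkap.
    + exact Hright.
Qed.

Lemma chart_inf (b : bool) :
  exists (chi : C -> Cpt) (kappa : Cpt -> C) (W : bool -> C -> C),
    chi 0 = Cinf b /\ nbhd_plane 0 (chart_at chi kappa W).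
Proof.
  set (s := slope_at_infinity b). assert (Hs : s <> 0) by apply slope_neq_0.
  set (S := fun v : C => branch s (polyC_inf (v ^ 2))).
  set (chi := fun v : C => if Ceq_dec v 0 then Cinf b else Caff (/ v) (S v / v ^ 3)).
  assert (Hchi : forall v : C, v <> 0 -> chi v = Caff (/ v) (S v / v ^ 3))
    by (intros v Hv; unfold chi; destruct Ceq_dec; [contradiction|reflexivity]).
  assert (Hchi0 : chi 0 = Cinf b) by (unfold chi; destruct Ceq_dec; [reflexivity|congruence]).
  (* From [xi = 1 / v] and [y = S v / v ^ 3], the two forms are [- v / S v dv] and [- 1 / S v dv],
     hence regular at infinity. *)
  exists chi, inv_xi, (fun (k : bool) v => (if k then - (1) else - v) / S v).
  split; [exact Hchi0|].
  set (D := fun u => (0 < Re (polyC_inf u / s ^ 2))%R).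
  assert (HD : nbhd_plane 0 (fun v => D (v ^ 2))).
  { apply clim_div_Re with (polyC_inf (0 ^ 2)); [typeclasses eauto|apply Cpow2_neq_0, Hs| |].
    - replace (0 ^ 2) with (RtoC 0) by ring. apply polyC_inf_0_Re.
    - apply polyC_inf_lim; [typeclasses eauto|apply clim_pow, clim_id]. }
  generalize (filter_and _ _ HD (nbhd_plane_open _ _ HD)). apply filter_imp. intros v [Hv Hvn].
  assert (HSv : S v <> 0) by (apply branch_neq_0; assumption).
  assert (HSd : exists d, cderiv S v d).
  { destruct (polyC_inf_cderiv _ v _ (sqr_cderiv v)) as [d Hd]. apply (branch_comp_cderiv s _ v d Hs Hv Hd). }
  destruct HSd as [dS HSd].
  assert (HonC : nbhd_plane v (fun w => onC t t' (chi w))).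
  { revert Hvn. apply filter_imp. intros w Hw. destruct (Ceq_dec w 0) as [->|Hw0]; [rewrite Hchi0; exact I|].
    rewrite Hchi by exact Hw0. apply onC_polyC.
    rewrite polyC_inf_spec by (apply Cinv_neq_0, Hw0).
    replace (/ (/ w) ^ 2) with (w ^ 2) by (field; exact Hw0).
    rewrite <- (branch_sqr s _ Hs Hw). fold (S w). field. exact Hw0. }
  assert (Hright0 : forall xi y, onC t t' (Caff xi y) -> xi <> 0 -> D ((/ xi) ^ 2) ->
     (0 < Re (y / xi ^ 3 / s))%R -> chi (inv_xi (Caff xi y)) = Caff xi y).
  { intros xi y K0 Hxi K1 K2. cbn [inv_xi]. rewrite Hchi by (apply Cinv_neq_0, Hxi).
    assert (E : S (/ xi) = y / xi ^ 3).
    { apply branch_unique; [exact Hs|exact K1| |exact K2].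
      change (y ^ 2 = polyC xi) in K0. rewrite polyC_inf_spec in K0 by exact Hxi.
      replace ((y / xi ^ 3) ^ 2) with (y ^ 2 / xi ^ 6) by (field; exact Hxi). rewrite K0.
      replace ((/ xi) ^ 2) with (/ xi ^ 2) by (field; exact Hxi). field. exact Hxi. }
    rewrite E. f_equal; field; exact Hxi. }
  assert (HWd : forall k : bool, exists d, cderiv (fun v => (if k then - (1) else - v) / S v) v d).
  { destruct (cderiv_inv S v dS HSv HSd) as [d Hd]. intros [|]; eexists.
    - apply (cderiv_mult (fun _ => - (1)) (fun v => / S v)); [apply cderiv_const|exact Hd].
    - apply (cderiv_mult (fun v => - v) (fun v => / S v)); [apply (cderiv_opp (fun v => v)), cderiv_id|exact Hd]. }
  destruct (Ceq_dec v 0) as [Ev|Hv0].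
  - subst v. assert (HS0 : S 0 = s).
    { unfold S. replace (0 ^ 2) with (RtoC 0) by ring. rewrite (polyC_inf_0 b). apply branch_self, Hs. }
    assert (HE : nbhdC (chi 0) (fun P => D (inv_xi P ^ 2) /\ (0 < Re (slope_coord P / s))%R /\
       (P = Cinf b \/ exists xi y, P = Caff xi y /\ xi <> 0))).
    { rewrite Hchi0. apply filter_and; [|apply filter_and; [|apply nbhdC_inf]].
      - apply clim_div_Re with (polyC_inf (0 ^ 2)); [typeclasses eauto|apply Cpow2_neq_0, Hs|exact Hv|].
        apply polyC_inf_lim; [typeclasses eauto|apply clim_pow, inv_xi_lim].
      - apply clim_div_Re with s; [typeclasses eauto|exact Hs|apply Re_div_self, Hs|apply slope_coord_lim]. }
    constructor.
    + apply lim_nC_of; [typeclasses eauto| |exact HonC]. rewrite Hchi0.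
      apply (lim_Cinf _ b (fun w => w) S).
      * apply clim_id.
      * fold s. rewrite <- HS0. apply (cderiv_continuous _ _ _ HSd).
      * apply filter_forall. intros w. destruct (Ceq_dec w 0) as [->|Hw]; [left; exact Hchi0|right].
        exists (/ w), (S w / w ^ 3). split; [apply Hchi, Hw|]. split; [apply Cinv_neq_0, Hw|].
        split; field; exact Hw.
    + rewrite Hchi0. reflexivity.
    + apply lim_from_nC. rewrite Hchi0. apply inv_xi_lim.
    + generalize (filter_and _ _ (nC_onC (chi 0)) (nC_of_nbhd _ _ HE)). apply filter_imp.
      intros P (K0 & K1 & K2 & [E|(xi & y & E & Hxi)]); rewrite E; [exact Hchi0|].
      rewrite E in K0, K1, K2. apply Hright0; assumption.
    + exists 1. split; [intros E; apply RtoC_inj in E; lra|]. split.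
      * rewrite Hchi0. cbn [coordC]. apply (cderiv_ext (fun w => w)); [|apply cderiv_id].
        apply filter_forall. intros w. destruct (Ceq_dec w 0) as [->|Hw]; [rewrite Hchi0; reflexivity|].
        rewrite Hchi by exact Hw. cbn [inv_xi]. field. exact Hw.
      * intros xi y E. rewrite Hchi0 in E. discriminate.
    + exact HWd.
    + intros Hn. contradiction.
    + intros _. split.
      * exists 1. apply (cderiv_ext (fun w => w)); [|apply cderiv_id].
        apply filter_forall. intros w. destruct (Ceq_dec w 0) as [->|Hw]; [rewrite Hchi0; reflexivity|].
        rewrite Hchi by exact Hw. cbn [inv_xi]. field. exact Hw.
      (* The coordinate [x / y] of E is [w * (t' * w ^ 2 - 1) / S w], with derivative [- 1 / S 0] at
         0. *)
      * assert (HF : exists d, cderiv (fun w => (t' * w ^ 2 - 1) * / S w) 0 d).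
        { destruct (cderiv_inv S 0 dS HSv HSd) as [d Hd]. eexists.
          apply (cderiv_mult (fun w => t' * w ^ 2 - 1) (fun w => / S w)); [|exact Hd].
          apply (cderiv_minus (fun w => t' * w ^ 2)); [apply cderiv_scal, sqr_cderiv|apply cderiv_const]. }
        destruct HF as [d HF]. exists (- / S 0). split.
        { intros E. apply (Cinv_neq_0 (S 0) HSv). replace (/ S 0) with (- - / S 0) by ring. rewrite E. ring. }
        rewrite Hchi0. cbn [fcov coordE].
        assert (HG := cderiv_mult _ _ _ _ _ (cderiv_id 0) HF).
        apply (cderiv_ext (fun x => x * ((t' * x ^ 2 - 1) * / S x))).
        -- assert (HSn : nbhd_plane 0 (fun w => S w <> 0)) by (apply clim_neq_0 with (S 0); [exact HSv|apply (cderiv_continuous _ _ _ HSd)]).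
           revert HSn. apply filter_imp. intros w HSw. destruct (Ceq_dec w 0) as [->|Hw].
           ++ rewrite Hchi0. cbn [fcov]. ring.
           ++ rewrite Hchi by exact Hw. cbn [fcov]. field. auto.
        -- apply (cderiv_eq _ _ _ _ HG). field. exact HSv.
  - apply (chart_at_regular _ _ _ (fun w => / w) (fun w => S w / w ^ 3) v (- / (v * v))).
    + assert (Hn : nbhd_plane v (fun w => w <> 0)) by (apply clim_neq_0 with v; [exact Hv0|apply clim_id]).
      revert Hn. apply filter_imp. exact Hchi.
    + apply Cdiv_neq_0; [exact HSv|apply Cpow_nz, Hv0].
    + apply (clim_div S (fun w => w ^ 3)); [apply Cpow_nz, Hv0|apply (cderiv_continuous _ _ _ HSd)|apply clim_pow, clim_id].
    + exact HonC.
    + apply cderiv_inv_id, Hv0.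
    + intros E. apply (Cinv_neq_0 (v * v)); [apply Cmult_neq_0; exact Hv0|].
      replace (/ (v * v)) with (- - / (v * v)) by ring. rewrite E. ring.
    + intros [|]; unfold form, omega1, omega2; field; auto.
    + exact HWd.
    + rewrite Hchi by exact Hv0. cbn [inv_xi]. field. exact Hv0.
    + rewrite Hchi by exact Hv0. replace (nbhd_plane v) with (nbhd_plane (/ / v)) by (f_equal; field; exact Hv0).
      apply (clim_ext (fun P => / xi_coord P)).
      * generalize (nbhdC_affine (/ v) (S v / v ^ 3)). apply filter_imp. intros P E. rewrite E. reflexivity.
      * apply clim_inv; [apply Cinv_neq_0, Hv0|apply xi_coord_lim].
    + rewrite Hchi by exact Hv0. set (xi0 := / v). set (y0 := S v / v ^ 3).
      assert (Hxi0 : xi0 <> 0) by apply Cinv_neq_0, Hv0.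
      assert (Lx := xi_coord_lim xi0 y0). assert (Ly := y_coordC_lim xi0 y0).
      assert (R0 : nbhdC (Caff xi0 y0) (fun P => xi_coord P <> 0)) by (apply clim_neq_0 with xi0; assumption).
      assert (R1 : nbhdC (Caff xi0 y0) (fun P => D ((/ xi_coord P) ^ 2))).
      { apply clim_div_Re with (polyC_inf ((/ xi0) ^ 2)); [typeclasses eauto|apply Cpow2_neq_0, Hs| |].
        - replace (/ xi0) with v by (unfold xi0; field; exact Hv0). exact Hv.
        - apply polyC_inf_lim; [typeclasses eauto|]. apply clim_pow, clim_inv; assumption. }
      assert (R2 : nbhdC (Caff xi0 y0) (fun P => (0 < Re (y_coordC P / xi_coord P ^ 3 / s))%R)).
      { apply clim_div_Re with (S v); [typeclasses eauto|exact Hs|apply branch_Re; assumption|].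
        replace (S v) with (y0 / xi0 ^ 3) by (unfold y0, xi0; field; exact Hv0).
        apply clim_div; [apply Cpow_nz, Hxi0|exact Ly|apply clim_pow, Lx]. }
      generalize (filter_and _ _ (nC_onC (Caff xi0 y0))
        (nC_of_nbhd _ _ (filter_and _ _ (nbhdC_affine _ _) (filter_and _ _ R0 (filter_and _ _ R1 R2))))).
      apply filter_imp. intros P (K0 & E & K1 & K2 & K3). rewrite E in K0. rewrite E.
      apply Hright0; assumption.
Qed.

Lemma chart_exists (P : Cpt) : onC t t' P ->
  exists (chi : C -> Cpt) (kappa : Cpt -> C) (W : bool -> C -> C),
    chi 0 = P /\ nbhd_plane 0 (chart_at chi kappa W).
Proof.
  destruct P as [xi y|b]; intros HP; [|apply chart_inf].
  destruct (Ceq_dec y 0) as [->|Hy]; [apply chart_y_eq_0, HP|apply chart_y_neq_0; assumption].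
Qed.

(** * Primitives *)

Lemma derivC_iff (h : Cpt -> C) (P : Cpt) (d : C) :
  derivC t t' h P d <->
  filterlim (fun P' => (h P' - h P) / (coordC P P' - coordC P P))
    (within (fun P' => P' <> P) (nC P)) (nbhd_plane d).
Proof.
  split; intros H A HA; generalize (H A HA); unfold nC, filtermap, within; apply filter_imp; tauto.
Qed.

Lemma derivE_iff (h : Ept -> C) (Q : Ept) (d : C) :
  derivE t h Q d <->
  filterlim (fun P' => (h P' - h Q) / (coordE Q P' - coordE Q Q))
    (within (fun P' => P' <> Q) (nE Q)) (nbhd_plane d).
Proof.
  split; intros H A HA; generalize (H A HA); unfold nE, filtermap, within; apply filter_imp; tauto.
Qed.

Lemma primitive_nearP (w : C -> C -> C) (u : Cpt -> C) (P : Cpt) :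
  primitive_near t t' w u P <-> nC P (fun P' => (exists d, derivC t t' u P' d) /\
    forall xi y, P' = Caff xi y -> y <> 0 -> derivC t t' u P' (w xi y)).
Proof. reflexivity. Qed.

Section OneChart.
Variables (chi : C -> Cpt) (kappa : Cpt -> C) (W : bool -> C -> C).
Hypothesis Hchart : nbhd_plane 0 (chart_at chi kappa W).

Lemma chart_push (A : Cpt -> Prop) : nC (chi 0) A -> nbhd_plane 0 (fun v => A (chi v)).
Proof. apply (ch_cont (nbhd_plane_self _ _ Hchart)). Qed.

Lemma chart_pull (A : Cpt -> Prop) : nbhd_plane 0 (fun v => A (chi v)) -> nC (chi 0) A.
Proof.
  intros H. assert (C0 := nbhd_plane_self _ _ Hchart).
  assert (K := ch_kappa C0 _ H). unfold filtermap in K.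
  generalize (filter_and _ _ K (ch_right C0)). apply filter_imp.
  intros P [K1 K2]. rewrite K2 in K1. exact K1.
Qed.

(** With the next lemma, this moves derivatives between the curve and the chart. The same factor [J]
    converts the coefficients of the forms, so that [du = w dxi] becomes an equation between [u']
    and [W] in the chart. *)
Lemma chart_derivC_elim (h : Cpt -> C) : nbhd_plane 0 (fun v => forall d, derivC t t' h (chi v) d ->
  exists J : C, J <> 0 /\ cderiv (fun w => h (chi w)) v (d * J) /\
    forall xi y, chi v = Caff xi y -> y <> 0 -> forall k, W k v = form k xi y * J).
Proof.
  generalize (filter_and _ _ Hchart (nbhd_plane_open _ _ Hchart)). apply filter_imp. intros v [Hv Hvn] d Hd.
  destruct (ch_coord Hv) as [J [HJ [HJ1 HJ2]]]. exists J. split; [exact HJ|]. split; [|exact HJ2].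
  apply (cderiv_of_quotient (nC (chi v)) (chi v) chi (coordC (chi v)) h v d J); auto.
  - apply (ch_cont Hv).
  - revert Hvn. apply filter_imp. intros w Hw E. rewrite <- (ch_left Hw), E. apply (ch_left Hv).
  - apply derivC_iff, Hd.
Qed.

Lemma chart_derivC_intro (h : Cpt -> C) : nbhd_plane 0 (fun v => forall a, cderiv (fun w => h (chi w)) v a ->
  exists J : C, J <> 0 /\ derivC t t' h (chi v) (a / J) /\
    forall xi y, chi v = Caff xi y -> y <> 0 -> forall k, W k v = form k xi y * J).
Proof.
  revert Hchart. apply filter_imp. intros v Hv a Ha.
  destruct (ch_coord Hv) as [J [HJ [HJ1 HJ2]]]. exists J. split; [exact HJ|]. split; [|exact HJ2].
  apply derivC_iff. apply (quotient_of_cderiv (nC (chi v)) (chi v) chi kappa (coordC (chi v)) h v a J); auto.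
  - apply (ch_kappa Hv).
  - apply (ch_right Hv).
Qed.

(** The equation is prescribed at points with [y <> 0] only, hence the restriction to [v <> 0]; at
    the centre differentiability remains. *)
Lemma chart_primitive (k : bool) (u : Cpt -> C) : primitive_near t t' (form k) u (chi 0) ->
  nbhd_plane 0 (fun v => (exists d, cderiv (fun w => u (chi w)) v d) /\
    (v <> 0 -> cderiv (fun w => u (chi w)) v (W k v))).
Proof.
  intros H. generalize (filter_and _ _ (chart_push _ H) (filter_and _ _ Hchart (chart_derivC_elim u))).
  apply filter_imp. intros v ([[d Hd] H2] & Hv & He). split.
  - destruct (He d Hd) as [J [_ [K _]]]. eexists. exact K.
  - intros Hv0. destruct (ch_regular Hv Hv0) as (xi & y & E & Hy).
    destruct (He _ (H2 xi y E Hy)) as [J [_ [K1 K2]]]. rewrite (K2 xi y E Hy). exact K1.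
Qed.

Lemma primitive_of_chart (k : bool) (F : C -> C) : nbhd_plane 0 (fun v => cderiv F v (W k v)) ->
  primitive_near t t' (form k) (fun P => F (kappa P)) (chi 0).
Proof.
  intros H. apply (chart_pull (fun P' => (exists d, derivC t t' (fun P => F (kappa P)) P' d) /\ forall xi y, P' = Caff xi y -> y <> 0 ->
     derivC t t' (fun P => F (kappa P)) P' (form k xi y))).
  generalize (filter_and _ _ H (filter_and _ _ (nbhd_plane_open _ _ Hchart) (chart_derivC_intro (fun P => F (kappa P))))).
  apply filter_imp. intros v (H1 & H2 & H3).
  destruct (H3 (W k v)) as [J [HJ [K1 K2]]].
  - revert H1. apply cderiv_ext. revert H2. apply filter_imp. intros w Hw. rewrite (ch_left Hw). reflexivity.
  - split; [eexists; exact K1|]. intros xi y E Hy. rewrite (K2 xi y E Hy) in K1.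
    replace (form k xi y * J / J) with (form k xi y) in K1 by (field; exact HJ). exact K1.
Qed.
End OneChart.

Lemma primitive_near_exists (k : bool) (P : Cpt) : onC t t' P -> exists u, primitive_near t t' (form k) u P.
Proof.
  intros HP. destruct (chart_exists P HP) as (chi & kappa & W & E & Hch). subst P.
  destruct (primitive_exists (W k)) as [F HF].
  - revert Hch. apply filter_imp. intros v Hv. apply (ch_holo Hv).
  - exists (fun P => F (kappa P)). apply (primitive_of_chart chi kappa W Hch k F HF).
Qed.

(** In a chart the difference has derivative 0 off the centre and is continuous at the centre, as
    [locally_constant] requires. *)
Lemma primitive_near_unique (k : bool) (P : Cpt) (u u' : Cpt -> C) : onC t t' P ->
  primitive_near t t' (form k) u P -> primitive_near t t' (form k) u' P ->
  exists c, nC P (fun P' => u' P' = u P' + c).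
Proof.
  intros HP Hu Hu'. destruct (chart_exists P HP) as (chi & kappa & W & E & Hch). subst P.
  assert (K1 := chart_primitive chi kappa W Hch k u Hu). assert (K2 := chart_primitive chi kappa W Hch k u' Hu').
  exists (u' (chi 0) - u (chi 0)). apply (chart_pull chi kappa W Hch).
  assert (K : nbhd_plane 0 (fun v => u' (chi v) - u (chi v) = u' (chi 0) - u (chi 0))).
  { apply (locally_constant (fun v => u' (chi v) - u (chi v))).
    - destruct (nbhd_plane_self _ _ K1) as [[d1 D1] _]. destruct (nbhd_plane_self _ _ K2) as [[d2 D2] _].
      apply clim_minus; eapply cderiv_continuous; eassumption.
    - generalize (filter_and _ _ K1 K2). apply filter_imp. intros v [[_ H1] [_ H2]] Hv.
      apply cderiv_eq with (W k v - W k v); [|ring]. apply cderiv_minus; auto. }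
  revert K. apply filter_imp. intros v Hv. rewrite <- Hv. ring.
Qed.

Lemma primitive_near_ext (w : C -> C -> C) (P : Cpt) (u u' : Cpt -> C) :
  nC P (fun P' => u P' = u' P') -> primitive_near t t' w u P -> primitive_near t t' w u' P.
Proof.
  intros H Hu. apply (proj1 (primitive_nearP _ _ _)) in Hu. apply (proj2 (primitive_nearP _ _ _)).
  assert (K : nC P (fun P' => forall d, derivC t t' u P' d -> derivC t t' u' P' d)).
  { generalize (filter_and _ _ (nC_onC P) (nC_open _ _ H)). apply filter_imp. intros P' [HP' H'] d Hd.
    apply derivC_iff in Hd. apply derivC_iff. revert Hd. apply filterlim_ext_loc.
    assert (E := nC_self P' _ HP' H'). unfold within. revert H'. apply filter_imp.
    intros P'' E'' _. rewrite E, E''. reflexivity. }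
  generalize (filter_and _ _ K Hu). apply filter_imp. intros P' [K1 [[d Hd] H2]]. split; [eauto|]. eauto.
Qed.

Lemma primitive_near_open (w : C -> C -> C) (P : Cpt) (u : Cpt -> C) :
  primitive_near t t' w u P -> nC P (fun P' => primitive_near t t' w u P').
Proof. apply nC_open. Qed.

Lemma primitive_near_plus (w : C -> C -> C) (P : Cpt) (u : Cpt -> C) (c : C) :
  primitive_near t t' w u P -> primitive_near t t' w (fun P' => u P' + c) P.
Proof.
  assert (K : forall P' d, derivC t t' u P' d -> derivC t t' (fun P' => u P' + c) P' d).
  { intros P' d. apply filterlim_ext. intros P''. f_equal. ring. }
  intros H. apply (proj1 (primitive_nearP _ _ _)) in H. apply (proj2 (primitive_nearP _ _ _)). revert H. apply filter_imp.
  intros P' [[d Hd] H2]. split; eauto.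
Qed.

(** The eigenvalue of [form k] under pull-back by [deck]. *)
Definition eta (k : bool) : C := if k then 1 else - (1).

Lemma Cinv_opp (z : C) : / - z = - / z.
Proof.
  destruct z as [x y]. unfold Cinv, Copp. simpl.
  replace (- x * (- x * 1) + - y * (- y * 1))%R with (x * (x * 1) + y * (y * 1))%R by ring.
  unfold Rdiv. f_equal; ring.
Qed.

(** [deck] keeps [y], the coordinate at points with [y = 0], and changes the sign of [xi] and
    [1 / xi], the coordinates elsewhere. *)
Lemma coordC_deck (P : Cpt) : exists e : C, (e = 1 \/ e = - (1)) /\
  (forall P', coordC (deck P) (deck P') = e * coordC P P') /\
  (forall xi y, P = Caff xi y -> y <> 0 -> e = - (1)).
Proof.
  destruct P as [xi y|b].
  - destruct (Ceq_dec y 0) as [Hy|Hy].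
    + exists 1. split; [auto|]. split; [|intros xi' y' E Hy'; apply (f_equal y_coordC) in E; cbn [y_coordC] in E; congruence].
      intros P'. cbn [deck coordC]. destruct (Ceq_dec y 0); [|contradiction].
      destruct P' as [x' y'|b']; cbn [deck]; ring.
    + exists (- (1)). split; [auto|]. split; [|auto]. intros P'. cbn [deck coordC].
      destruct (Ceq_dec y 0); [contradiction|]. destruct P'; cbn [deck xi_coord]; ring.
  - exists (- (1)). split; [auto|]. split; [|discriminate]. intros P'. cbn [deck coordC].
    destruct P' as [x' y'|b']; cbn [deck inv_xi]; [rewrite Cinv_opp|]; ring.
Qed.

Lemma nC_deck_image (P : Cpt) (A : Cpt -> Prop) : nC P (fun P' => A (deck P')) -> nC (deck P) A.
Proof.
  intros H. assert (K := deck_nC (deck P)). rewrite deck_deck in K. assert (K1 := K _ H).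
  unfold filtermap in K1. revert K1. apply filter_imp. intros P'. rewrite deck_deck. auto.
Qed.

Lemma derivC_deck (u : Cpt -> C) (P : Cpt) (d e c : C) : e = 1 \/ e = - (1) ->
  (forall P', coordC (deck P) (deck P') = e * coordC P P') -> derivC t t' u P d ->
  derivC t t' (fun P' => c * u (deck P')) (deck P) (c * e * d).
Proof.
  intros He Hc Hd. apply derivC_iff in Hd. apply derivC_iff.
  assert (Hs : filterlim deck (within (fun P' => P' <> deck P) (nC (deck P))) (within (fun P' => P' <> P) (nC P))).
  { intros A HA. unfold filtermap, within in *. apply nC_deck_image. revert HA. apply filter_imp.
    intros P' H Hn. rewrite deck_deck. apply H. intros E. apply Hn. rewrite E. reflexivity. }
  assert (L := filterlim_comp _ _ _ _ _ _ _ _ Hs Hd).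
  assert (L2 := clim_mult _ _ _ _ (clim_const (F := within (fun P' => P' <> deck P) (nC (deck P))) (c * e)) L).
  revert L2. apply filterlim_ext.
  intros P'. assert (Hc' := Hc (deck P')). rewrite deck_deck in Hc'.
  rewrite Hc', Hc, deck_deck. unfold Cdiv.
  destruct He as [-> | ->].
  - replace (1 * coordC P (deck P') - 1 * coordC P P) with (coordC P (deck P') - coordC P P) by ring. ring.
  - replace (- (1) * coordC P (deck P') - - (1) * coordC P P) with (- (coordC P (deck P') - coordC P P)) by ring.
    rewrite Cinv_opp. ring.
Qed.

Lemma form_deck (k : bool) (xi y : C) : eta k * - (1) * form k xi y = form k (- xi) y.
Proof. destruct k; unfold eta, form, omega1, omega2, Cdiv; ring. Qed.

Lemma primitive_near_deck (k : bool) (P : Cpt) (u : Cpt -> C) :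
  primitive_near t t' (form k) u P -> primitive_near t t' (form k) (fun P' => eta k * u (deck P')) (deck P).
Proof.
  intros H. apply (proj1 (primitive_nearP _ _ _)) in H. apply (proj2 (primitive_nearP _ _ _)). apply nC_deck_image. revert H. apply filter_imp.
  intros P' [[d Hd] H2]. destruct (coordC_deck P') as (e & He & Hc & Hy). split.
  - eexists. apply (derivC_deck u P' d e (eta k) He Hc Hd).
  - intros xi y E Hy0. assert (E' : P' = Caff (- xi) y) by (rewrite <- (deck_deck P'), E; reflexivity).
    specialize (H2 _ _ E' Hy0). assert (K := derivC_deck u P' _ e (eta k) He Hc H2).
    rewrite (Hy _ _ E' Hy0), form_deck in K. replace (- - xi) with xi in K by ring. exact K.
Qed.

Definition germ (P : Cpt) (u u' : Cpt -> C) : Prop := nC P (fun P' => u P' = u' P').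

Lemma germ_refl P u : germ P u u.
Proof. unfold germ. apply filter_forall. reflexivity. Qed.
Lemma germ_sym P u u' : germ P u u' -> germ P u' u.
Proof. unfold germ. apply filter_imp. auto. Qed.
Lemma germ_trans P u u' u'' : germ P u u' -> germ P u' u'' -> germ P u u''.
Proof.
  intros H1 H2. unfold germ in *. generalize (filter_and _ _ H1 H2). apply filter_imp.
  intros P' [E1 E2]. congruence.
Qed.
Lemma germ_open P u u' : germ P u u' -> nC P (fun P' => germ P' u u').
Proof. apply nC_open. Qed.

(** A function on all of [Cpt] represents its germ at every point, so a local section of the
    covering by germs is a constant map; hence [tau] takes the same value at all points. *)
Definition primitive_germ (k : bool) (P : Cpt) (tau : Cpt -> Cpt -> C) : Prop :=
  onC t t' P /\ exists u, primitive_near t t' (form k) u P /\ forall P', tau P' = u.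

(** Constants of integration act as deck transformations. Two primitives near [P] differ by one
    constant at all nearby points, and their germs agree exactly when it is 0. *)
Lemma covering_C (k : bool) : is_covering nC (onC t t') germ (primitive_germ k)
  (fun (c : C) u => fun P => u P + c).
Proof.
  constructor.
  - apply germ_sym.
  - apply germ_trans.
  - intros P HP. destruct (primitive_near_exists k P HP) as [u Hu]. exists (fun _ => u). split; [exact HP|].
    exists u. auto.
  - intros P tau [HP [u [Hu Htau]]].
    generalize (filter_and _ _ (nC_onC P) (primitive_near_open _ _ _ Hu)). apply filter_imp.
    intros P' [H1 H2]. split; [exact H1|]. exists u. auto.
  - intros. apply germ_refl.
  - intros P tau tau' [HP [u [Hu Htau]]] [_ [u' [Hu' Htau']]].
    destruct (primitive_near_unique k P u u' HP Hu Hu') as [c Hc].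
    assert (K : forall P', nC P' (fun P'' => u' P'' = u P'' + c) -> onC t t' P' -> (germ P' u u' <-> c = 0)).
    { intros P' H HP'. split.
      - intros E. assert (E1 := nC_self P' _ HP' E). assert (E2 := nC_self P' _ HP' H). cbv beta in E1, E2.
        replace c with (u P' + c - u P') by ring. rewrite <- E2, E1. ring.
      - intros ->. unfold germ. revert H. apply filter_imp. intros P'' ->. ring. }
    generalize (filter_and _ _ (nC_onC P) (nC_open _ _ Hc)). apply filter_imp.
    intros P' [H1 H2]. rewrite !Htau, !Htau'. rewrite (K P' H2 H1), (K P Hc HP). tauto.
  - intros P c tau [HP [u [Hu Htau]]]. split; [exact HP|]. exists (fun P' => u P' + c).
    split; [apply primitive_near_plus, Hu|]. intros P'. rewrite Htau. reflexivity.
  - intros P c u u'. unfold germ. apply filter_imp. intros P' ->. reflexivity.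
  - intros P tau tau' HP [_ [u [Hu Htau]]] [_ [u' [Hu' Htau']]].
    destruct (primitive_near_unique k P u u' HP Hu Hu') as [c Hc]. exists c. rewrite Htau, Htau'.
    unfold germ. revert Hc. apply filter_imp. auto.
Qed.

(** * Continuation along paths *)

Definition in_E {U : UniformSpace} := @maps_on Ept nE (puncturedE t t') U.
Definition in_C {U : UniformSpace} := @maps_on Cpt nC (onC t t') U.
Definition lifts {U : UniformSpace} :=
  @family Ept Cpt (fun _ P P' => P = P') (section_near) U.
Definition primitives (k : bool) {U : UniformSpace} :=
  @family Cpt (Cpt -> C) germ (primitive_germ k) U.

Lemma lifts_section {U : UniformSpace} (A : U -> Prop) (H : U -> Ept) (c : U -> Cpt) (p : U) :
  lifts A H c -> A p -> fcov t' (c p) = H p /\ puncturedC t t' (c p).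
Proof.
  intros Hc Ap. destruct (Hc p Ap) as [tau [Ht Hdt]].
  assert (E : c p = tau (H p)) by exact (locally_singleton p _ Hdt Ap).
  destruct (section_self _ _ Ht) as (_ & E2 & E3). rewrite E. auto.
Qed.

Lemma lifts_in_C {U : UniformSpace} (A : U -> Prop) (H : U -> Ept) (c : U -> Cpt) :
  in_E A H -> lifts A H c -> in_C A c.
Proof.
  intros HH Hc p Ap. split; [apply (lifts_section A H c p Hc Ap)|].
  destruct (Hc p Ap) as [tau [Ht Hdt]].
  assert (E : c p = tau (H p)) by exact (locally_singleton p _ Hdt Ap).
  destruct (section_self _ _ Ht) as (L & _ & _). rewrite E.
  assert (K := filterlim_comp _ _ _ _ _ _ _ _ (proj2 (HH p Ap)) L). revert K.
  apply filterlim_ext_loc. revert Hdt. apply filter_imp. auto.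
Qed.

Lemma in_C_fcov (c : R -> Cpt) : in_C I01 c -> (forall r, I01 r -> puncturedC t t' (c r)) ->
  in_E I01 (fun r => fcov t' (c r)).
Proof.
  intros Hc HP r Hr. split; [apply punctured_fcov, HP, Hr|].
  eapply filterlim_comp; [apply Hc, Hr|apply fcov_continuous].
Qed.

Lemma lifts_fcov (c : R -> Cpt) : in_C I01 c -> (forall r, I01 r -> puncturedC t t' (c r)) ->
  lifts I01 (fun r => fcov t' (c r)) c.
Proof.
  intros Hc HP r Hr. exists (lift (c r)). split; [apply lift_near, HP, Hr|].
  assert (K := proj2 (Hc r Hr) _ (lift_retract _ (HP r Hr))). unfold filtermap in K.
  revert K. apply filter_imp. auto.
Qed.

Lemma primitives_spec (k : bool) {U : UniformSpace} (A : U -> Prop) (c : U -> Cpt) (V : U -> Cpt -> C) (p : U) :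
  primitives k A c V -> A p -> primitive_near t t' (form k) (V p) (c p).
Proof.
  intros HV Ap. destruct (HV p Ap) as [tau [[HP [u [Hu Htau]]] Hdt]].
  assert (E : germ (c p) (V p) u) by (rewrite <- (Htau (c p)); exact (locally_singleton p _ Hdt Ap)).
  revert Hu. apply primitive_near_ext, germ_sym, E.
Qed.

Lemma primitives_local (k : bool) {U : UniformSpace} (A : U -> Prop) (c : U -> Cpt) (V : U -> Cpt -> C) (p : U) :
  in_C A c -> primitives k A c V -> A p -> within A (locally p) (fun q => germ (c q) (V q) (V p)).
Proof.
  intros Hc HV Ap. destruct (HV p Ap) as [tau [[HP [u [Hu Htau]]] Hdt]].
  assert (E : germ (c p) (V p) u) by (rewrite <- (Htau (c p)); exact (locally_singleton p _ Hdt Ap)).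
  assert (K := proj2 (Hc p Ap) _ (germ_open _ _ _ (germ_sym _ _ _ E))). unfold filtermap in K.
  generalize (filter_and _ _ Hdt K). apply filter_imp. intros q [H1 H2]. rewrite Htau in H1.
  apply germ_trans with u; assumption.
Qed.

Lemma primitives_deck (k : bool) {U : UniformSpace} (A : U -> Prop) (c : U -> Cpt) (V : U -> Cpt -> C) :
  primitives k A c V -> primitives k A (fun p => deck (c p)) (fun p P => eta k * V p (deck P)).
Proof.
  intros HV p Ap. destruct (HV p Ap) as [tau [[HP [u [Hu Htau]]] Hdt]].
  exists (fun _ P => eta k * u (deck P)). split.
  - split; [apply onC_deck, HP|]. exists (fun P => eta k * u (deck P)).
    split; [apply primitive_near_deck, Hu|reflexivity].
  - unfold within in *. revert Hdt. apply filter_imp. intros q H Aq. specialize (H Aq). rewrite Htau in H.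
    unfold germ in *. apply nC_deck_image. revert H. apply filter_imp. intros P E. rewrite deck_deck, E. reflexivity.
Qed.

Lemma germ_deck k P u u' : germ P u u' ->
  germ (deck P) (fun P => eta k * u (deck P)) (fun P => eta k * u' (deck P)).
Proof.
  unfold germ. intros H. apply nC_deck_image. revert H. apply filter_imp. intros P' E. rewrite deck_deck, E. reflexivity.
Qed.

Lemma germ_plus P u u' c : germ P u u' -> germ P (fun P => u P + c) (fun P => u' P + c).
Proof. unfold germ. apply filter_imp. intros P' ->. reflexivity. Qed.

Lemma primitives_plus (k : bool) {U : UniformSpace} (A : U -> Prop) (c : U -> Cpt) (V : U -> Cpt -> C) (x : C) :
  primitives k A c V -> primitives k A c (fun p P => V p P + x).
Proof. apply (family_act (covering_C k) A c V x). Qed.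

Lemma primitives_from (k : bool) (c : R -> Cpt) (u : Cpt -> C) : in_C I01 c ->
  primitive_near t t' (form k) u (c 0%R) ->
  exists V, primitives k I01 c V /\ germ (c 0%R) (V 0%R) u.
Proof.
  intros Hc Hu. destruct (family_path (covering_C k) c Hc) as [V HV].
  destruct (primitive_near_unique k (c 0%R) (V 0%R) u) as [x Hx].
  - apply (Hc 0%R I01_0).
  - apply (primitives_spec k I01 c V 0%R HV I01_0).
  - exact Hu.
  - exists (fun r P => V r P + x). split; [apply primitives_plus, HV|].
    apply germ_sym, Hx.
Qed.

Lemma lifts_deck {U : UniformSpace} (A : U -> Prop) (g : U -> Ept) (c : U -> Cpt) :
  lifts A g c -> lifts A g (fun p => deck (c p)).
Proof. apply (family_act covering_E A g c true). Qed.

Lemma lifts_from (g : R -> Ept) (P : Cpt) : in_E I01 g -> fcov t' P = g 0%R ->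
  exists c, lifts I01 g c /\ c 0%R = P.
Proof.
  intros Hg HP. destruct (family_path covering_E g Hg) as [c Hc].
  destruct (lifts_section I01 g c 0%R Hc I01_0) as [E _].
  destruct (fcov_fibre t' P (c 0%R)) as [E'|E']; [congruence| |].
  - exists c. auto.
  - exists (fun r => deck (c r)). split; [apply lifts_deck, Hc|auto].
Qed.

(** Continuation along [g], lifted to C, leads from the germ of the primitive
    [u0] at [P0] to that of [u1] at [P1]. *)
Definition continues (k : bool) (g : R -> Ept) (P0 : Cpt) (u0 : Cpt -> C) (P1 : Cpt) (u1 : Cpt -> C) : Prop :=
  exists c V, lifts I01 g c /\ primitives k I01 c V /\ c 0%R = P0 /\ c 1%R = P1 /\
    germ P0 (V 0%R) u0 /\ germ P1 (V 1%R) u1.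

Lemma continues_exists k g P0 u0 : in_E I01 g -> fcov t' P0 = g 0%R ->
  primitive_near t t' (form k) u0 P0 -> exists P1 u1, continues k g P0 u0 P1 u1 /\ fcov t' P1 = g 1%R.
Proof.
  intros Hg HP Hu. destruct (lifts_from g P0 Hg HP) as [c [Hc Ec]].
  rewrite <- Ec in Hu. destruct (primitives_from k c u0 (lifts_in_C _ _ _ Hg Hc) Hu) as [V [HV EV]].
  exists (c 1%R), (V 1%R). split.
  - exists c, V. rewrite Ec in EV. repeat split; auto. apply germ_refl.
  - apply (lifts_section I01 g c 1%R Hc I01_1).
Qed.

Lemma lifts_unique g c c' : in_E I01 g -> lifts I01 g c -> lifts I01 g c' -> c 0%R = c' 0%R ->
  forall r, I01 r -> c r = c' r.
Proof. intros Hg Hc Hc' E. apply (family_unique covering_E g c c' 0%R I01_0 Hg Hc Hc' E). Qed.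

Lemma primitives_curve_ext k (c c' : R -> Cpt) V : (forall r, I01 r -> c r = c' r) ->
  primitives k I01 c V -> primitives k I01 c' V.
Proof.
  intros E. apply (family_ext (covering_C k)); [exact E|]. intros. apply germ_refl.
Qed.

Lemma lifts_ext (g g' : R -> Ept) (c c' : R -> Cpt) :
  (forall r, I01 r -> g r = g' r) -> (forall r, I01 r -> c r = c' r) -> lifts I01 g c -> lifts I01 g' c'.
Proof. apply (family_ext covering_E). Qed.

Lemma continues_unique k g P0 u0 u0' P1 P1' u1 u1' : in_E I01 g ->
  continues k g P0 u0 P1 u1 -> continues k g P0 u0' P1' u1' -> germ P0 u0 u0' ->
  P1 = P1' /\ germ P1 u1 u1'.
Proof.
  intros Hg (c & V & Hc & HV & E0 & E1 & G0 & G1) (c' & V' & Hc' & HV' & E0' & E1' & G0' & G1') Hu.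
  assert (E : forall r, I01 r -> c r = c' r) by (apply (lifts_unique g); auto; congruence).
  assert (EP : P1 = P1') by (rewrite <- E1, <- E1'; apply E, I01_1). split; [exact EP|].
  assert (HV'' : primitives k I01 c V') by (revert HV'; apply primitives_curve_ext; intros; symmetry; auto).
  assert (K : germ (c 1%R) (V 1%R) (V' 1%R)).
  { apply (family_unique (covering_C k) c V V' 0%R I01_0 (lifts_in_C _ _ _ Hg Hc) HV HV''); [|apply I01_1].
    rewrite E0. apply germ_trans with u0; [exact G0|]. apply germ_trans with u0'; [exact Hu|apply germ_sym, G0']. }
  rewrite E1 in K. apply germ_trans with (V 1%R); [apply germ_sym, G1|].
  apply germ_trans with (V' 1%R); [exact K|]. rewrite EP. exact G1'.
Qed.

Lemma continues_germ k g P0 u0 u0' P1 u1 u1' : continues k g P0 u0 P1 u1 ->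
  germ P0 u0 u0' -> germ P1 u1 u1' -> continues k g P0 u0' P1 u1'.
Proof.
  intros (c & V & Hc & HV & E0 & E1 & G0 & G1) H0 H1. exists c, V. repeat split; auto; eapply germ_trans; eauto.
Qed.

Lemma continues_concat k g h P0 u0 P1 u1 P2 u2 : in_E I01 g -> in_E I01 h -> g 1%R = h 0%R ->
  continues k g P0 u0 P1 u1 -> continues k h P1 u1 P2 u2 -> continues k (concat g h) P0 u0 P2 u2.
Proof.
  intros Hg Hh E (c & V & Hc & HV & E0 & E1 & G0 & G1) (c' & V' & Hc' & HV' & E0' & E1' & G0' & G1').
  assert (C0 : forall (S : Type) (x y : R -> S), concat x y 0%R = x 0%R).
  { intros. rewrite concat_left by lra. f_equal. ring. }
  assert (C1 : forall (S : Type) (x y : R -> S), concat x y 1%R = y 1%R).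
  { intros. rewrite concat_right by lra. f_equal. ring. }
  exists (concat c c'), (concat V V'). rewrite !C0, !C1. repeat split; auto.
  - apply (family_concat covering_E g h c c' Hg Hh E Hc Hc'). congruence.
  - apply (family_concat (covering_C k) c c' V V' (lifts_in_C _ _ _ Hg Hc) (lifts_in_C _ _ _ Hh Hc')); auto; [congruence|].
    rewrite E1. apply germ_trans with u1; [exact G1|apply germ_sym, G0'].
Qed.

Lemma continues_reverse k g P0 u0 P1 u1 :
  continues k g P0 u0 P1 u1 -> continues k (reverse g) P1 u1 P0 u0.
Proof.
  intros (c & V & Hc & HV & E0 & E1 & G0 & G1).
  assert (R0 : forall (S : Type) (x : R -> S), reverse x 0%R = x 1%R) by (intros; unfold reverse; f_equal; ring).
  assert (R1 : forall (S : Type) (x : R -> S), reverse x 1%R = x 0%R) by (intros; unfold reverse; f_equal; ring).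
  exists (reverse c), (reverse V). rewrite !R0, !R1. repeat split; auto.
  - apply (family_reverse covering_E), Hc.
  - apply (family_reverse (covering_C k)), HV.
Qed.

Lemma continues_deck k g P0 u0 P1 u1 : continues k g P0 u0 P1 u1 ->
  continues k g (deck P0) (fun P => eta k * u0 (deck P)) (deck P1) (fun P => eta k * u1 (deck P)).
Proof.
  intros (c & V & Hc & HV & E0 & E1 & G0 & G1).
  exists (fun r => deck (c r)), (fun r P => eta k * V r (deck P)). rewrite E0, E1. repeat split; auto.
  - apply lifts_deck, Hc.
  - apply primitives_deck, HV.
  - apply germ_deck, G0.
  - apply germ_deck, G1.
Qed.

Lemma continues_plus k g P0 u0 P1 u1 x : continues k g P0 u0 P1 u1 ->
  continues k g P0 (fun P => u0 P + x) P1 (fun P => u1 P + x).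
Proof.
  intros (c & V & Hc & HV & E0 & E1 & G0 & G1).
  exists c, (fun r P => V r P + x). repeat split; auto.
  - apply primitives_plus, HV.
  - apply germ_plus, G0.
  - apply germ_plus, G1.
Qed.

Lemma continues_const k u : primitive_near t t' (form k) u (Cinf true) ->
  continues k (fun _ => Einf) (Cinf true) u (Cinf true) u.
Proof.
  intros Hu. exists (fun _ => Cinf true), (fun _ => u). repeat split; try apply germ_refl.
  - intros r Hr. exists (lift (Cinf true)). split; [apply lift_near_inf|]. apply filter_forall. reflexivity.
  - intros r Hr. exists (fun _ => u). split; [split; [exact I|exists u; auto]|].
    apply filter_forall. intros. apply germ_refl.
Qed.

Lemma square_in_E (H : R -> R -> Ept) : continuous_square nbhdE H ->
  (forall s r, square01 (s, r) -> puncturedE t t' (H s r)) ->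
  in_E square01 (fun q => H (fst q) (snd q)).
Proof.
  intros Hc HP [s r] Hsr. split; [apply HP, Hsr|]. apply lim_nE_of; [typeclasses eauto|apply Hc, Hsr|].
  unfold within. apply filter_forall. intros [s' r'] H'. apply (HP s' r' H').
Qed.

Lemma square_in_C (H : R -> R -> Cpt) : continuous_square nbhdC H ->
  (forall s r, square01 (s, r) -> onC t t' (H s r)) ->
  in_C square01 (fun q => H (fst q) (snd q)).
Proof.
  intros Hc HP [s r] Hsr. split; [apply HP, Hsr|]. apply lim_nC_of; [typeclasses eauto|apply Hc, Hsr|].
  unfold within. apply filter_forall. intros [s' r'] H'. apply (HP s' r' H').
Qed.

Lemma path_in_E (g : R -> Ept) : pathE t t' g -> in_E I01 g.
Proof.
  intros [Hc HP] r Hr. split; [apply HP, Hr|]. apply lim_nE_of; [typeclasses eauto|apply Hc, Hr|].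
  unfold within. apply filter_forall. intros r' H'. apply (HP r' H').
Qed.

Lemma path_in_C (c : R -> Cpt) : continuous_path nbhdC c -> (forall r, I01 r -> onC t t' (c r)) -> in_C I01 c.
Proof.
  intros Hc HP r Hr. split; [apply HP, Hr|]. apply lim_nC_of; [typeclasses eauto|apply Hc, Hr|].
  unfold within. apply filter_forall. intros r' H'. apply (HP r' H').
Qed.

(** The homotopy is lifted twice, from E to C and from C to germs of primitives; the second lifting
    uses that the first keeps its ends fixed. *)
Lemma continues_homotopic k g h P0 u0 P1 u1 : homotopicE t t' g h ->
  continues k g P0 u0 P1 u1 -> continues k h P0 u0 P1 u1.
Proof.
  intros (H & Hc & HP & Hend & Hgh) (c & V & Hlc & HV & E0 & E1 & G0 & G1).
  assert (HH := square_in_E H Hc HP).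
  destruct (family_homotopy covering_E (fun q => H (fst q) (snd q)) c HH) as (D & HD & D0 & Dl & Dr).
  - intros s Hs. simpl. destruct (Hend s Hs) as [-> _]. destruct (Hend 0%R I01_0) as [-> _]. reflexivity.
  - intros s Hs. simpl. destruct (Hend s Hs) as [_ ->]. destruct (Hend 0%R I01_0) as [_ ->]. reflexivity.
  - revert Hlc. apply lifts_ext; [|reflexivity]. intros r Hr. symmetry. apply Hgh, Hr.
  - assert (HDC := lifts_in_C _ _ _ HH HD).
    destruct (family_homotopy (covering_C k) D V HDC) as (W & HW & W0 & Wl & Wr).
    + intros s Hs. rewrite (Dl s Hs), (Dl 0%R I01_0). reflexivity.
    + intros s Hs. rewrite (Dr s Hs), (Dr 0%R I01_0). reflexivity.
    + revert HV. apply primitives_curve_ext. intros r Hr. symmetry. apply D0, Hr.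
    + exists (fun r => D (1%R, r)), (fun r => W (1%R, r)).
      specialize (Wl 1%R I01_1). specialize (Wr 1%R I01_1). cbv beta in Wl, Wr.
      rewrite (Dl 0%R I01_0), E0 in Wl. rewrite (Dr 0%R I01_0), E1 in Wr.
      repeat split.
      * assert (K := family_row _ D 1%R I01_1 HD). revert K. apply lifts_ext; [|reflexivity].
        intros r Hr. apply Hgh, Hr.
      * apply (family_row D W 1%R I01_1 HW).
      * transitivity (c 0%R); [exact (Dl 1%R I01_1)|exact E0].
      * transitivity (c 1%R); [exact (Dr 1%R I01_1)|exact E1].
      * apply germ_trans with (V 0%R); assumption.
      * apply germ_trans with (V 1%R); assumption.
Qed.

Lemma homotopic_sym (g h : R -> Ept) : homotopicE t t' g h -> homotopicE t t' h g.
Proof.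
  intros (H & Hc & HP & Hend & Hgh). exists (fun s r => H (1 - s)%R r). split; [|split; [|split]].
  - intros s r Hsr.
    assert (Hsr' : square01 ((1 - s)%R, r)) by (destruct Hsr as [H1 H2]; split; unfold I01 in *; simpl in *; lra).
    intros A HA. destruct (Hc _ _ Hsr' A HA) as [eps He]. exists eps.
    intros [s' r'] [B1 B2] [H1 H2]. apply (He ((1 - s')%R, r')).
    + split; [|exact B2]. change (Rabs (s' + - s) < eps)%R in B1.
      change (Rabs (1 - s' + - (1 - s)) < eps)%R.
      replace (1 - s' + - (1 - s))%R with (- (s' + - s))%R by ring. rewrite Rabs_Ropp. exact B1.
    + split; unfold I01 in *; simpl in *; lra.
  - intros s r [H1 H2]. apply HP. split; unfold I01 in *; simpl in *; lra.
  - intros s Hs. apply Hend. unfold I01 in *. lra.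
  - intros r Hr. destruct (Hgh r Hr) as [E1 E2]. rewrite Rminus_0_r, Rminus_diag. auto.
Qed.

(** * Monodromy of the primitives *)

Lemma germ_of_value k P u u' : onC t t' P -> primitive_near t t' (form k) u P ->
  primitive_near t t' (form k) u' P -> u P = u' P -> germ P u u'.
Proof.
  intros HP Hu Hu' E. destruct (primitive_near_unique k P u u' HP Hu Hu') as [x Hx].
  assert (Ex := nC_self P _ HP Hx). cbv beta in Ex.
  assert (x = 0) as -> by (replace x with (u P + x - u P) by ring; rewrite <- Ex, E; ring).
  unfold germ. revert Hx. apply filter_imp. intros P' ->. ring.
Qed.

(** The edge s = 0 of the square is contracted to a ramification point, and its
    edges r = 0 and r = 1 are exchanged by the deck transformation: continuing
    along the latter two from the fixed point determines [V] on the edge r = 1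
    from [V] on the edge r = 0. *)
Lemma half_disc k (H : R * R -> Cpt) (v : Cpt -> C) : in_C square01 H ->
  (forall r, I01 r -> H (0%R, r) = H (0%R, 0%R)) -> deck (H (0%R, 0%R)) = H (0%R, 0%R) ->
  (forall s, I01 s -> H (s, 1%R) = deck (H (s, 0%R))) ->
  primitive_near t t' (form k) v (H (1%R, 0%R)) ->
  exists (x : C) (V : R -> Cpt -> C), primitives k I01 (fun r => H (1%R, r)) V /\
    germ (H (1%R, 0%R)) (V 0%R) v /\
    germ (H (1%R, 1%R)) (V 1%R) (fun P => eta k * v (deck P) + (1 - eta k) * x).
Proof.
  intros HH H0 Hfix Hdeck Hv.
  assert (Hsq : forall s r, I01 s -> I01 r -> square01 (s, r)) by (intros; split; assumption).
  destruct (family_square (covering_C k) H HH) as [V1 HV1].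
  assert (Hp10 := Hsq _ _ I01_1 I01_0).
  destruct (primitive_near_unique k (H (1%R, 0%R)) (V1 (1%R, 0%R)) v) as [x0 Hx0].
  { apply HH, Hp10. }
  { apply (primitives_spec k square01 H V1 _ HV1 Hp10). }
  { exact Hv. }
  set (V := fun q P => V1 q P + x0).
  assert (HV : primitives k square01 H V) by (apply primitives_plus, HV1).
  assert (HVv : germ (H (1%R, 0%R)) (V (1%R, 0%R)) v) by (apply germ_sym, Hx0).
  set (x := V (0%R, 0%R) (H (0%R, 0%R))).
  exists x, (fun r => V (1%R, r)).
  split; [apply (family_row H V 1%R I01_1 HV)|]. split; [exact HVv|].
  (* The primitive on the edge [r = 0], transported by [deck]. The added constant gives it the value
     [x] at the fixed point, since [eta k * x + (1 - eta k) * x = x]. *)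
  set (W := fun (s : R) P => eta k * V (s, 0%R) (deck P) + (1 - eta k) * x).
  assert (Hcol1 : in_C I01 (fun s => H (s, 1%R))) by (apply (maps_on_column H 1%R I01_1 HH)).
  assert (HW : primitives k I01 (fun s => H (s, 1%R)) W).
  { apply primitives_plus.
    assert (K := primitives_deck k _ _ _ (family_column H V 0%R I01_0 HV)).
    revert K. apply primitives_curve_ext. intros s Hs. symmetry. apply Hdeck, Hs. }
  (* On the contracted edge the curve is constant, so the germ does not change. *)
  assert (HV01 : germ (H (0%R, 0%R)) (V (0%R, 1%R)) (V (0%R, 0%R))).
  { assert (Hr := family_row H V 0%R I01_0 HV).
    assert (K := family_unique (covering_C k) (fun r => H (0%R, r)) (fun r => V (0%R, r)) (fun _ => V (0%R, 0%R)) 0%R I01_0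
      (maps_on_row H 0%R I01_0 HH) Hr).
    rewrite <- (H0 1%R I01_1). apply K; [|apply germ_refl|apply I01_1].
    apply (family_ext (covering_C k) I01 (fun _ => H (0%R, 0%R)) _ (fun _ => V (0%R, 0%R))).
    - intros r Hr'. symmetry. apply H0, Hr'.
    - intros. apply germ_refl.
    - apply (family_const (fun r => H (0%R, r)) (fun r => V (0%R, r)) 0%R I01_0 Hr). }
  assert (E1 := H0 1%R I01_1).
  assert (HW0 : germ (H (0%R, 1%R)) (V (0%R, 1%R)) (W 0%R)).
  { rewrite E1. apply germ_trans with (V (0%R, 0%R)); [exact HV01|].
    assert (Hon : onC t t' (H (0%R, 0%R))) by (apply HH, Hsq; apply I01_0).
    apply (germ_of_value k); [exact Hon| | |].
    - apply (primitives_spec k square01 H V _ HV), Hsq; apply I01_0.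
    - assert (K : primitive_near t t' (form k) (W 0%R) (H (0%R, 1%R)))
        by exact (primitives_spec k I01 _ W 0%R HW I01_0).
      rewrite E1 in K. exact K.
    - unfold W. rewrite Hfix. fold x. ring. }
  assert (K := family_unique (covering_C k) (fun s => H (s, 1%R)) (fun s => V (s, 1%R)) W 0%R I01_0 Hcol1
    (family_column H V 1%R I01_1 HV) HW HW0 1%R I01_1).
  cbv beta in K. apply germ_trans with (W 1%R); [exact K|].
  unfold W. apply germ_plus. rewrite Hdeck by apply I01_1. apply germ_deck, HVv.
Qed.

(** The difference between [zeta] and the primitive continued along [c] is locally constant, hence
    constant on [0, 1]. *)
Lemma is_integral_change (c : R -> Cpt) (k : bool) (V : R -> Cpt -> C) (v : C) :
  in_C I01 c -> primitives k I01 c V -> is_integral t t' (form k) c v ->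
  V 1%R (c 1%R) - V 0%R (c 0%R) = v.
Proof.
  intros Hc HV (zeta & Ev & Hz).
  assert (K : zeta 0%R - V 0%R (c 0%R) = zeta 1%R - V 1%R (c 1%R)).
  { apply (interval_induction (fun a b => zeta a - V a (c a) = zeta b - V b (c b))); [lra| |].
    - intros. congruence.
    - intros s Hs. destruct (Hz s Hs) as (h & Hh & Hzh).
      assert (Hon : onC t t' (c s)) by apply (Hc s Hs).
      assert (Hs' := primitives_spec k I01 c V s HV Hs).
      destruct (primitive_near_unique k (c s) _ _ Hon Hs' Hh) as [x Hx].
      assert (L1 := proj2 (Hc s Hs) _ (nC_open _ _ Hx)). unfold filtermap in L1.
      assert (L2 := primitives_local k I01 c V s Hc HV Hs).
      assert (L3 : within I01 (locally s) (fun r => onC t t' (c r)))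
        by (unfold within; apply filter_forall; intros r Hr; apply (Hc r Hr)).
      destruct (filter_and _ _ (filter_and _ _ L1 L2) (filter_and _ _ L3 Hzh)) as [delta Hd].
      exists delta. split; [apply cond_pos|].
      assert (Q : forall r, I01 r -> (s - delta < r < s + delta)%R -> zeta r - V r (c r) = x).
      { intros r Hr Hrs. destruct (Hd r) as [[M1 M2] [M3 M4]].
        - apply Rabs_def1; unfold minus, plus, opp; simpl; lra.
        - exact Hr.
        - rewrite M4. rewrite (nC_self (c r) _ M3 M1), (nC_self (c r) _ M3 M2). ring. }
      intros a b Ha Hb H1 H2. rewrite (Q a), (Q b); unfold I01; try lra. reflexivity. }
  rewrite Ev. replace (V 1%R (c 1%R)) with (zeta 1%R - (zeta 1%R - V 1%R (c 1%R))) by ring.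
  rewrite <- K. ring.
Qed.

Lemma continues_loop (c : R -> Cpt) (k : bool) (u : Cpt -> C) (v : C) : loopC t t' c ->
  is_integral t t' (form k) c v -> primitive_near t t' (form k) u (Cinf true) ->
  exists V, primitives k I01 c V /\ germ (Cinf true) (V 0%R) u /\
    germ (Cinf true) (V 1%R) (fun P => u P + v).
Proof.
  intros (Hc & HP & E0 & E1) Hint Hu.
  assert (HcC : in_C I01 c) by (apply path_in_C; [exact Hc|intros r Hr; apply HP, Hr]).
  destruct (primitives_from k c u HcC) as [V [HV HV0]]; [rewrite E0; exact Hu|].
  rewrite E0 in HV0. exists V. split; [exact HV|]. split; [exact HV0|].
  assert (Ev := is_integral_change c k V v HcC HV Hint). rewrite E0, E1 in Ev.
  assert (G0 := nC_self (Cinf true) _ I HV0). cbv beta in G0.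
  apply (germ_of_value k); [exact I| | |].
  - rewrite <- E1. apply (primitives_spec k I01 c V 1%R HV I01_1).
  - apply primitive_near_plus, Hu.
  - rewrite <- G0, <- Ev. ring.
Qed.

(** A path of square roots of the unit circle; the sign [e], 1 or -1, is the direction in which it
    is run. *)
Definition half_turn (e : R) (r : R) : C := (cos (PI * r), (e * sin (PI * r))%R).

Lemma half_turn_sqr (e r : R) : (e * e = 1)%R ->
  half_turn e r ^ 2 = (cos (2 * PI * r), (e * sin (2 * PI * r))%R).
Proof.
  intros He. replace (2 * PI * r)%R with (2 * (PI * r))%R by ring.
  rewrite cos_2a, sin_2a. unfold half_turn. simpl. unfold Cmult; simpl. f_equal; [|ring].
  replace (sin (PI * r) * sin (PI * r))%R with (e * e * sin (PI * r) * sin (PI * r))%R by (rewrite He; ring). ring.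
Qed.

Lemma half_turn_continuous (e r : R) : filterlim (half_turn e) (locally r) (nbhd_plane (half_turn e r)).
Proof.
  apply (clim_ext (fun r => RtoC (cos (PI * r)) + RtoC (e * sin (PI * r)) * Ci)).
  - apply filter_forall. intros r'. unfold half_turn, RtoC, Ci, Cplus, Cmult. simpl. f_equal; ring.
  - replace (half_turn e r) with (RtoC (cos (PI * r)) + RtoC (e * sin (PI * r)) * Ci)
      by (unfold half_turn, RtoC, Ci, Cplus, Cmult; simpl; f_equal; ring).
    assert (K : forall f : R -> R, ex_derive f r -> filterlim (fun r => RtoC (f r)) (locally r) (nbhd_plane (RtoC (f r)))).
    { intros f Hf. apply (filterlim_comp _ _ _ f RtoC (locally r) (locally (f r))); [|apply clim_RtoC].
      apply (ex_derive_continuous (V := R_NormedModule)), Hf. }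
    apply clim_plus; [|apply clim_mult; [|apply clim_const]].
    + apply (K (fun r => cos (PI * r))). auto_derive. auto.
    + apply (K (fun r => e * sin (PI * r))%R). auto_derive. auto.
Qed.

(** The disc around the branch point is pulled back by [x = t' - xi ^ 2]. Over its boundary [xi]
    makes half a turn, and scaling [xi] to 0 contracts this to the ramification point, as
    [half_disc] requires. The lift of the lasso then returns along the image of its first part under
    [deck]. *)
Lemma continues_lasso k (w : C) (g : R -> Ept) (u : Cpt -> C) : simple_loop_around t t' w g ->
  primitive_near t t' (form k) u (Cinf true) ->
  exists x : C, continues k g (Cinf true) u (Cinf false) (fun P => eta k * u (deck P) + (1 - eta k) * x).
Proof.
  intros ([Hg _] & _ & (rho & Y & turn & s & Hlasso)) Hu. cbv zeta in Hlasso.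
  destruct Hlasso as (Hrho & HYc & HYE & _ & Hturn & Hs & Hs0 & Hs1 & Hhom).
  set (D := fun x : C => (Cmod (x - t') <= rho)%R) in *.
  set (c := fun r : R => Eaff (t' + rho * turn r) (Y (t' + rho * turn r))) in *.
  assert (Ht : exists e : R, (e * e = 1)%R /\ forall r, half_turn e r ^ 2 = turn r).
  { destruct Hturn as [-> | ->].
    - exists 1%R. split; [ring|]. intros r. rewrite half_turn_sqr by ring. unfold unit_circle. f_equal. ring.
    - exists (-1)%R. split; [ring|]. intros r. rewrite half_turn_sqr by ring. unfold reverse, unit_circle.
      replace (2 * PI * (1 - r))%R with (- (2 * PI * r) + 2 * INR 1 * PI)%R by (simpl; ring).
      rewrite cos_period, sin_period, cos_neg, sin_neg. f_equal. ring. }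
  destruct Ht as (e & He & Ht).
  assert (HsE := path_in_E s Hs).
  destruct (continues_exists k s (Cinf true) u HsE) as (P1 & v & Hcont & HP1); [symmetry; exact Hs0|exact Hu|].
  rewrite Hs1 in HP1. unfold c in HP1.
  assert (T0 : turn 0%R = 1).
  { rewrite <- Ht. unfold half_turn. rewrite Rmult_0_r, cos_0, sin_0, Rmult_0_r. change (1%R, 0%R) with (RtoC 1). ring. }
  destruct P1 as [xi1 y1|b1]; [|discriminate]. cbn [fcov] in HP1.
  assert (EX := f_equal x_coordE HP1). assert (EY := f_equal y_coordE HP1). cbn [x_coordE y_coordE] in EX, EY.
  assert (Exi : xi1 ^ 2 = - rho).
  { replace (xi1 ^ 2) with (t' - (t' - xi1 ^ 2)) by ring. rewrite EX, T0. ring. }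
  set (xi := fun r => xi1 * half_turn e r).
  assert (Exr : forall r, xi r ^ 2 = - (rho * turn r)).
  { intros r. unfold xi. rewrite Cpow_mult_l, Exi, Ht. ring. }
  (* For [sg = 0] this is the ramification point, for [sg = 1] the lift of the circle [c]. *)
  set (H := fun sg r : R => Caff (sg * xi r) (Y (t' - (sg * xi r) ^ 2))).
  assert (Hhalf : forall r, Cmod (xi r ^ 2) = rho).
  { intros r. unfold xi. rewrite Cpow_mult_l, Exi, Cmod_mult, Cmod_opp, Cmod_R, Rabs_pos_eq by lra.
    rewrite Cmod_pow. replace (Cmod (half_turn e r)) with 1%R; [ring|].
    unfold Cmod, half_turn. cbn [fst snd]. symmetry.
    replace (cos (PI * r) ^ 2 + (e * sin (PI * r)) ^ 2)%R with 1%R; [apply sqrt_1|].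
    generalize (sin2_cos2 (PI * r)). unfold Rsqr. intros E. rewrite <- E. simpl.
    replace (e * sin (PI * r) * (e * sin (PI * r) * 1))%R with (e * e * (sin (PI * r) * sin (PI * r)))%R by ring.
    rewrite He. ring. }
  assert (HD : forall sg r, I01 sg -> D (t' - (RtoC sg * xi r) ^ 2)).
  { intros sg r Hsg. unfold I01 in Hsg. unfold D.
    replace (t' - (sg * xi r) ^ 2 - t') with (- (RtoC sg * RtoC sg * xi r ^ 2)) by ring.
    rewrite Cmod_opp, !Cmod_mult, Hhalf, Cmod_R, Rabs_pos_eq by lra.
    assert (Hss : (sg * sg <= 1)%R) by nra. apply Rmult_le_compat_r with (r := rho) in Hss; lra. }
  assert (HonC : forall sg r, square01 (sg, r) -> onC t t' (H sg r)).
  { intros sg r [Hsg _]. apply onC_of_fcov. unfold H. cbn [fcov]. apply HYE, HD, Hsg. }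
  assert (Hxic : forall sg r, filterlim (fun q : R * R => RtoC (fst q) * xi (snd q)) (locally (sg, r))
     (nbhd_plane (RtoC sg * xi r))).
  { intros sg r. apply clim_mult; [|apply clim_mult; [apply clim_const|]].
    - apply (filterlim_comp _ _ _ fst RtoC _ (locally sg)); [|apply clim_RtoC].
      apply (continuous_fst (U := R_UniformSpace) (V := R_UniformSpace)).
    - apply (filterlim_comp _ _ _ snd (half_turn e) _ (locally r)); [|apply half_turn_continuous].
      apply (continuous_snd (U := R_UniformSpace) (V := R_UniformSpace)). }
  assert (HHc : continuous_square nbhdC H).
  { intros sg r Hq. assert (Hsg := proj1 Hq). simpl in Hsg.
    assert (L1 := filterlim_within square01 _ _ _ (Hxic sg r)).
    unfold H. apply lim_Caff; [exact L1|].
    assert (L2 : filterlim (fun q : R * R => t' - (RtoC (fst q) * xi (snd q)) ^ 2) (within square01 (locally (sg, r)))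
      (within D (nbhd_plane (t' - (RtoC sg * xi r) ^ 2)))).
    { intros A HA.
      assert (L3 : filterlim (fun q : R * R => t' - (RtoC (fst q) * xi (snd q)) ^ 2) (within square01 (locally (sg, r)))
        (nbhd_plane (t' - (RtoC sg * xi r) ^ 2))).
      { apply (clim_minus (fun _ => t')); [apply clim_const|]. apply (clim_pow _ _ 2), L1. }
      assert (K := L3 _ HA). unfold filtermap, within in *. revert K. apply filter_imp.
      intros [sg' r'] K Hq'. apply (K Hq'). apply HD, Hq'. }
    apply (filterlim_comp _ _ _ _ Y _ _ _ L2). apply HYc, HD, Hsg. }
  assert (HH := square_in_C H HHc HonC).
  assert (Hd1 : forall sg : R, RtoC sg * xi 1%R = - (RtoC sg * xi 0%R)).
  { intros sg. unfold xi, half_turn. rewrite Rmult_1_r, Rmult_0_r, cos_PI, sin_PI, cos_0, sin_0, Rmult_0_r.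
    replace ((-1)%R, 0%R) with (- RtoC 1) by (unfold RtoC, Copp; simpl; f_equal; ring).
    change (1%R, 0%R) with (RtoC 1). ring. }
  assert (HP1' : H 1%R 0%R = Caff xi1 y1).
  { assert (X0 : xi 0%R = xi1).
    { unfold xi, half_turn. rewrite Rmult_0_r, cos_0, sin_0, Rmult_0_r. change (1%R, 0%R) with (RtoC 1). ring. }
    unfold H. rewrite X0. replace (1 * xi1) with xi1 by ring. f_equal. rewrite EY, <- EX. reflexivity. }
  assert (Hv : primitive_near t t' (form k) v (Caff xi1 y1)).
  { destruct Hcont as (c' & V & _ & HV & _ & E1 & _ & G1). rewrite <- E1 in G1 |- *.
    apply (primitive_near_ext _ _ (V 1%R)); [exact G1|apply (primitives_spec k I01 c' V 1%R HV I01_1)]. }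
  destruct (half_disc k (fun q => H (fst q) (snd q)) v HH) as (x & V & HV & G0 & G1).
  - intros r _. unfold H. cbn [fst snd]. f_equal; [ring|]. f_equal. ring.
  - unfold H. cbn [fst snd deck]. f_equal. ring.
  - intros sg _. unfold H. cbn [fst snd deck]. rewrite Hd1. f_equal. f_equal. ring.
  - cbn [fst snd]. rewrite HP1'. exact Hv.
  - cbn [fst snd] in HV, G0, G1.
    assert (HdP : H 1%R 1%R = deck (Caff xi1 y1)).
    { rewrite <- HP1'. unfold H. cbn [deck]. rewrite Hd1. f_equal. f_equal. ring. }
    assert (HcC : in_C I01 (fun r => H 1%R r)) by (apply (maps_on_row _ 1%R I01_1 HH)).
    assert (HcP : forall r, I01 r -> puncturedC t t' (H 1%R r)).
    { intros r Hr. split; [apply HonC; split; [apply I01_1|exact Hr]|]. intros y E.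
      apply (f_equal xi_coord) in E. cbn [xi_coord] in E. unfold H in E. cbn [xi_coord] in E.
      assert (E2 : xi r ^ 2 = 0) by (replace (xi r) with (1 * xi r) by ring; rewrite E; ring).
      assert (E3 := Hhalf r). rewrite E2, Cmod_0 in E3. lra. }
    assert (Hfc : forall r, fcov t' (H 1%R r) = c r).
    { intros r. unfold H, c. cbn [fcov]. replace (1 * xi r) with (xi r) by ring. rewrite Exr.
      replace (t' - - (rho * turn r)) with (t' + rho * turn r) by ring. reflexivity. }
    assert (HcE : in_E I01 c).
    { assert (K := in_C_fcov _ HcC HcP). revert K. apply maps_on_ext. intros r _. apply Hfc. }
    assert (Hcc : continues k c (Caff xi1 y1) v (deck (Caff xi1 y1)) (fun P => eta k * v (deck P) + (1 - eta k) * x)).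
    { exists (fun r => H 1%R r), V. rewrite HP1' in G0. rewrite HdP in G1. repeat split; auto.
      assert (K := lifts_fcov _ HcC HcP). revert K. apply lifts_ext; [|reflexivity]. intros r _. apply Hfc. }
    assert (Ec : c 1%R = c 0%R).
    { rewrite <- (Hfc 1%R), <- (Hfc 0%R), HdP, HP1', fcov_deck. reflexivity. }
    exists x.
    (* The way back is the first lift, moved to the other sheet and reversed; its primitive is
       shifted by the constant acquired on the half turn. *)
    assert (Hback := continues_plus k _ _ _ _ _ ((1 - eta k) * x)
      (continues_reverse k _ _ _ _ _ (continues_deck k _ _ _ _ _ Hcont))).
    apply (continues_homotopic k _ g) with (1 := homotopic_sym _ _ Hhom).
    assert (HrE : in_E I01 (reverse s)) by (apply maps_on_reverse, HsE).
    apply (continues_concat k) with (P1 := Caff xi1 y1) (u1 := v); [exact HsE| | |exact Hcont|].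
    + apply maps_on_concat; [exact HcE|exact HrE|].
      unfold reverse. rewrite Rminus_0_r, Hs1. exact Ec.
    + rewrite Hs1. unfold concat. destruct Rle_dec; [rewrite Rmult_0_r; reflexivity|lra].
    + apply (continues_concat k) with (2 := HrE) (4 := Hcc) (5 := Hback); [exact HcE|].
      unfold reverse. rewrite Rminus_0_r, Hs1. exact Ec.
Qed.

Lemma continues_fcov_loop (c : R -> Cpt) (k : bool) (u : Cpt -> C) (v : C) : loopC t t' c ->
  is_integral t t' (form k) c v -> primitive_near t t' (form k) u (Cinf true) ->
  in_E I01 (fun r => fcov t' (c r)) /\
  continues k (fun r => fcov t' (c r)) (Cinf true) u (Cinf true) (fun P => u P + v).
Proof.
  intros Hc Hint Hu. destruct (continues_loop c k u v Hc Hint Hu) as (V & HV & H0 & H1).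
  destruct Hc as (Hc & HP & E0 & E1).
  assert (HcC : in_C I01 c) by (apply path_in_C; [exact Hc|intros r Hr; apply HP, Hr]).
  split; [apply in_C_fcov; assumption|].
  exists c, V. repeat split; auto. apply lifts_fcov; assumption.
Qed.

Lemma continues_pointwise k g P0 u0 u0' P1 u1 u1' : continues k g P0 u0 P1 u1 ->
  (forall P, u0 P = u0' P) -> (forall P, u1 P = u1' P) -> continues k g P0 u0' P1 u1'.
Proof.
  intros H E0 E1. apply (continues_germ k g P0 u0 u0' P1 u1 u1' H);
    unfold germ; apply filter_forall; assumption.
Qed.

(** The commutator of the translations by [A] and [B] is trivial, so that the
    reflections attached to [g1] and [g2] have the same centre. *)
Lemma surface_centres (a b g1 g2 : R -> Ept) (u : Cpt -> C) (A B x1 x2 : C) :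
  primitive_near t t' (form false) u (Cinf true) ->
  in_E I01 a -> in_E I01 b -> in_E I01 g1 -> in_E I01 g2 ->
  (a 0%R = Einf /\ a 1%R = Einf) -> (b 0%R = Einf /\ b 1%R = Einf) ->
  (g1 0%R = Einf /\ g1 1%R = Einf) -> (g2 0%R = Einf /\ g2 1%R = Einf) ->
  continues false a (Cinf true) u (Cinf true) (fun P => u P + A) ->
  continues false b (Cinf true) u (Cinf true) (fun P => u P + B) ->
  continues false g1 (Cinf true) u (Cinf false) (fun P => eta false * u (deck P) + (1 - eta false) * x1) ->
  continues false g2 (Cinf true) u (Cinf false) (fun P => eta false * u (deck P) + (1 - eta false) * x2) ->
  surface_relation t t' a b g1 g2 -> x1 = x2.
Proof.
  intros Hu Ea Eb E1 E2 [a0 a1] [b0 b1] [g10 g11] [g20 g21] Ca Cb C1 C2 Hrel.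
  assert (C00 : forall (x y : R -> Ept), concat x y 0%R = x 0%R)
    by (intros; rewrite concat_left by lra; f_equal; ring).
  assert (C11 : forall (x y : R -> Ept), concat x y 1%R = y 1%R)
    by (intros; rewrite concat_right by lra; f_equal; ring).
  assert (R0 : forall x : R -> Ept, reverse x 0%R = x 1%R) by (intros; unfold reverse; f_equal; ring).
  assert (R1 : forall x : R -> Ept, reverse x 1%R = x 0%R) by (intros; unfold reverse; f_equal; ring).
  assert (Era : in_E I01 (reverse a)) by (apply maps_on_reverse, Ea).
  assert (Erb : in_E I01 (reverse b)) by (apply maps_on_reverse, Eb).
  assert (S1 : continues false (concat a b) (Cinf true) u (Cinf true) (fun P => u P + B + A)).
  { apply (continues_concat) with (4 := Ca); [exact Ea|exact Eb|congruence|].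
    apply (continues_plus), Cb. }
  assert (I1 : in_E I01 (concat a b)) by (apply maps_on_concat; [exact Ea|exact Eb|congruence]).
  assert (S2 : continues false (concat (concat a b) (reverse a)) (Cinf true) u (Cinf true) (fun P => u P + B)).
  { apply (continues_concat) with (4 := S1); [exact I1|exact Era|rewrite C11, R0; congruence|].
    apply (continues_pointwise _ _ _ _ _ _ _ _
      (continues_plus _ _ _ _ _ _ B (continues_reverse _ _ _ _ _ _ Ca))); intros; ring. }
  assert (I2 : in_E I01 (concat (concat a b) (reverse a))).
  { apply maps_on_concat; [exact I1|exact Era|rewrite C11, R0; congruence]. }
  assert (S3 : continues false (concat (concat (concat a b) (reverse a)) (reverse b)) (Cinf true) u (Cinf true) u).
  { apply (continues_concat) with (4 := S2); [exact I2|exact Erb|rewrite C11, R0, R1; congruence|].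
    apply (continues_reverse), Cb. }
  assert (I3 : in_E I01 (concat (concat (concat a b) (reverse a)) (reverse b))).
  { apply maps_on_concat; [exact I2|exact Erb|rewrite C11, R0, R1; congruence]. }
  assert (S4 := continues_concat false _ _ _ _ _ _ _ _ I3 E1 ltac:(rewrite C11, R1; congruence) S3 C1).
  assert (I4 : in_E I01 (concat (concat (concat (concat a b) (reverse a)) (reverse b)) g1)).
  { apply maps_on_concat; [exact I3|exact E1|rewrite C11, R1; congruence]. }
  (* The loop [g2] is now entered on the other sheet, so its continuation is conjugated by
     [deck]. *)
  assert (C2' := continues_plus _ _ _ _ _ _ ((1 - eta false) * x1) (continues_deck _ _ _ _ _ _ C2)).
  assert (S5 := continues_concat false _ _ _ _ _ _ _ _ I4 E2 ltac:(rewrite C11; congruence) S4 C2').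
  assert (S6 := continues_homotopic false _ _ _ _ _ _ Hrel S5).
  assert (Ic : in_E I01 (fun _ => Einf)).
  { intros r Hr. split; [apply (punctured_fcov (Cinf true)), punctured_inf|].
    intros Q HQ. unfold filtermap. apply filter_forall. intros _. apply (nE_self Einf Q I HQ). }
  destruct (continues_unique false _ _ _ _ _ _ _ _ Ic (continues_const false u Hu) S6 (germ_refl _ _)) as [_ G].
  assert (E := nC_self (Cinf true) _ I G). cbv beta in E. rewrite deck_deck in E. unfold eta in E.
  (* The two reflections compose to the translation by [2 * (x1 - x2)], which has to be trivial. *)
  assert (Ex : 2 * (x1 - x2) = 0).
  { replace (2 * (x1 - x2)) with (- (1) * (- (1) * u (Cinf true) + (1 - - (1)) * x2) + (1 - - (1)) * x1 - u (Cinf true)) by ring.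
    rewrite <- E. ring. }
  apply NNPP. intros Hn. revert Ex. apply Cmult_neq_0; [|apply Cminus_neq_0, Hn].
  intros E3. apply RtoC_inj in E3. lra.
Qed.

(** * The fundamental matrix *)

Lemma Mmult_22 (a b c d a' b' c' d' : C) :
  Mmult (T := C_Ring) ([ [a, b], [c, d] ] : mat2) ([ [a', b'], [c', d'] ] : mat2)
  = [ [a * a' + b * c', a * b' + b * d'], [c * a' + d * c', c * b' + d * d'] ].
Proof.
  unfold Mmult, mk_matrix. simpl. rewrite !sum_Sn, !sum_O. reflexivity.
Qed.

Lemma mat2_eq (a b c d a' b' c' d' : C) : a = a' -> b = b' -> c = c' -> d = d' ->
  ([ [a, b], [c, d] ] : mat2) = [ [a', b'], [c', d'] ].
Proof. intros -> -> -> ->. reflexivity. Qed.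

Lemma Ccosh_sqr_minus (z : C) : Ccosh z * Ccosh z - Csinh z * Csinh z = 1.
Proof.
  assert (E : Cexp z * Cexp (- z) = 1).
  { rewrite <- Cexp_plus. replace (z + - z) with (RtoC 0) by ring. apply Cexp_0. }
  unfold Ccosh, Csinh. rewrite <- E. field.
Qed.

(** The imaginary unit in the period turns hyperbolic functions of it into circular ones; after
    expansion into exponentials this is an algebraic identity. *)
Lemma Phi_translate_a (lam1 lam2 K K' z1 z2 iv : C) :
  let Phi z1 z2 : mat2 := [ [ Cexp (- (lam2 * z2)) * Ccosh (lam1 * z1), - (Cexp (- (lam2 * z2)) * Csinh (lam1 * z1)) ],
    [ - (Cexp (- (lam2 * z2)) * iv * Csinh (lam1 * z1)), Cexp (- (lam2 * z2)) * iv * Ccosh (lam1 * z1) ] ] in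
  Phi (z1 + 2 * Ci * K) (z2 + 2 * Ci * K') = Mmult (T := C_Ring) (Phi z1 z2) (M_a lam1 lam2 K K').
Proof.
  cbv zeta beta. unfold M_a. rewrite Mmult_22. unfold Ccosh, Csinh, Ccos, Csin.
  replace (- (lam2 * (z2 + 2 * Ci * K'))) with (- (lam2 * z2) + - (2 * Ci * lam2 * K')) by ring.
  replace (lam1 * (z1 + 2 * Ci * K)) with (lam1 * z1 + Ci * (2 * lam1 * K)) by ring.
  replace (- (lam1 * z1 + Ci * (2 * lam1 * K))) with (- (lam1 * z1) + - (Ci * (2 * lam1 * K))) by ring.
  rewrite !Cexp_plus. assert (Hi : Ci <> 0) by (apply (slope_neq_0 true)).
  apply mat2_eq; field; exact Hi.
Qed.

Lemma Phi_translate_b (lam1 lam2 L L' z1 z2 iv : C) :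
  let Phi z1 z2 : mat2 := [ [ Cexp (- (lam2 * z2)) * Ccosh (lam1 * z1), - (Cexp (- (lam2 * z2)) * Csinh (lam1 * z1)) ],
    [ - (Cexp (- (lam2 * z2)) * iv * Csinh (lam1 * z1)), Cexp (- (lam2 * z2)) * iv * Ccosh (lam1 * z1) ] ] in
  Phi (z1 + - 2 * L) (z2 + - 2 * L') = Mmult (T := C_Ring) (Phi z1 z2) (M_b lam1 lam2 L L').
Proof.
  cbv zeta beta. unfold M_b. rewrite Mmult_22. unfold Ccosh, Csinh.
  replace (- (lam2 * (z2 + - 2 * L'))) with (- (lam2 * z2) + 2 * lam2 * L') by ring.
  replace (lam1 * (z1 + - 2 * L)) with (lam1 * z1 + - (2 * lam1 * L)) by ring.
  replace (- (lam1 * z1 + - (2 * lam1 * L))) with (- (lam1 * z1) + 2 * lam1 * L) by ring.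
  rewrite !Cexp_plus. apply mat2_eq; field.
Qed.

(** The continuation ends on the other sheet, where [z1] and [1 / xi] both change sign: the effects
    cancel in the first column and leave a sign in the second. *)
Lemma Phi_reflect (lam1 lam2 z1 z2 iv : C) :
  let Phi z1 z2 iv : mat2 := [ [ Cexp (- (lam2 * z2)) * Ccosh (lam1 * z1), - (Cexp (- (lam2 * z2)) * Csinh (lam1 * z1)) ],
    [ - (Cexp (- (lam2 * z2)) * iv * Csinh (lam1 * z1)), Cexp (- (lam2 * z2)) * iv * Ccosh (lam1 * z1) ] ] in
  Phi (- (1) * z1) z2 (- iv) = Mmult (T := C_Ring) (Phi z1 z2 iv) M_gamma.
Proof.
  cbv zeta beta. unfold M_gamma. rewrite Mmult_22. unfold Ccosh, Csinh.
  replace (lam1 * (- (1) * z1)) with (- (lam1 * z1)) by ring.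
  replace (- - (lam1 * z1)) with (lam1 * z1) by ring.
  replace (RtoC (-1)) with (- (1)) by (rewrite <- RtoC_opp; f_equal; ring). apply mat2_eq; field.
Qed.

Section Phi.
Variables lam1 lam2 : C.

Lemma cderiv_Ccosh (f : C -> C) (v d : C) : cderiv f v d -> exists d', cderiv (fun w => Ccosh (f w)) v d'.
Proof.
  intros H. eexists. unfold Ccosh, Cdiv.
  apply (cderiv_mult (fun w => Cexp (f w) + Cexp (- f w)) (fun _ => / 2)); [|apply cderiv_const].
  apply cderiv_plus.
  - apply (cderiv_comp Cexp f); [apply Cexp_cderiv|exact H].
  - apply (cderiv_comp Cexp (fun w => - f w)); [apply Cexp_cderiv|apply cderiv_opp, H].
Qed.

Lemma cderiv_Csinh (f : C -> C) (v d : C) : cderiv f v d -> exists d', cderiv (fun w => Csinh (f w)) v d'.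
Proof.
  intros H. eexists. unfold Csinh, Cdiv.
  apply (cderiv_mult (fun w => Cexp (f w) - Cexp (- f w)) (fun _ => / 2)); [|apply cderiv_const].
  apply cderiv_minus.
  - apply (cderiv_comp Cexp f); [apply Cexp_cderiv|exact H].
  - apply (cderiv_comp Cexp (fun w => - f w)); [apply Cexp_cderiv|apply cderiv_opp, H].
Qed.

Lemma Phi_entry_cderiv (chi : C -> Cpt) (z1 z2 : Cpt -> C) (v : C) (i j : nat) : (i < 2)%nat -> (j < 2)%nat ->
  (exists d, cderiv (fun w => z1 (chi w)) v d) -> (exists d, cderiv (fun w => z2 (chi w)) v d) ->
  (exists d, cderiv (fun w => inv_xi (chi w)) v d) ->
  exists d, cderiv (fun w => coeff_mat (T := C) 0 (Phi_matrix lam1 lam2 z1 z2 (chi w)) i j) v d.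
Proof.
  intros Hi Hj [d1 H1] [d2 H2] [d3 H3].
  destruct (cderiv_Ccosh _ v _ (cderiv_scal lam1 _ v _ H1)) as [dc Hc].
  destruct (cderiv_Csinh _ v _ (cderiv_scal lam1 _ v _ H1)) as [ds Hs].
  assert (He : exists d, cderiv (fun w => Cexp (- (lam2 * z2 (chi w)))) v d).
  { eexists. apply (cderiv_comp Cexp (fun w => - (lam2 * z2 (chi w)))); [apply Cexp_cderiv|].
    apply cderiv_opp, cderiv_scal, H2. }
  destruct He as [de He]. assert (Hei := cderiv_mult _ _ _ _ _ He H3).
  destruct i as [|[|i]]; [| |lia]; (destruct j as [|[|j]]; [| |lia]); eexists; unfold Phi_matrix, coeff_mat; cbn -[Cexp Ccosh Csinh].
  - apply (cderiv_mult _ _ _ _ _ He Hc).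
  - apply (cderiv_opp (fun w => Cexp (- (lam2 * z2 (chi w))) * Csinh (lam1 * z1 (chi w)))), (cderiv_mult _ _ _ _ _ He Hs).
  - apply (cderiv_opp (fun w => Cexp (- (lam2 * z2 (chi w))) * inv_xi (chi w) * Csinh (lam1 * z1 (chi w)))), (cderiv_mult _ _ _ _ _ Hei Hs).
  - apply (cderiv_mult _ _ _ _ _ Hei Hc).
Qed.

Lemma lift_push (P : Cpt) (A : Cpt -> Prop) (Q : Ept) :
  section_near Q (lift P) -> nC (lift P Q) A -> nE Q (fun Q' => A (lift P Q')).
Proof. intros H. destruct (section_self _ _ H) as [L _]. apply L. Qed.

(** A chart of C at the unramified point [P] composed with [fcov] is a chart of E. In it the entries
    are built from the primitives and from [1 / xi], which is holomorphic at infinity too. *)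
Lemma entries_holomorphic (P : Cpt) (z1 z2 : Cpt -> C) : puncturedC t t' P ->
  primitive_near t t' (form false) z1 P -> primitive_near t t' (form true) z2 P ->
  forall i j, (i < 2)%nat -> (j < 2)%nat ->
  nearE t (fcov t' P) (fun Q => exists d,
    derivE t (entry (fun Q => Phi_matrix lam1 lam2 z1 z2 (lift P Q)) i j) Q d).
Proof.
  intros HP H1 H2 i j Hi Hj.
  destruct (chart_exists P (proj1 HP)) as (chi & kappa & W & E0 & Hch).
  set (A := fun Q => exists d, derivE t (entry (fun Q => Phi_matrix lam1 lam2 z1 z2 (lift P Q)) i j) Q d).
  change (nE (fcov t' P) A).
  assert (Hsec := lift_near P HP).
  assert (Hgood : nE (fcov t' P) (fun Q => section_near Q (lift P))).
  { apply (cov_open (covering_E)), Hsec. }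
  assert (K : nbhd_plane 0 (fun v => A (fcov t' (chi v)))).
  { rewrite <- E0 in H1, H2.
    assert (R1 := chart_primitive chi kappa W Hch false z1 H1).
    assert (R2 := chart_primitive chi kappa W Hch true z2 H2).
    assert (R3 := nbhd_plane_open _ _ (chart_push chi kappa W Hch _ ltac:(rewrite E0; exact (lift_retract P HP)))).
    assert (R4 := chart_push chi kappa W Hch _ ltac:(rewrite E0; exact (fcov_continuous P _ Hgood))).
    generalize (filter_and _ _ Hch (filter_and _ _ (filter_and _ _ R1 R2) (filter_and _ _ R3 R4))).
    apply filter_imp. intros v (Hv & [[D1 _] [D2 _]] & Hlift & Hsv). cbv beta in Hlift, Hsv.
    assert (HPv : puncturedC t t' (chi v)) by (apply punctured_of_fcov, Hsv).
    destruct (ch_below Hv HPv) as [D3 (J & HJ & HJd)].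
    destruct (Phi_entry_cderiv chi z1 z2 v i j Hi Hj D1 D2 D3) as [d Hd].
    assert (Elv := nbhd_plane_self _ _ Hlift). cbv beta in Elv.
    exists (d / J). apply derivE_iff.
    apply (quotient_of_cderiv (nE (fcov t' (chi v))) (fcov t' (chi v)) (fun w => fcov t' (chi w))
      (fun Q => kappa (lift P Q)) (coordE (fcov t' (chi v)))
      (entry (fun Q => Phi_matrix lam1 lam2 z1 z2 (lift P Q)) i j) v d J); auto.
    - intros B HB. apply (lift_push P (fun P' => B (kappa P'))); [exact Hsv|]. rewrite Elv.
      apply (ch_kappa Hv), HB.
    - assert (L := lift_push P _ _ Hsv ltac:(rewrite Elv; exact (ch_right Hv))).
      generalize (filter_and _ _ L (proj2 Hsv)). apply filter_imp. intros Q [M1 [_ M2]]. rewrite M1. exact M2.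
    - revert Hd. apply cderiv_ext. revert Hlift. apply filter_imp. intros w Hw. unfold entry. rewrite Hw. reflexivity. }
  assert (KC : nC P (fun P' => A (fcov t' P'))).
  { rewrite <- E0. apply (chart_pull chi kappa W Hch (fun P' => A (fcov t' P'))), K. }
  assert (KL := lift_push P (fun P' => A (fcov t' P')) (fcov t' P) Hsec ltac:(rewrite lift_fcov by exact HP; exact KC)).
  generalize (filter_and _ _ KL (proj2 Hsec)). apply filter_imp. intros Q [M1 [_ M2]]. rewrite M2 in M1. exact M1.
Qed.

Lemma Phi_matrix_ext (z1 z1' z2 z2' : Cpt -> C) (P : Cpt) : z1 P = z1' P -> z2 P = z2' P ->
  Phi_matrix lam1 lam2 z1 z2 P = Phi_matrix lam1 lam2 z1' z2' P.
Proof. intros E1 E2. unfold Phi_matrix. rewrite E1, E2. reflexivity. Qed.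

(** The germ at time [r] is the matrix of the two continued primitives, carried to E by the inverse
    of [fcov] near the lifted point. Both primitives are continued along the same curve, because
    lifts with the same origin coincide. *)
Lemma monodromy_of_continues (g : R -> Ept) (z1 z2 w1 w2 : Cpt -> C) (P0 P1 P1' : Cpt) (G1 : Ept -> mat2) :
  in_E I01 g ->
  continues false g P0 z1 P1 w1 -> continues true g P0 z2 P1' w2 ->
  nE (g 1%R) (fun Q => Phi_matrix lam1 lam2 w1 w2 (lift P1 Q) = G1 Q) ->
  continuation t g (fun Q => Phi_matrix lam1 lam2 z1 z2 (lift P0 Q)) G1.
Proof.
  intros Hg (c & V1 & Hc & HV1 & E0 & E1 & Ga & Gb) (c' & V2 & Hc' & HV2 & E0' & E1' & Ga' & Gb') HG1.
  assert (Ecc : forall r, I01 r -> c r = c' r) by (apply (lifts_unique g); auto; congruence).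
  assert (HV2' : primitives true I01 c V2).
  { revert HV2. apply (primitives_curve_ext). intros r Hr. symmetry. auto. }
  assert (E1c : P1' = P1) by (rewrite <- E1, <- E1'; symmetry; apply Ecc, I01_1). rewrite E1c in Gb'.
  assert (HcC := lifts_in_C _ _ _ Hg Hc).
  assert (Hcr : forall r, I01 r -> fcov t' (c r) = g r /\ puncturedC t t' (c r)) by (intros r; apply (lifts_section I01 g c r Hc)).
  assert (Hsec : forall r, I01 r -> section_near (g r) (lift (c r))).
  { intros r Hr. destruct (Hcr r Hr) as [<- HP]. apply lift_near, HP. }
  assert (Hlr : forall r, I01 r -> lift (c r) (g r) = c r).
  { intros r Hr. destruct (Hcr r Hr) as [<- HP]. apply lift_fcov, HP. }
  exists (fun r Q => Phi_matrix lam1 lam2 (V1 r) (V2 r) (lift (c r) Q)).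
  split; [|split].
  - assert (L1 := lift_push _ _ _ (Hsec _ I01_0) ltac:(rewrite (Hlr _ I01_0), E0; exact Ga)).
    assert (L2 := lift_push _ _ _ (Hsec _ I01_0) ltac:(rewrite (Hlr _ I01_0), E0; exact Ga')).
    unfold same_germ. change (nE (g 0%R) (fun Q' => Phi_matrix lam1 lam2 (V1 0%R) (V2 0%R) (lift (c 0%R) Q') = Phi_matrix lam1 lam2 z1 z2 (lift P0 Q'))).
    generalize (filter_and _ _ L1 L2). apply filter_imp. intros Q [M1 M2]. rewrite E0 in *. apply Phi_matrix_ext; assumption.
  - assert (L1 := lift_push _ _ _ (Hsec _ I01_1) ltac:(rewrite (Hlr _ I01_1), E1; exact Gb)).
    assert (L2 := lift_push _ _ _ (Hsec _ I01_1) ltac:(rewrite (Hlr _ I01_1), E1; exact Gb')).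
    change (nE (g 1%R) (fun Q' => Phi_matrix lam1 lam2 (V1 1%R) (V2 1%R) (lift (c 1%R) Q') = G1 Q')).
    generalize (filter_and _ _ HG1 (filter_and _ _ L1 L2)). apply filter_imp. intros Q [M0 [M1 M2]]. rewrite E1 in *. rewrite <- M0. apply Phi_matrix_ext; assumption.
  - intros s Hs. destruct (Hcr s Hs) as [Hfs HPs]. split.
    + intros i j Hi Hj. rewrite <- Hfs. apply entries_holomorphic; auto.
      * apply (primitives_spec false I01 c V1 s HV1 Hs).
      * apply (primitives_spec true I01 c V2 s HV2' Hs).
    + assert (L1 := primitives_local false I01 c V1 s HcC HV1 Hs).
      assert (L2 := primitives_local true I01 c V2 s HcC HV2' Hs).
      assert (L3 := proj2 (HcC s Hs) _ (lift_retract _ HPs)).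
      assert (L4 := proj2 (Hg s Hs) _ (cov_open (covering_E) _ _ (Hsec s Hs))).
      unfold filtermap in L3, L4. cbv beta in L3, L4.
      assert (LI : within I01 (locally s) I01) by (unfold within; apply filter_forall; auto).
      generalize (filter_and _ _ LI (filter_and _ _ (filter_and _ _ L1 L2) (filter_and _ _ L3 L4))). apply filter_imp.
      intros r (Hr & [M1 M2] & M3 & M4). destruct (Hcr r Hr) as [Hfr HPr]. rewrite Hfr in M3.
      assert (N1 := lift_push _ _ _ M4 ltac:(rewrite M3; exact M1)).
      assert (N2 := lift_push _ _ _ M4 ltac:(rewrite M3; exact M2)).
      assert (N3 := section_near_lift _ _ M4). rewrite M3 in N3.
      change (nE (g r) (fun Q' => Phi_matrix lam1 lam2 (V1 r) (V2 r) (lift (c r) Q') = Phi_matrix lam1 lam2 (V1 s) (V2 s) (lift (c s) Q'))).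
      generalize (filter_and _ _ N3 (filter_and _ _ N1 N2)). apply filter_imp. intros Q (X3 & X1 & X2).
      rewrite <- X3. apply Phi_matrix_ext; assumption.
Qed.
End Phi.

Section Horizontal.
Variables lam1 lam2 : C.

(** The exponential solves the rank-1 equation. The factor [k] is left free because it may differ
    between the two sheets. *)
Lemma nablaO_exp (u1 u2 h : Cpt -> C) (k xi y : C) : onC t t' (Caff xi y) -> y <> 0 ->
  primitive_near t t' (form false) u1 (Caff xi y) -> primitive_near t t' (form true) u2 (Caff xi y) ->
  nC (Caff xi y) (fun P => h P = k * Cexp (- (lam1 * u1 P) + - (lam2 * u2 P))) ->
  nablaO_zero t t' lam1 lam2 h xi y.
Proof.
  intros HP Hy H1 H2 Hh.
  destruct (chart_exists _ HP) as (chi & kappa & W & E0 & Hch).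
  assert (D : forall b u, primitive_near t t' (form b) u (Caff xi y) -> cderiv (fun w => u (chi w)) 0 (W b 0)).
  { intros b u Hu. destruct (nC_self _ _ HP Hu) as [_ Hd].
    destruct (nbhd_plane_self _ _ (chart_derivC_elim chi kappa W Hch u) (form b xi y)) as [J [_ [K1 K2]]].
    - rewrite E0. apply (Hd xi y eq_refl Hy).
    - rewrite (K2 xi y E0 Hy b). exact K1. }
  assert (D1 := D _ _ H1). assert (D2 := D _ _ H2).
  set (d := k * ((- (lam1 * W false 0) + - (lam2 * W true 0))
     * Cexp (- (lam1 * u1 (chi 0)) + - (lam2 * u2 (chi 0))))).
  assert (Dh : cderiv (fun w => h (chi w)) 0 d).
  { apply (cderiv_ext (fun w => k * Cexp (- (lam1 * u1 (chi w)) + - (lam2 * u2 (chi w))))).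
    - rewrite <- E0 in Hh. generalize (chart_push chi kappa W Hch _ Hh). apply filter_imp. intros w ->. reflexivity.
    - apply cderiv_scal. apply (cderiv_comp Cexp (fun w => - (lam1 * u1 (chi w)) + - (lam2 * u2 (chi w)))); [apply Cexp_cderiv|].
      apply cderiv_plus; apply cderiv_opp, cderiv_scal; assumption. }
  destruct (nbhd_plane_self _ _ (chart_derivC_intro chi kappa W Hch h) d Dh) as [J [HJ [K1 K2]]].
  rewrite E0 in K1. exists (d / J). split; [exact K1|].
  rewrite (nC_self _ _ HP Hh). unfold d. rewrite E0.
  rewrite (K2 xi y E0 Hy false), (K2 xi y E0 Hy true).
  change (omega1 xi y) with (form false xi y). change (omega2 xi y) with (form true xi y).
  field. exact HJ.
Qed.

Section Germ.
Variables z1 z2 : Cpt -> C.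
Notation phi := (lift (Cinf true)).
Notation Phi := (fun Q => Phi_matrix lam1 lam2 z1 z2 (phi Q)).

Lemma Ccosh_minus_Csinh (z : C) : Ccosh z - Csinh z = Cexp (- z).
Proof. unfold Ccosh, Csinh. field. Qed.
Lemma Ccosh_plus_Csinh (z : C) : Ccosh z + Csinh z = Cexp z.
Proof. unfold Ccosh, Csinh. field. Qed.

(** The factor [xi] cancels [1 / xi], and both columns give [cosh - sinh]: they coincide on this
    sheet. *)
Lemma section_on_plus_sheet (j : nat) (xi y : C) : (j < 2)%nat -> xi <> 0 ->
  phi (fcov t' (Caff xi y)) = Caff xi y ->
  section_of t' (entry Phi 0 j) (entry Phi 1 j) (Caff xi y)
    = 1 * Cexp (- (lam1 * z1 (Caff xi y)) + - (lam2 * z2 (Caff xi y))).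
Proof.
  intros Hj Hxi E. unfold section_of, entry. rewrite E.
  rewrite Cexp_plus, <- Ccosh_minus_Csinh. cbn [xi_coord].
  destruct j as [|[|j]]; [| |lia]; unfold Phi_matrix, coeff_mat; cbn -[Cexp Ccosh Csinh Cinv Cmult Cplus Copp];
    cbn [inv_xi]; field; exact Hxi.
Qed.

(** Here [1 / xi] is taken at the opposite point, so [cosh + sinh] appears, with the sign 1 for
    [j = 0] and -1 for [j = 1]. Agreeing on one sheet and being opposite on the other makes the
    columns independent. *)
Lemma section_on_minus_sheet (j : nat) (xi y : C) : (j < 2)%nat -> xi <> 0 ->
  phi (fcov t' (Caff xi y)) = deck (Caff xi y) ->
  section_of t' (entry Phi 0 j) (entry Phi 1 j) (Caff xi y)
    = (if j then 1 else - (1)) * Cexp (- (lam1 * (eta false * z1 (deck (Caff xi y))))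
        + - (lam2 * (eta true * z2 (deck (Caff xi y))))).
Proof.
  intros Hj Hxi E. unfold section_of, entry. rewrite E. unfold eta.
  replace (- (lam1 * (- (1) * z1 (deck (Caff xi y))))) with (lam1 * z1 (deck (Caff xi y))) by ring.
  replace (- (lam2 * (1 * z2 (deck (Caff xi y))))) with (- (lam2 * z2 (deck (Caff xi y)))) by ring.
  rewrite Cexp_plus, <- (Ccosh_plus_Csinh (lam1 * _)). cbn [xi_coord].
  destruct j as [|[|j]]; [| |lia]; unfold Phi_matrix, coeff_mat; cbn -[Cexp Ccosh Csinh Cinv Cmult Cplus Copp];
    cbn [inv_xi deck]; rewrite Cinv_opp; field; exact Hxi.
Qed.

Hypothesis Hz1 : primitive_near t t' (form false) z1 (Cinf true).
Hypothesis Hz2 : primitive_near t t' (form true) z2 (Cinf true).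

Lemma xi_neq_0_near (xi y : C) : xi <> 0 ->
  nC (Caff xi y) (fun P => exists xi' y', P = Caff xi' y' /\ xi' <> 0).
Proof.
  intros H. apply nC_of_nbhd. generalize (filter_and _ _ (nbhdC_affine xi y) (clim_neq_0 _ _ H (xi_coord_lim xi y))).
  apply filter_imp. intros P [E1 E2]. eauto.
Qed.

(** A point near infinity has one preimage on each sheet; on the second sheet the primitives
    transported by [deck] are used. *)
Lemma Phi_horizontal (j : nat) : (j < 2)%nat ->
  horizontal_near t t' lam1 lam2 (entry Phi 0 j) (entry Phi 1 j) Einf.
Proof.
  intros Hj. assert (HB := punctured_inf true).
  assert (Hsec := lift_near_inf true).
  assert (L : phi Einf = Cinf true) by reflexivity.
  assert (A1 := entries_holomorphic lam1 lam2 (Cinf true) z1 z2 HB Hz1 Hz2 0 j ltac:(lia) Hj).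
  assert (A2 := entries_holomorphic lam1 lam2 (Cinf true) z1 z2 HB Hz1 Hz2 1 j ltac:(lia) Hj).
  assert (B1 := lift_push (Cinf true) _ Einf Hsec (primitive_near_open _ _ _ Hz1)).
  assert (B2 := lift_push (Cinf true) _ Einf Hsec (primitive_near_open _ _ _ Hz2)).
  assert (B3 := lift_push (Cinf true) _ Einf Hsec (nC_open _ _ (lift_retract _ HB))).
  assert (B4 := cov_open (covering_E) _ _ Hsec).
  change (nE Einf (fun Q' => (exists d, derivE t (entry Phi 0 j) Q' d) /\ (exists d, derivE t (entry Phi 1 j) Q' d) /\
    forall xi y, onC t t' (Caff xi y) -> fcov t' (Caff xi y) = Q' -> y <> 0 ->
      nablaO_zero t t' lam1 lam2 (section_of t' (entry Phi 0 j) (entry Phi 1 j)) xi y)).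
  generalize (filter_and _ _ (filter_and _ _ A1 A2) (filter_and _ _ (filter_and _ _ B1 B2) (filter_and _ _ B3 B4))).
  apply filter_imp. intros Q [[D1 D2] [[C1 C2] [C3 C4]]]. split; [exact D1|]. split; [exact D2|].
  intros xi y HX HfX Hy.
  assert (HPX : puncturedC t t' (Caff xi y)) by (apply punctured_of_fcov; rewrite HfX; apply C4).
  assert (Hxi : xi <> 0) by (intros E; apply (proj2 HPX y); rewrite E; reflexivity).
  destruct (section_self _ _ C4) as (_ & Hfphi & _).
  destruct (fcov_fibre t' (Caff xi y) (phi Q)) as [E|E]; [congruence| |].
  - rewrite <- E in C1, C2, C3.
    apply (nablaO_exp z1 z2 _ 1); auto.
    generalize (filter_and _ _ C3 (xi_neq_0_near xi y Hxi)). apply filter_imp.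
    intros P [M1 (xi' & y' & EP & Hxi')]. rewrite EP in *. apply section_on_plus_sheet; assumption.
  - assert (E' : phi Q = deck (Caff xi y)) by (rewrite E, deck_deck; reflexivity).
    apply (nablaO_exp (fun P => eta false * z1 (deck P)) (fun P => eta true * z2 (deck P)) _ (if j then 1 else - (1))); auto.
    + rewrite E. apply primitive_near_deck, C1.
    + rewrite E. apply primitive_near_deck, C2.
    + rewrite E' in C3.
      assert (C3' : nC (Caff xi y) (fun P => phi (fcov t' (deck P)) = deck P)) by exact (deck_nC (Caff xi y) _ C3).
      generalize (filter_and _ _ C3' (xi_neq_0_near xi y Hxi)). apply filter_imp.
      intros P [M1 (xi' & y' & EP & Hxi')]. rewrite EP in *. rewrite fcov_deck in M1.
      apply section_on_minus_sheet; assumption.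
Qed.

(** The determinant is [exp (- 2 lam2 z2) / xi], which is 0 at infinity and nowhere else nearby. *)
Lemma Phi_fundamental : fundamental_matrix t t' lam1 lam2 Phi.
Proof.
  split; [exact Phi_horizontal|].
  change (nE Einf (fun Q => Q <> Einf ->
    entry Phi 0 0 Q * entry Phi 1 1 Q - entry Phi 0 1 Q * entry Phi 1 0 Q <> 0)).
  generalize (filter_and _ _ (nE_onE Einf) (lift_inf_dom_near true)). apply filter_imp.
  intros [x y|] [HE HD] Hn; [|congruence].
  destruct (lift_inf_spec true x y HE HD) as (_ & Hxi & _ & _). cbv zeta in Hxi.
  assert (Hiv : inv_xi (phi (Eaff x y)) <> 0) by (cbn [lift inv_xi]; apply Cinv_neq_0, Hxi).
  unfold entry. set (P := phi (Eaff x y)) in *. clearbody P.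
  assert (E : forall e iv ch sh : C, e * ch * (e * iv * ch) - - (e * sh) * - (e * iv * sh) = e * e * iv * (ch * ch - sh * sh))
    by (intros; ring).
  unfold Phi_matrix, coeff_mat. cbn -[Cexp Ccosh Csinh Cinv Cmult Cplus Copp inv_xi].
  rewrite E, Ccosh_sqr_minus. repeat apply Cmult_neq_0; auto; try apply Cexp_neq_0.
  intros E1. apply RtoC_inj in E1. lra.
Qed.

Lemma Phi_germ : is_Phi_germ t t' lam1 lam2 z1 z2 Phi.
Proof.
  change (nC (Cinf true) (fun P => Phi (fcov t' P) = Phi_matrix lam1 lam2 z1 z2 P)).
  generalize (lift_retract _ (punctured_inf true)). apply filter_imp. intros P ->. reflexivity.
Qed.
End Germ.
End Horizontal.
End Curves.

(** * The other sheet and the monodromy matrices *)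

Lemma lift_other_sheet (t t' : C) (Q : Ept) : lift t t' (Cinf false) Q = deck (lift t t' (Cinf true) Q).
Proof.
  destruct Q as [x y|]; [|reflexivity]. cbn [lift deck]. f_equal.
  change (slope_at_infinity false) with (- slope_at_infinity true). rewrite branch_opp.
  unfold Cdiv. replace (- branch (slope_at_infinity true) (polyC_inf t t' (/ (t' - x))) * (t' - x))
    with (- (branch (slope_at_infinity true) (polyC_inf t t' (/ (t' - x))) * (t' - x))) by ring.
  rewrite Cinv_opp. ring.
Qed.

Lemma inv_xi_deck (P : Cpt) : inv_xi (deck P) = - inv_xi P.
Proof. destruct P; cbn [deck inv_xi]; [apply Cinv_opp|ring]. Qed.

(** The loops at the end of the deformation agree with [a1] and [b1] on [0, 1], while as functions
    on R they may differ; they are therefore kept apart. *)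
Lemma normalized_of_marking (t t' K K' L L' : C) (a1 b1 : R -> Cpt) :
  marking t t' K K' L L' a1 b1 -> exists A B, normalized_loops t t' K K' L L' A B /\
    (forall r, I01 r -> A r = a1 r /\ B r = b1 r).
Proof.
  intros (T & T' & KK & KK' & LL & LL' & A & B & t0 & t0' & _ & _ & _ & Hn & _ &
    (<- & <- & <- & <- & <- & <- & Hab)).
  exists (A 1%R), (B 1%R). split; [|exact Hab]. apply Hn, I01_1.
Qed.

Theorem proposition8 (t t' y0 lam1 lam2 K K' L L' : C)
    (a1 b1 : R -> Cpt) (g1 g2 : R -> Ept)
    (Htt' : admissible t t')
    (Hy0 : y0 ^ 2 = t' * (t' - 1) * (t' - t))
    (Hloops : marking t t' K K' L L' a1 b1)
    (Hg1 : simple_loop_around t t' y0 g1)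
    (Hg2 : simple_loop_around t t' (- y0) g2) :
  let a := fun r => fcov t' (a1 r) in
  let b := fun r => fcov t' (b1 r) in
  generate_pi1 t t' a b g1 g2 ->
  surface_relation t t' a b g1 g2 ->
  exists (z1 z2 : Cpt -> C) (Phi : Ept -> mat2),
    primitive_near t t' omega1 z1 (Cinf true) /\
    primitive_near t t' omega2 z2 (Cinf true) /\
    is_Phi_germ t t' lam1 lam2 z1 z2 Phi /\
    fundamental_matrix t t' lam1 lam2 Phi /\
    has_monodromy t a Phi (M_a lam1 lam2 K K') /\
    has_monodromy t b Phi (M_b lam1 lam2 L L') /\
    has_monodromy t g1 Phi M_gamma /\
    has_monodromy t g2 Phi M_gamma.
Proof.
  intros a b _ Hrel.
  destruct (normalized_of_marking _ _ _ _ _ _ _ _ Hloops) as (A & B & (HA & HB & IA1 & IA2 & IB1 & IB2) & HAB).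
  destruct (primitive_near_exists t t' Htt' false (Cinf true) I) as [u1 Hu1].
  destruct (primitive_near_exists t t' Htt' true (Cinf true) I) as [z2 Hz2].
  (* Continuation depends on the curve over [0, 1] only. *)
  assert (Hext : forall k (c c' : R -> Cpt) P0 v0 P1 v1, (forall r, I01 r -> c r = c' r) ->
    in_E t t' I01 (fun r => fcov t' (c r)) /\
    continues t t' k (fun r => fcov t' (c r)) P0 v0 P1 v1 ->
    in_E t t' I01 (fun r => fcov t' (c' r)) /\
    continues t t' k (fun r => fcov t' (c' r)) P0 v0 P1 v1).
  { intros k c c' P0 v0 P1 v1 E [H1 (l & V & Hl & H2)]. split.
    - revert H1. apply maps_on_ext. intros r Hr. rewrite E by exact Hr. reflexivity.
    - exists l, V. split; [|exact H2]. revert Hl. apply lifts_ext; [|reflexivity].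
      intros r Hr. rewrite E by exact Hr. reflexivity. }
  (* Stated for every primitive [u], since it serves for [u1], to compare the centres, and for the
     shifted [z1]. *)
  assert (Ca : forall u, primitive_near t t' (form false) u (Cinf true) ->
    in_E t t' I01 a /\ continues t t' false a (Cinf true) u (Cinf true) (fun P => u P + 2 * Ci * K)).
  { intros u Hu. apply (Hext false A a1); [intros r Hr; apply HAB, Hr|].
    apply (continues_fcov_loop t t' Htt' A false); assumption. }
  assert (Ca2 : continues t t' true a (Cinf true) z2 (Cinf true) (fun P => z2 P + 2 * Ci * K')).
  { apply (Hext true A a1); [intros r Hr; apply HAB, Hr|].
    apply (continues_fcov_loop t t' Htt' A true); assumption. }
  assert (Cb : forall u, primitive_near t t' (form false) u (Cinf true) ->
    in_E t t' I01 b /\ continues t t' false b (Cinf true) u (Cinf true) (fun P => u P + - 2 * L)).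
  { intros u Hu. apply (Hext false B b1); [intros r Hr; apply HAB, Hr|].
    apply (continues_fcov_loop t t' Htt' B false); assumption. }
  assert (Cb2 : continues t t' true b (Cinf true) z2 (Cinf true) (fun P => z2 P + - 2 * L')).
  { apply (Hext true B b1); [intros r Hr; apply HAB, Hr|].
    apply (continues_fcov_loop t t' Htt' B true); assumption. }
  destruct (continues_lasso t t' Htt' false y0 g1 u1 Hg1 Hu1) as [x1 C1].
  destruct (continues_lasso t t' Htt' false (- y0) g2 u1 Hg2 Hu1) as [x2 C2].
  destruct (continues_lasso t t' Htt' true y0 g1 z2 Hg1 Hz2) as [x1' C1'].
  destruct (continues_lasso t t' Htt' true (- y0) g2 z2 Hg2 Hz2) as [x2' C2'].
  destruct Hg1 as [[Hp1 Hend1] _]. destruct Hg2 as [[Hp2 Hend2] _].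
  assert (E1 := path_in_E t t' g1 Hp1). assert (E2 := path_in_E t t' g2 Hp2).
  destruct (Ca u1 Hu1) as [Ea Ca1]. destruct (Cb u1 Hu1) as [Eb Cb1].
  assert (Ea01 : a 0%R = Einf /\ a 1%R = Einf).
  { destruct HA as (_ & _ & A0 & A1). unfold a.
    rewrite <- (proj1 (HAB _ I01_0)), <- (proj1 (HAB _ I01_1)), A0, A1. split; reflexivity. }
  assert (Eb01 : b 0%R = Einf /\ b 1%R = Einf).
  { destruct HB as (_ & _ & B0 & B1). unfold b.
    rewrite <- (proj2 (HAB _ I01_0)), <- (proj2 (HAB _ I01_1)), B0, B1. split; reflexivity. }
  assert (Ex : x1 = x2) by (apply (surface_centres t t' Htt' a b g1 g2 u1 (2 * Ci * K) (- 2 * L)); assumption).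
  subst x2.
  (* With this constant of integration the reflections attached to [g1] and [g2] are centred at 0. *)
  set (z1 := fun P => u1 P + - x1).
  assert (Hz1 : primitive_near t t' (form false) z1 (Cinf true)) by (apply primitive_near_plus, Hu1).
  exists z1, z2, (fun Q => Phi_matrix lam1 lam2 z1 z2 (lift t t' (Cinf true) Q)).
  split; [exact Hz1|]. split; [exact Hz2|]. split; [apply Phi_germ|]. split; [apply Phi_fundamental; assumption|].
  assert (Hrefl : forall g x', in_E t t' I01 g -> g 1%R = Einf ->
    continues t t' false g (Cinf true) u1 (Cinf false) (fun P => eta false * u1 (deck P) + (1 - eta false) * x1) ->
    continues t t' true g (Cinf true) z2 (Cinf false) (fun P => eta true * z2 (deck P) + (1 - eta true) * x') ->
    has_monodromy t g (fun Q => Phi_matrix lam1 lam2 z1 z2 (lift t t' (Cinf true) Q)) M_gamma).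
  { intros g x' Eg Hg H1 H2.
    apply (monodromy_of_continues t t' Htt' lam1 lam2 g z1 z2
      (fun P => - (1) * z1 (deck P)) (fun P => z2 (deck P)) (Cinf true) (Cinf false) (Cinf false)); [exact Eg| | |].
    - apply (continues_pointwise t t' _ _ _ _ _ _ _ _ (continues_plus t t' Htt' _ _ _ _ _ _ (- x1) H1)); intros P.
      + reflexivity.
      (* The shift moves the centre to 0: [- u1 + 2 x1 - x1 = - (u1 - x1)]. *)
      + unfold z1, eta. ring.
    (* For [z2] the factor [1 - eta true] is 0, so the centre [x'] drops out. *)
    - apply (continues_pointwise t t' _ _ _ _ _ _ _ _ H2); intros P; [reflexivity|unfold eta; ring].
    - rewrite Hg. apply filter_forall. intros Q. rewrite lift_other_sheet.
      set (P := lift t t' (Cinf true) Q). unfold Phi_matrix. rewrite inv_xi_deck, deck_deck.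
      exact (Phi_reflect lam1 lam2 (z1 P) (z2 P) (inv_xi P)). }
  split; [|split; [|split]].
  - apply (monodromy_of_continues t t' Htt' lam1 lam2 a z1 z2 (fun P => z1 P + 2 * Ci * K) (fun P => z2 P + 2 * Ci * K')
      (Cinf true) (Cinf true) (Cinf true)); [exact Ea|apply Ca, Hz1|exact Ca2|].
    apply filter_forall. intros Q. apply (Phi_translate_a lam1 lam2 K K' (z1 _) (z2 _) (inv_xi _)).
  - apply (monodromy_of_continues t t' Htt' lam1 lam2 b z1 z2 (fun P => z1 P + - 2 * L) (fun P => z2 P + - 2 * L')
      (Cinf true) (Cinf true) (Cinf true)); [exact Eb|apply Cb, Hz1|exact Cb2|].
    apply filter_forall. intros Q. apply (Phi_translate_b lam1 lam2 L L' (z1 _) (z2 _) (inv_xi _)).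
  - apply (Hrefl g1 x1'); [exact E1|apply Hend1|exact C1|exact C1'].
  - apply (Hrefl g2 x2'); [exact E2|apply Hend2|exact C2|exact C2'].
Qed.
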